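(* Let $G\subseteq GL(V)$ be an irreducible exceptional complex reflection group which is not a real reflection group, i.e. one of the Shephard–Todd groups $G_4,\ldots,G_{34}$ other than $G_{23},G_{28},G_{30}$, acting on its reflection representation $V$. If $G$ is not one of $G_4,G_{12},G_{24}$, then every graded Hecke algebra for $G$ has $a_g=0$ for all $g\in G$. In the remaining cases, for $g\in G$ there exists a graded Hecke algebra $A$ for $G$ with $a_g\ne0$ if and only if: - $G=G_4$: $g$ has order $4$; - $G=G_{12}$: $g$ has order $3$ or $6$; - $G=G_{24}$: $g$ has order $3$, or $g$ has order $4$ and $\det(g)=1$. The vector space of collections $\{a_g\}_{g\in G}$ that define graded Hecke algebras for $G$ has dimension $1$ for $G_4$, $2$ for $G_{12}$, and $2$ for $G_{24}$.
   Context: Graded Hecke algebras. Let $V$ be a finite-dimensional complex vector space with basis $u_1,\dots,u_n$ and $G$ a finite subgroup of $GL(V)$. Let $\mathbb{C}G$ be the group algebra with basis $\{t_g\mid g\in G\}$, $t_gt_h=t_{gh}$. Given skew symmetric bilinear forms $a_g\colon V\times V\to\mathbb{C}$ indexed by $g\in G$, let $A$ be the associative algebra generated by $V$ and $\mathbb{C}G$ with the additional relations $$t_hvt_{h^{-1}}=hv,\qquad [v,w]=vw-wv=\sum_{g\in G}a_g(v,w)\,t_g,\qquad h\in G,\ v,w\in V.$$ These relations allow every $a\in A$ to be written as $a=\sum_{g\in G}p_gt_g$ with $p_g\in S(V)$, where $S(V)$ (the symmetric algebra) is lifted to words in $V$ by a fixed section of $T(V)\to S(V)$ (e.g. ordered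 monomials in $u_1,\dots,u_n$). $A$ is called a graded Hecke algebra for $G$ (with forms $\{a_g\}$) if $A\cong S(V)\otimes\mathbb{C}G$ as a vector space in the sense that this expression is unique for each $a\in A$, i.e. the elements $u_1^{m_1}\cdots u_n^{m_n}t_g$ ($m_i\ge 0$, $g\in G$) form a basis of $A$. Complex reflection groups. A reflection is an element of $GL(V)$ of finite order with exactly one eigenvalue not equal to $1$; a complex reflection group is a finite subgroup of $GL(V)$ generated by reflections. The groups $G_k$ are the exceptional irreducible complex reflection groups in the Shephard–Todd numbering. In particular, $G_4$ has rank $2$, order $24$ and all its reflections have order $3$; $G_{12}$ has rank $2$ and order $48$; $G_{24}$ has rank $3$ and order $336$. The real groups among $G_4,\dots,G_{37}$ are $G_{23}=H_3$, $G_{28}=F_4$, $G_{30}=H_4$, $G_{35}=E_6$, $G_{36}=E_7$, $G_{37}=E_8$. *)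

(* Defs.v *)
From HB Require Import structures.
From mathcomp Require Import all_boot all_order all_algebra.
From mathcomp Require Import all_fingroup all_solvable all_field all_character.
From mathcomp Require Import reals complex.
From mathcomp Require Import xfinmap monalg.

Set Implicit Arguments.
Unset Strict Implicit.
Unset Printing Implicit Defensive.

Import Order.TTheory GRing.Theory Num.Theory.
Local Open Scope ring_scope.

(** * Graded Hecke algebras

   [V] is [C^n] (column vectors) with basis [u_1, ..., u_n] the standard one,
   [G] is a finite group [gT] with a representation [rG], and [h] acts on [V]
   by [v |-> rG h *m v], which is a left action.  A family of bilinear forms
   [a_g] is a family of Gram matrices: [a_g(v, w) = v^T *m a g *m w]. *)

Section GradedHecke.

Variables (C : fieldType) (gT : finGroupType) (n : nat).

(* The free associative algebra on the symbols u_i (inl i) and t_g (inr g). *)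
Definition freeAlg := {malg C[{fmonom ('I_n + gT)%type}]}.

Definition gen (x : 'I_n + gT) : freeAlg := << fmu x >>.

Definition tgen (g : gT) : freeAlg := gen (inr g).

Definition vgen (v : 'cV[C]_n) : freeAlg :=
  \sum_(i < n) v i 0 *: gen (inl i).

Definition form_val (b : 'M[C]_n) (v w : 'cV[C]_n) : C :=
  (v^T *m b *m w) 0 0.

Variable rG : mx_representation C [set: gT] n.
Variable a : {ffun gT -> 'M[C]_n}.

Inductive hecke_relator : freeAlg -> Prop :=
| HeckeOne : hecke_relator (tgen 1%g - 1)
| HeckeMul (g h : gT) : hecke_relator (tgen g * tgen h - tgen (g * h)%g)
| HeckeAct (h : gT) (v : 'cV[C]_n) :
    hecke_relator (tgen h * vgen v * tgen h^-1%g - vgen (rG h *m v))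
| HeckeComm (v w : 'cV[C]_n) :
    hecke_relator (vgen v * vgen w - vgen w * vgen v
                   - \sum_(g : gT) form_val (a g) v w *: tgen g).

(* The two-sided ideal generated by the relators. *)
Inductive hecke_ideal : freeAlg -> Prop :=
| HeckeIdeal0 : hecke_ideal 0
| HeckeIdealD (x y : freeAlg) :
    hecke_ideal x -> hecke_ideal y -> hecke_ideal (x + y)
| HeckeIdealM (x r y : freeAlg) :
    hecke_relator r -> hecke_ideal (x * r * y).

(* The algebra A is freeAlg / hecke_ideal; this is equality in A. *)
Definition hecke_eq (x y : freeAlg) : Prop := hecke_ideal (x - y).

(* S(V) is the algebra of polynomials in u_1, ..., u_n; it is lifted to words
   by sending each monomial to the ordered product u_1^m_1 ... u_n^m_n. *)
Definition symAlg := {malg C[{cmonom 'I_n}]}.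

Definition sym_lift (p : symAlg) : freeAlg :=
  \sum_(m <- msupp p) p@_m *: \prod_(i < n) gen (inl i) ^+ m i.

Definition graded_hecke : Prop :=
  (forall g, (a g)^T = - a g) /\
  (forall x : freeAlg, exists! p : {ffun gT -> symAlg},
     hecke_eq x (\sum_(g : gT) sym_lift (p g) * tgen g)).

End GradedHecke.

(** * The exceptional Shephard-Todd groups which are not real *)

Section ShephardTodd.

Variable C : numClosedFieldType.

Definition zeta3 : C := (-1 + 'i * sqrtC 3) / 2.
Definition zeta8 : C := (1 + 'i) / sqrtC 2.
Definition zeta5 : C := (sqrtC 5 - 1 + 'i * sqrtC (10 + 2 * sqrtC 5)) / 4.
Definition golden : C := (1 + sqrtC 5) / 2.
Definition klein : C := (-1 + 'i * sqrtC 7) / 2.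

Definition mx_rows n (s : seq (seq C)) : 'M[C]_n :=
  \matrix_(i, j) (nth [::] s i)`_j.

(* In rank 2 we use the generators of Shephard and Todd, which are scalar
   multiples of fixed generators of the binary tetrahedral, octahedral and
   icosahedral groups; these generators need not be reflections. *)
Definition tetra_gens n (l m : C) : seq 'M[C]_n :=
  [:: l *: mx_rows n [:: [:: 'i; 0]; [:: 0; - 'i]];
      m *: ((sqrtC 2)^-1 *:
        mx_rows n [:: [:: zeta8; zeta8 ^+ 3]; [:: zeta8; zeta8 ^+ 7]])].

Definition octa_gens n (l m : C) : seq 'M[C]_n :=
  [:: l *: ((sqrtC 2)^-1 *: mx_rows n [:: [:: 'i; 1]; [:: -1; - 'i]]);
      m *: ((sqrtC 2)^-1 *:
        mx_rows n [:: [:: zeta8; zeta8]; [:: zeta8 ^+ 3; zeta8 ^+ 7]])].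

Definition icosa_gens n (l m : C) : seq 'M[C]_n :=
  let e := zeta5 in
  [:: l *: ((sqrtC 5)^-1 *:
        mx_rows n [:: [:: e ^+ 4 - e; e ^+ 2 - e ^+ 3];
                      [:: e ^+ 2 - e ^+ 3; e - e ^+ 4]]);
      m *: ((sqrtC 5)^-1 *:
        mx_rows n [:: [:: e ^+ 2 - e ^+ 4; e ^+ 4 - 1];
                      [:: 1 - e; e ^+ 3 - e]])].

(* The unitary reflection v |-> v - (1 - z) (<v, r> / <r, r>) r, which
   multiplies the root r by z and fixes its orthogonal complement. *)
Definition refl n (z : C) (r : seq C) : 'M[C]_n :=
  \matrix_(i, j) ((i == j)%:R
    - (1 - z) * r`_i * (r`_j)^* / \sum_(k < n) `|r`_k| ^+ 2).

Definition ST_rank (k : nat) : nat :=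
  if (k <= 22)%N then 2 else if (k <= 27)%N then 3
  else if (k <= 32)%N then 4 else if k == 33 then 5 else 6.

(* Generators of the Shephard-Todd group G_k; n is meant to be ST_rank k.
   In rank > 2 they are reflections in roots of the standard line systems,
   e.g. for G_34 in roots of G(3,3,6) and the all-ones vector; G_33 is the
   subsystem of G_34 orthogonal to a root, with sqrtC 2 coming from the
   orthonormal coordinates of that hyperplane. *)
Definition ST_gens (n k : nat) : seq 'M[C]_n :=
  let w := zeta3 in
  match k with
  | 4%N  => tetra_gens n (-1) (- w)
  | 5%N  => tetra_gens n (- w) (- w)
  | 6%N  => tetra_gens n 'i (- w)
  | 7%N  => tetra_gens n ('i * w) (- w)
  | 8%N  => octa_gens n (zeta8 ^+ 3) 1
  | 9%N  => octa_gens n 'i zeta8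
  | 10%N => octa_gens n (zeta8 ^+ 7 * w ^+ 2) (- w)
  | 11%N => octa_gens n 'i (zeta8 * w)
  | 12%N => octa_gens n 'i 1
  | 13%N => octa_gens n 'i 'i
  | 14%N => octa_gens n 'i (- w)
  | 15%N => octa_gens n 'i ('i * w)
  | 16%N => icosa_gens n (- zeta5 ^+ 3) 1
  | 17%N => icosa_gens n 'i ('i * zeta5 ^+ 3)
  | 18%N => icosa_gens n (- w * zeta5 ^+ 3) (w ^+ 2)
  | 19%N => icosa_gens n ('i * w) ('i * zeta5 ^+ 3)
  | 20%N => icosa_gens n 1 (w ^+ 2)
  | 21%N => icosa_gens n 'i (w ^+ 2)
  | 22%N => icosa_gens n 'i 1
  | 24%N => [seq refl n (-1) r | r <-
             [:: [:: 0; 0; 1]; [:: 0; 1; -1]; [:: 1; 1; klein]]]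
  | 25%N => [seq refl n w r | r <-
             [:: [:: 1; 0; 0]; [:: 0; 1; 0]; [:: 1; 1; 1]]]
  | 26%N => [:: refl n w [:: 1; 0; 0]; refl n w [:: 1; 1; 1];
              refl n (-1) [:: 1; -1; 0]]
  | 27%N => [seq refl n (-1) r | r <-
             [:: [:: 0; 1; 0]; [:: 1; golden; golden - 1]; [:: 0; 1; w]]]
  | 29%N => [seq refl n (-1) r | r <-
             [:: [:: 0; 1; -1; 0]; [:: 0; 0; 1; -1]; [:: 0; 0; 1; - 'i];
                 [:: 1; 1; 1; 1]]]
  | 31%N => [seq refl n (-1) r | r <-
             [:: [:: 1; -1; 0; 0]; [:: 0; 1; -1; 0]; [:: 0; 0; 1; - 'i];
                 [:: 0; 0; 0; 1]; [:: 1; 1; 1; 1]]]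
  | 32%N => [seq refl n w r | r <-
             [:: [:: 1; 0; 0; 0]; [:: 0; 1; 1; 1]; [:: 0; 0; 1; 0];
                 [:: 1; 0; 1; -1]]]
  | 33%N => [seq refl n (-1) r | r <-
             [:: [:: 1; -1; 0; 0; 0]; [:: 0; 1; -1; 0; 0];
                 [:: 0; 0; 1; -1; 0]; [:: 0; 0; 1; - w; 0];
                 [:: 1; 1; 1; 1; sqrtC 2]]]
  | 34%N => [seq refl n (-1) r | r <-
             [:: [:: 0; 1; -1; 0; 0; 0]; [:: 0; 0; 1; -1; 0; 0];
                 [:: 0; 0; 0; 1; -1; 0]; [:: 0; 0; 0; 0; 1; -1];
                 [:: 0; 0; 0; 0; 1; - w]; [:: 1; 1; 1; 1; 1; 1]]]
  | _ => [::]
  end.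

(* The image of rG in GL(V) is G_k: rG is faithful and, in a suitable basis
   of V, gT is generated by elements acting as the generators of G_k. *)
Definition is_ST_group (k : nat) (gT : finGroupType) (n : nat)
    (rG : mx_representation C [set: gT] n) : Prop :=
  [/\ n = ST_rank k, mx_faithful rG &
    exists (gs : seq gT) (P : 'M[C]_n),
      [/\ P \in unitmx, <<[set:: gs]>>%g = [set: gT] &
          [seq rG g | g <- gs] =
            [seq P *m s *m invmx P | s <- ST_gens n k]]].

End ShephardTodd.

(* Main.v *)
(* By the PBW theorem in the form of Drinfeld, the forms a_g define a graded Hecke
   algebra iff they are alternating, a_(h^-1 g h)(v, w) = a_g(h v, h w), and
   a_g(u, v) (g w - w) + cyclic = 0.  Necessity compares coefficients in the
   relations; for sufficiency the u_i and t_g act on the free module with basis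
   u^m t_h, so that no combination of the ordered words vanishes in A.

   If some z in G acts by a scalar c with c^2 <> 1, then the invariance under z
   kills every a_g.  A power of a product of the generators is such a z except in
   G_4, G_12, G_24 and G_33, whose centers are {1, -1}.  There, a_g <> 0 with
   g <> 1 forces im (g - 1) to be a plane and the centralizer of g to preserve the
   form with radical ker (g - 1), which is unique up to a scalar; conversely such a
   form spreads over the class of g by averaging.  The classes are found by exact
   computation on a lattice preserved by G.  That a list of representatives c is
   complete is certified by giving, for each c and each conjugate s of a generator,
   a word x such that x^-1 s c x is again in the list (up to sign for G_33). *)
From Stdlib Require Import BinInt.
From HB Require Import structures.
Require Import Defs.
From mathcomp Require Import all_boot all_order all_algebra.
From mathcomp Require Import all_fingroup all_solvable all_field all_character.
From mathcomp Require Import reals complex.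
From mathcomp Require Import xfinmap monalg.
From mathcomp Require Import ssrZ ring.

Set Implicit Arguments.
Unset Strict Implicit.
Unset Printing Implicit Defensive.

Import Order.TTheory GRing.Theory Num.Theory.
Local Open Scope ring_scope.

(** The element -1 preserves every bilinear form, so a center {1, -1} kills nothing by itself. What
    decides then is the shape of the cyclic condition: it is a linear relation between vectors of im
    (g - 1) with values of the form as coefficients. Three independent vectors there force the form
    to vanish, and two determine it from a single value. In rank 2 an alternating form is a multiple
    of the determinant, so it survives at [g] exactly when all of the centralizer has determinant 1.
    Existence needs invariance under a full centralizer, so G_4, G_12 and G_24 (orders 24, 48, 336)
    are enumerated. For G_33 (order 51840) only vanishing is at stake, and one suitable commuting
    element per class is enough. The obstacle to sufficiency is that the operators of the u_i and
    t_g on ordered words must be defined before any relation between them is known: moving u_i past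
    u_k creates t_g, and t_g turns letters into combinations of the u_j. Recursion on the degree
    breaks this circle, and the relations are then proved together by induction on the degree.
    Matrices are computed over towers of quadratic rings, with denominators cleared by a known
    scalar. *)

Section LinearExtension.

Variables (C : fieldType) (K : choiceType) (V : lmodType C) (f : K -> V).

(** The action of the free algebra, the section [lift] and the splitting into components are all
    instances of this extension from a basis. *)
Definition lext (x : {malg C[K]}) : V := \sum_(k <- msupp x) x@_k *: f k.

Lemma lextEw (d : {fset K}) x :
  (msupp x `<=` d)%fset -> lext x = \sum_(k <- d) x@_k *: f k.
Proof.
move=> le; rewrite /lext (big_fset_incl _ le) //= => k _ /mcoeff_outdom ->.
by rewrite scale0r.
Qed.

Lemma lextU c k : lext << c *g k >> = c *: f k.
Proof. by rewrite (lextEw msuppU_le) big_seq_fset1 mcoeffUU. Qed.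

Lemma lextB x y : lext (x - y) = lext x - lext y.
Proof.
rewrite [in RHS](lextEw (fsubsetUl _ (msupp y))).
rewrite [in RHS](lextEw (fsubsetUr (msupp x) _)).
rewrite (lextEw (msuppB_le _ _)) -sumrB.
by apply: eq_bigr => k _; rewrite mcoeffB scalerBl.
Qed.

Lemma lextZ c x : lext (c *: x) = c *: lext x.
Proof.
rewrite (lextEw (msuppZ_le _ _)) scaler_sumr.
by apply: eq_bigr => k _; rewrite mcoeffZ scalerA.
Qed.

HB.instance Definition _ := GRing.isZmodMorphism.Build {malg C[K]} V lext lextB.
HB.instance Definition _ := GRing.isScalable.Build C {malg C[K]} V *:%R lext lextZ.

End LinearExtension.

Lemma eq_lext (C : fieldType) (K : choiceType) (V : lmodType C)
    (f g : K -> V) (x : {malg C[K]}) :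
  (forall k, k \in msupp x -> f k = g k) -> lext f x = lext g x.
Proof.
by move=> fg; rewrite /lext; apply: eq_big_seq => k kx; rewrite fg.
Qed.

Lemma malgE_scale (C : fieldType) (K : choiceType) (x : {malg C[K]}) :
  x = \sum_(k <- msupp x) x@_k *: << k >>.
Proof.
rewrite {1}(monalgE x); apply: eq_bigr => k _.
by apply/malgP => l; rewrite mcoeffZ !mcoeffU mulrnAr mulr1.
Qed.

Lemma malg_scaleAr (C : fieldType) (K : monomType) (c : C)
    (x y : {malg C[K]}) : x * (c *: y) = c *: (x * y).
Proof.
rewrite (malgMEw (fsubset_refl _) (msuppZ_le c y)) malgME.
rewrite scaler_sumr; apply: eq_bigr => k _; rewrite scaler_sumr.
apply: eq_bigr => l _; apply/malgP => j.
by rewrite !mcoeffsE mulrnAr mulrCA.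
Qed.

Lemma lext_lext (C : fieldType) (K J : choiceType) (V : lmodType C)
    (f : J -> V) (g : K -> {malg C[J]}) (x : {malg C[K]}) :
  lext f (lext g x) = lext (fun k => lext f (g k)) x.
Proof.
rewrite [lext g x]/lext linear_sum; apply: eq_bigr => k _.
by rewrite linearZ.
Qed.

(** * Drinfeld's conditions *)

Section FormVal.

Variables (C : fieldType) (n : nat).
Implicit Types (b : 'M[C]_n) (v w : 'cV[C]_n).

Lemma form_val_mulmx b (M N : 'M[C]_n) v w :
  form_val b (M *m v) (N *m w) = form_val (M^T *m b *m N) v w.
Proof. by rewrite /form_val trmx_mul !mulmxA. Qed.

Lemma form_val_delta b i j : form_val b (delta_mx i 0) (delta_mx j 0) = b i j.
Proof. by rewrite /form_val trmx_delta -rowE -colE mxE mxE. Qed.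

Lemma form_val_trmx b v w : form_val b^T v w = form_val b w v.
Proof.
rewrite /form_val; have -> : v^T *m b^T *m w = (w^T *m b *m v)^T.
  by rewrite !trmx_mul trmxK mulmxA.
by rewrite mxE.
Qed.

Lemma form_valNl b v w : form_val (- b) v w = - form_val b v w.
Proof. by rewrite /form_val mulmxN mulNmx mxE. Qed.

Lemma form_val0 v w : form_val 0 v w = 0.
Proof. by rewrite /form_val mulmx0 mul0mx mxE. Qed.

Lemma form_val_sum b v w :
  form_val b v w = \sum_i \sum_j v i 0 * w j 0 * b i j.
Proof.
rewrite /form_val mxE exchange_big /=; apply: eq_bigr => j _.
rewrite mxE mulr_suml; apply: eq_bigr => i _.
by rewrite !mxE mulrAC.
Qed.

Lemma form_valDl b v1 v2 w :
  form_val b (v1 + v2) w = form_val b v1 w + form_val b v2 w.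
Proof. by rewrite /form_val linearD /= !mulmxDl mxE. Qed.

Lemma form_valDr b v w1 w2 :
  form_val b v (w1 + w2) = form_val b v w1 + form_val b v w2.
Proof. by rewrite /form_val mulmxDr mxE. Qed.

Lemma form_valZl b c v w : form_val b (c *: v) w = c * form_val b v w.
Proof. by rewrite /form_val linearZ /= -!scalemxAl mxE. Qed.

Lemma form_valZr b c v w : form_val b v (c *: w) = c * form_val b v w.
Proof. by rewrite /form_val -scalemxAr mxE. Qed.

Lemma form_eqP b1 b2 : (forall v w, form_val b1 v w = form_val b2 v w) -> b1 = b2.
Proof. by move=> e; apply/matrixP => i j; rewrite -!form_val_delta e. Qed.

Definition alternating_form b := b^T = - b.

Lemma form_val_skew b v w : alternating_form b -> form_val b v w = - form_val b w v.
Proof. by move=> sb; rewrite -form_valNl -sb form_val_trmx. Qed.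

End FormVal.

Lemma jacobi_ring (R : pzRingType) (x y z : R) :
  (y * z - z * y) * x - x * (y * z - z * y)
  + ((z * x - x * z) * y - y * (z * x - x * z))
  + ((x * y - y * x) * z - z * (x * y - y * x)) = 0.
Proof.
rewrite !mulrBr !mulrBl !mulrA !opprB !addrA.
(* The twelve monomials form six cancelling pairs. *)
rewrite (ACl ((1*8)*(2*11)*(3*6)*(4*9)*(5*12)*(7*10))) /=.
by rewrite !subrr !addNr !addr0.
Qed.

(** * Consequences of the Hecke relations modulo a two-sided ideal *)

Section Congruence.

Variables (C : fieldType) (R : lalgType C) (I : R -> Prop).
Hypotheses (scaleAr : forall (c : C) (x y : R), x * (c *: y) = c *: (x * y))
  (I0 : I 0) (ID : forall x y, I x -> I y -> I (x + y))
  (IMl : forall y x, I x -> I (y * x)) (IMr : forall y x, I x -> I (x * y)).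

Definition congr_mod x y := I (x - y).
Local Notation "x === y" := (congr_mod x y) (at level 70).

Lemma cgr_refl x : x === x.
Proof. by rewrite /congr_mod subrr. Qed.

Lemma cgrMl z x y : x === y -> z * x === z * y.
Proof. by rewrite /congr_mod -mulrBr; apply: IMl. Qed.

Lemma cgrMr z x y : x === y -> x * z === y * z.
Proof. by rewrite /congr_mod -mulrBl; apply: IMr. Qed.

Lemma cgrZ c x y : x === y -> c *: x === c *: y.
Proof.
rewrite /congr_mod -scalerBr -[X in _ -> I (_ *: X)]mul1r scalerAl.
exact: IMl.
Qed.

Lemma cgrN x y : x === y -> - x === - y.
Proof. by rewrite -2!scaleN1r; apply: cgrZ. Qed.

Lemma cgr_sym x y : x === y -> y === x.
Proof. by move/cgrN; rewrite /congr_mod opprK addrC. Qed.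

Lemma cgr_trans y x z : x === y -> y === z -> x === z.
Proof. by rewrite /congr_mod => xy yz; rewrite -(subrKA y); apply: ID. Qed.

Lemma cgrD x1 x2 y1 y2 : x1 === y1 -> x2 === y2 -> x1 + x2 === y1 + y2.
Proof. by rewrite /congr_mod opprD addrACA; apply: ID. Qed.

Lemma cgrB x1 x2 y1 y2 : x1 === y1 -> x2 === y2 -> x1 - x2 === y1 - y2.
Proof. by move=> e1 e2; apply/cgrD/cgrN. Qed.

Lemma cgrM x1 x2 y1 y2 : x1 === y1 -> x2 === y2 -> x1 * x2 === y1 * y2.
Proof. by move=> e1 e2; apply: cgr_trans (cgrMl _ e2); apply: cgrMr. Qed.

Lemma cgr_sum (J : Type) (r : seq J) (P : pred J) (F G : J -> R) :
  (forall j, P j -> F j === G j) ->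
  \sum_(j <- r | P j) F j === \sum_(j <- r | P j) G j.
Proof.
move=> FG; elim/big_rec2: _ => [|j x y Pj xy]; first exact: cgr_refl.
exact/cgrD/xy/FG.
Qed.

Variables (gT : finGroupType) (n : nat) (rG : mx_representation C [set: gT] n).
Variables (a : gT -> 'M[C]_n) (t : gT -> R) (u : {linear 'cV[C]_n -> R}).

Definition kappa v w : R := \sum_(g : gT) form_val (a g) v w *: t g.

Hypotheses (t1 : t 1%g === 1) (tM : forall g h, t g * t h === t (g * h)%g)
  (tuV : forall h v, t h * u v * t h^-1%g === u (rG h *m v))
  (comm : forall v w, u v * u w - u w * u v === kappa v w).

Lemma cgr_tVK h : t h^-1%g * t h === 1.
Proof. by apply: cgr_trans (tM _ _) _; rewrite mulVg. Qed.

Lemma cgr_tu h v : t h * u v === u (rG h *m v) * t h.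
Proof.
apply: cgr_trans _ (cgrMr (t h) (tuV h v)).
rewrite -[X in X === _]mulr1 -[X in _ === X]mulrA.
exact/cgrMl/cgr_sym/cgr_tVK.
Qed.

(** Conjugating the commutator of v and w by t_h gives the commutator of hv and hw, while it carries
    t_g to the t of h g h^-1; the right side is the sum reindexed accordingly. *)
Lemma cgr_comm_conj h v w :
  kappa (rG h *m v) (rG h *m w)
  === \sum_g form_val (a (g ^ h)%g) v w *: t g.
Proof.
have e x y : u (rG h *m x) * u (rG h *m y) === t h * (u x * u y) * t h^-1%g.
  apply: cgr_trans (cgr_sym (cgrM (tuV h x) (tuV h y))) _.
  rewrite -!mulrA; do 2!apply: cgrMl.
  by rewrite [X in X === _]mulrA -[X in _ === X]mul1r; apply/cgrMr/cgr_tVK.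
apply: cgr_trans (cgr_sym (comm _ _)) _.
apply: cgr_trans (cgrB (e v w) (e w v)) _.
rewrite -mulrBl -mulrBr.
apply: cgr_trans (cgrMr _ (cgrMl _ (comm v w))) _.
rewrite [X in _ === X](reindex_inj (conjg_inj h^-1%g)).
rewrite mulr_sumr mulr_suml; apply: cgr_sum => g _.
rewrite conjgKV scaleAr -scalerAl; apply: cgrZ.
apply: cgr_trans (cgrMr _ (tM _ _)) _.
apply: cgr_trans (tM _ _) _.
by rewrite conjgE invgK mulgA; apply: cgr_refl.
Qed.

(** Each double commutator [[y, z], x] is the sum of a_h(y, z) (t_h x - x t_h), and [cgr_tu] turns
    t_h x into (hx) t_h. The Jacobi identity of the associative algebra then adds up to 0. *)
Lemma cgr_jacobi x y z :
  \sum_h (form_val (a h) y z *: u (rG h *m x - x)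
          + form_val (a h) z x *: u (rG h *m y - y)
          + form_val (a h) x y *: u (rG h *m z - z)) * t h === 0.
Proof.
have e p q r : (u q * u r - u r * u q) * u p - u p * (u q * u r - u r * u q)
   === \sum_h (form_val (a h) q r *: u (rG h *m p - p)) * t h.
  apply: cgr_trans (cgrB (cgrMr _ (comm _ _)) (cgrMl _ (comm _ _))) _.
  rewrite mulr_suml mulr_sumr -sumrB; apply: cgr_sum => h _.
  rewrite scaleAr -!scalerAl -scalerBr; apply: cgrZ.
  by rewrite linearB mulrBl; apply: cgrB (cgr_refl _); apply: cgr_tu.
have := cgrD (cgrD (e x y z) (e y z x)) (e z x y).
rewrite jacobi_ring => /cgr_sym; congr (_ === _).
by rewrite -!big_split; apply: eq_bigr => h _; rewrite !mulrDl.
Qed.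

End Congruence.

Section HeckeIdeal.

Variables (C : fieldType) (gT : finGroupType) (n : nat).
Variable rG : mx_representation C [set: gT] n.
Variable a : {ffun gT -> 'M[C]_n}.

Local Notation A := (freeAlg C gT n).
Local Notation t := (@tgen C gT n).
Local Notation u := (@vgen C gT n).
Local Notation I := (hecke_ideal rG a).
Local Notation "x === y" := (congr_mod I x y) (at level 70).

Lemma hecke_ideal_rel x : hecke_relator rG a x -> I x.
Proof. by move=> /(HeckeIdealM 1 1); rewrite mul1r mulr1. Qed.

Lemma hecke_idealMl y x : I x -> I (y * x).
Proof.
elim=> [|x1 x2 _ i1 _ i2|x1 r x2 rr]; first by rewrite mulr0; apply: HeckeIdeal0.
  by rewrite mulrDr; apply: HeckeIdealD.
by rewrite !mulrA; apply: HeckeIdealM.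
Qed.

Lemma hecke_idealMr y x : I x -> I (x * y).
Proof.
elim=> [|x1 x2 _ i1 _ i2|x1 r x2 rr]; first by rewrite mul0r; apply: HeckeIdeal0.
  by rewrite mulrDl; apply: HeckeIdealD.
by rewrite -mulrA; apply: HeckeIdealM.
Qed.

Lemma vgen_linear c v w : u (c *: v + w) = c *: u v + u w.
Proof.
rewrite /vgen scaler_sumr -big_split /=; apply: eq_bigr => i _.
by rewrite !mxE scalerDl scalerA.
Qed.

HB.instance Definition _ := GRing.isLinear.Build C 'cV[C]_n A *:%R u vgen_linear.

Lemma cgr_t1 : t 1%g === 1.
Proof. exact/hecke_ideal_rel/HeckeOne. Qed.

Lemma cgr_tM g h : t g * t h === t (g * h)%g.
Proof. exact/hecke_ideal_rel/HeckeMul. Qed.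

Lemma cgr_tuV h v : t h * u v * t h^-1%g === u (rG h *m v).
Proof. exact/hecke_ideal_rel/HeckeAct. Qed.

Lemma cgr_comm v w : u v * u w - u w * u v === kappa a t v w.
Proof. exact/hecke_ideal_rel/HeckeComm. Qed.

End HeckeIdeal.

Section OrderedWords.

Variables (C : fieldType) (gT : finGroupType) (n : nat).

Definition wordmon (m : {cmonom 'I_n}) : freeAlg C gT n :=
  \prod_(i < n) gen C (inl gT i) ^+ m i.

(** No commutativity is involved: the factors before [x k] have exponent 0, so [x k] written in
    front merges with its own power. *)
Lemma prodX_below (R : pzSemiRingType) (d : nat) (x : 'I_d -> R) (m : 'I_d -> nat)
    (k : 'I_d) :
  (forall j : 'I_d, (j < k)%N -> m j = 0%N) ->
  \prod_(i < d) x i ^+ ((k == i) + m i) = x k * \prod_(i < d) x i ^+ m i.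
Proof.
elim: d x m k => [|d IH] x m; first by case.
move=> k; rewrite !big_ord_recl; case: (unliftP ord0 k) => [j|] -> m0 /=.
  rewrite m0 // !expr0 !mul1r -IH.
    by apply: eq_bigr => i _; rewrite (inj_eq lift_inj).
  by move=> i ij; rewrite m0.
by rewrite exprS mulrA.
Qed.

Lemma wordmon1 : wordmon mone = 1.
Proof. by apply: big1 => i _; rewrite cm1. Qed.

Lemma wordmonU (k : 'I_n) (m : {cmonom 'I_n}) : (forall j : 'I_n, (j < k)%N -> m j = 0%N) ->
  wordmon (mmul (ucm k) m) = gen C (inl gT k) * wordmon m.
Proof.
move=> m0; rewrite -(prodX_below (fun i => gen C (inl gT i)) m0).
by apply: eq_bigr => i _; rewrite cmM cmU.
Qed.

End OrderedWords.

Section Drinfeld.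

Variables (C : fieldType) (gT : finGroupType) (n : nat).
Variable rG : mx_representation C [set: gT] n.

Definition jacobi_at (M b : 'M[C]_n) : Prop :=
  forall u v w : 'cV[C]_n,
    form_val b v w *: (M *m u - u) + form_val b w u *: (M *m v - v)
    + form_val b u v *: (M *m w - w) = 0.

Definition drinfeld (a : {ffun gT -> 'M[C]_n}) : Prop :=
  [/\ forall g, alternating_form (a g),
      forall g h, (rG h)^T *m a g *m rG h = a (g ^ h)%g
    & forall g, jacobi_at (rG g) (a g)].

End Drinfeld.

(** * Necessity of Drinfeld's conditions *)

Section Necessity.

Variables (C : fieldType) (gT : finGroupType) (n : nat).
Variable rG : mx_representation C [set: gT] n.
Variable a : {ffun gT -> 'M[C]_n}.
Hypothesis aP : graded_hecke rG a.

Local Notation A := (freeAlg C gT n).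
Local Notation t := (@tgen C gT n).
Local Notation u := (@vgen C gT n).
Local Notation I := (hecke_ideal rG a).
Local Notation "x === y" := (congr_mod I x y) (at level 70).

Lemma sym_lift_lext (p : symAlg C n) :
  sym_lift gT p = lext (fun m : {cmonom 'I_n} => \prod_(i < n) gen C (inl gT i) ^+ m i) p.
Proof. by []. Qed.

(** Both families are expressions of the same element of A, namely the left side, so the [exists!]
    of [graded_hecke] at that element identifies them. *)
Lemma graded_hecke_uniq (p q : gT -> symAlg C n) :
  \sum_(g : gT) sym_lift gT (p g) * t g === \sum_(g : gT) sym_lift gT (q g) * t g ->
  p =1 q.
Proof.
move=> pq g; have [_ /(_ (\sum_(g : gT) sym_lift gT (p g) * t g))] := aP.
case=> p0 [_ uniq].
have e (r : gT -> symAlg C n) :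
    \sum_(g : gT) sym_lift gT (finfun r g) * t g = \sum_(g : gT) sym_lift gT (r g) * t g.
  by apply: eq_bigr => i _; rewrite (ffunE r i).
have e1 : p0 = finfun p.
  by apply: uniq; rewrite [X in hecke_eq _ _ _ X]e /hecke_eq subrr; apply: HeckeIdeal0.
have e2 : p0 = finfun q by apply: uniq; rewrite [X in hecke_eq _ _ _ X]e.
by rewrite -(ffunE p g) -(ffunE q g) -e1 -e2.
Qed.

Lemma sym_liftC (c : C) : sym_lift gT (<< c *g mone >> : symAlg C n) = c *: 1.
Proof.
by rewrite sym_lift_lext lextU big1 // => i _; rewrite cm1 expr0.
Qed.

Definition sym_vec (v : 'cV[C]_n) : symAlg C n :=
  \sum_(i < n) << v i 0 *g ucm i >>.

Lemma sym_lift_vec v : sym_lift gT (sym_vec v) = u v.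
Proof.
rewrite sym_lift_lext linear_sum /=; apply: eq_bigr => i _.
rewrite lextU; congr (_ *: _).
have := @wordmonU C gT n i mone; rewrite mulm1 wordmon1 mulr1; apply.
by move=> j _; rewrite cm1.
Qed.

Lemma sym_vec_eq0 v : sym_vec v = 0 -> v = 0.
Proof.
move=> v0; apply/matrixP => i j; rewrite ord1 mxE {j}.
have e j : << v j 0 *g ucm j >>@_(ucm i) = v j 0 *+ (j == i).
  rewrite mcoeffU; congr (_ *+ nat_of_bool _).
  apply/eqP/eqP => [/eqP/cmP/(_ i)|-> //].
  by rewrite !cmU eqxx; case: eqP.
have := congr1 (mcoeff (ucm i)) v0.
rewrite mcoeff0 (big_morph (mcoeff (ucm i)) (mcoeffD _) (mcoeff0 _)).
rewrite (eq_bigr _ (fun j _ => e j)) (bigD1 i) //= eqxx big1 ?addr0 // => j.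
by move=> /negbTE ->.
Qed.

Lemma kappa_uniq (c d : gT -> C) :
  \sum_g c g *: t g === \sum_g d g *: t g -> c =1 d.
Proof.
move=> cd g.
have e (f : gT -> C) : \sum_(g : gT) sym_lift gT (<< f g *g mone >> : symAlg C n) * t g
   = \sum_g f g *: t g.
  by apply: eq_bigr => x _; rewrite sym_liftC -scalerAl mul1r.
move: cd; rewrite -[X in X === _](e c) -[X in _ === X](e d) => cd.
have cdg := @graded_hecke_uniq (fun g => << c g *g mone >>)
  (fun g => << d g *g mone >>) cd g.
rewrite -[LHS](mcoeffUU (mone : {cmonom 'I_n})) -[RHS](mcoeffUU (mone : {cmonom 'I_n})).
exact: congr1 cdg.
Qed.

Lemma graded_hecke_equiv g h : (rG h)^T *m a g *m rG h = a (g ^ h)%g.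
Proof.
apply: form_eqP => v w; rewrite -form_val_mulmx.
apply: (@kappa_uniq (fun g => form_val (a g) (rG h *m v) (rG h *m w))
  (fun g => form_val (a (g ^ h)%g) v w) _ g).
apply: cgr_comm_conj.
- exact: malg_scaleAr.
- exact: HeckeIdeal0.
- exact: HeckeIdealD.
- exact: hecke_idealMl.
- exact: hecke_idealMr.
- exact: cgr_t1.
- exact: cgr_tM.
- exact: cgr_tuV.
- exact: cgr_comm.
Qed.

(** [cgr_jacobi] writes 0 with a coefficient of degree one in front of each t_h; uniqueness makes
    every one of these coefficients zero. *)
Lemma graded_hecke_jacobi g : jacobi_at (rG g) (a g).
Proof.
move=> x y z.
pose cy (h : gT) := form_val (a h) y z *: (rG h *m x - x)
  + form_val (a h) z x *: (rG h *m y - y) + form_val (a h) x y *: (rG h *m z - z).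
rewrite -/(cy g); apply: sym_vec_eq0.
apply: (@graded_hecke_uniq (fun h => sym_vec (cy h)) (fun=> 0) _ g).
rewrite [X in _ === X]big1; last by move=> h _; rewrite sym_lift_lext linear0 mul0r.
rewrite (eq_bigr (fun h => (form_val (a h) y z *: u (rG h *m x - x)
          + form_val (a h) z x *: u (rG h *m y - y)
          + form_val (a h) x y *: u (rG h *m z - z)) * t h)); last first.
  by move=> h _; rewrite sym_lift_vec !linearD !linearZ.
apply: cgr_jacobi.
- exact: malg_scaleAr.
- exact: HeckeIdeal0.
- exact: HeckeIdealD.
- exact: hecke_idealMl.
- exact: hecke_idealMr.
- exact: cgr_t1.
- exact: cgr_tM.
- exact: cgr_tuV.
- exact: cgr_comm.
Qed.

End Necessity.

(** * The module with basis the ordered words *)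

HB.lock Definition mU (n : nat) (k : 'I_n) (m : {cmonom 'I_n}) : {cmonom 'I_n} :=
  mmul (ucm k) m.

Section Monomials.

Variable n : nat.
Implicit Types (i j k : 'I_n) (m : {cmonom 'I_n}).

Lemma mUE k m j : mU k m j = ((k == j) + m j)%N.
Proof. by rewrite mU.unlock cmM cmU. Qed.

Lemma mUC i k m : mU i (mU k m) = mU k (mU i m).
Proof. by apply/eqP/cmP => j; rewrite !mUE addnCA. Qed.

Lemma mdegmU k m : mdeg (mU k m) = (mdeg m).+1.
Proof. by rewrite mU.unlock mdegM mdegU. Qed.

(** This is the condition for the ordered word of [m] to stay ordered when u_k is written in front
    of it. It allows [m] to contain u_k itself. *)
Definition below k m := [forall j : 'I_n, (j < k)%N ==> (m j == 0%N)].

Lemma belowP k m : reflect (forall j : 'I_n, (j < k)%N -> m j = 0%N) (below k m).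
Proof.
apply: (iffP forallP) => [h j jk|h j]; first by apply/eqP; move/implyP: (h j); apply.
by apply/implyP => jk; apply/eqP/h.
Qed.

Lemma below_mU k i m : (k <= i)%N -> below k (mU i m) = below k m.
Proof.
move=> ki; apply: eq_forallb => j; rewrite mUE.
case: ltnP => //= jk; suff /negbTE -> : i != j by [].
by apply/eqP => e; move: jk; rewrite -e ltnNge ki.
Qed.

Lemma below_trans i k m : (i <= k)%N -> below k m -> below i m.
Proof.
move=> ik /belowP h; apply/belowP => j ji; apply: h; exact: leq_trans ji ik.
Qed.

Lemma below1 k : below k mone.
Proof. by apply/belowP => j _; rewrite cm1. Qed.

(** The first letter of the ordered word of [m] together with the rest of that word; by [monP] and
    [mheadU], [None] occurs only for the empty word. *)
Definition mhead m : option ('I_n * {cmonom 'I_n}) :=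
  if [pick k | (m k != 0%N) && below k m] is Some k then Some (k, divcm m (ucm k))
  else None.

Lemma mheadU k m : below k m -> mhead (mU k m) = Some (k, m).
Proof.
move=> bkm; rewrite /mhead; case: pickP => [j|/(_ k)]; last first.
  by rewrite mUE eqxx below_mU // bkm.
rewrite mUE => /andP[mj /belowP bj].
have e : j = k.
  apply/eqP; rewrite eq_sym; apply/negPn/negP => kj.
  move: mj; rewrite (negbTE kj) => mj.
  have jk : (k <= j)%N.
    by rewrite leqNgt; apply/negP => jk; move/belowP/(_ j jk): bkm mj => ->.
  have := bj k; rewrite mUE eqxx ltn_neqAle jk andbT; move: kj; rewrite -val_eqE.
  by move=> -> /(_ isT).
rewrite e; congr (Some (_, _)); apply/eqP/cmP => i.
by rewrite divcmE mUE ucmE addKn.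
Qed.

Lemma monP m : m = mone \/ exists k m', below k m' /\ m = mU k m'.
Proof.
case: (pickP (fun k => m k != 0%N)) => [k0 mk0|m0]; last first.
  by left; apply/eqP/cmP => j; rewrite cm1; apply/eqP; have := m0 j; case: eqP.
right; case: (@arg_minnP _ k0 (fun k => m k != 0%N) val mk0) => k mk kmin.
have bk : forall j : 'I_n, (j < k)%N -> m j = 0%N.
  by move=> j jk; apply/eqP/negPn/negP => /kmin; rewrite leqNgt jk.
exists k, (divcm m (ucm k)); split.
  by apply/belowP => j jk; rewrite divcmE bk.
apply/eqP/cmP => j; rewrite mUE divcmE ucmE subnKC //.
by case: eqP => // <-; rewrite lt0n.
Qed.

Lemma mon_ind (P : {cmonom 'I_n} -> Prop) : P mone ->
  (forall k m, below k m -> P m -> P (mU k m)) -> forall m, P m.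
Proof.
move=> P1 PU m; move: {2}(mdeg m) (leqnn (mdeg m)) => d; elim: d m => [|d IH] m.
  by rewrite leqn0 => /eqP/mdeg_eq0I ->.
have [-> //|[k [m' [bk ->]]]] := monP m.
by rewrite mdegmU => md; apply/PU/IH.
Qed.

End Monomials.

Section FreeModule.

Variables (C : fieldType) (gT : finGroupType) (n : nat).
Variable rG : mx_representation C [set: gT] n.
Variable a : {ffun gT -> 'M[C]_n}.
Hypotheses (a_alt : forall g i, a g i i = 0)
  (a_skew : forall g, alternating_form (a g))
  (a_equiv : forall g h, (rG h)^T *m a g *m rG h = a (g ^ h)%g)
  (a_jac : forall g, jacobi_at (rG g) (a g)).

Local Notation K := ({cmonom 'I_n} * gT)%type.

Variables (V : lmodType C) (e : K -> V) (ext : (K -> V) -> {linear V -> V}).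
Hypothesis extE : forall f k, ext f (e k) = f k.

Implicit Types (i j : 'I_n) (m : {cmonom 'I_n}) (g h : gT) (x y : V).

(** The filtration of [V] by the degree of the polynomial part. The inductive form reduces the
    equality of two linear maps on it to basis vectors ([eq_bnd]). *)
Inductive bnd (d : nat) : V -> Prop :=
| bnd0 : bnd d 0
| bndS c k x : (mdeg k.1 <= d)%N -> bnd d x -> bnd d (c *: e k + x).

Lemma bndD d x y : bnd d x -> bnd d y -> bnd d (x + y).
Proof.
by elim=> [|c k z kd _ IH] by_; rewrite ?add0r // -addrA; apply/bndS/IH.
Qed.

Lemma bndZ d c x : bnd d x -> bnd d (c *: x).
Proof.
elim=> [|b k z kd _ IH]; first by rewrite scaler0; apply: bnd0.
by rewrite scalerDr scalerA; apply: bndS.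
Qed.

Lemma bndW d d' x : (d <= d')%N -> bnd d x -> bnd d' x.
Proof.
move=> dd'; elim=> [|b k z kd _ IH]; first exact: bnd0.
by apply: bndS => //; apply: leq_trans dd'.
Qed.

Lemma bnd_sum (J : Type) (r : seq J) (F : J -> V) d :
  (forall z : J, bnd d (F z)) -> bnd d (\sum_(z <- r) F z).
Proof. by move=> b; elim/big_rec: _ => [|z x _]; [apply: bnd0 | apply/bndD/b]. Qed.

Lemma bnd_e k : bnd (mdeg k.1) (e k).
Proof. by rewrite -[e k]scale1r -[_ *: _]addr0; apply/bndS/bnd0. Qed.

Lemma bnd_ext d d' (f : {linear V -> V}) x :
  (forall k, (mdeg k.1 <= d)%N -> bnd d' (f (e k))) -> bnd d x -> bnd d' (f x).
Proof.
move=> fd; elim=> [|c k y kd _ IH]; first by rewrite linear0; apply: bnd0.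
by rewrite linearD linearZ; apply/bndD/IH/bndZ/fd.
Qed.

(** Unbundled linearity, since the maps to be compared are composites and sums of operators written
    as plain functions. *)
Definition lin (f : V -> V) := forall c x y, f (c *: x + y) = c *: f x + f y.

Lemma lin_lin (f : {linear V -> V}) : lin f.
Proof. exact: linearP. Qed.

Lemma lin_comp (f f' : V -> V) : lin f -> lin f' -> lin (fun x => f (f' x)).
Proof. by move=> lf lg c x y; rewrite lg lf. Qed.

Lemma lin_add (f f' : V -> V) : lin f -> lin f' -> lin (fun x => f x + f' x).
Proof. by move=> lf lg c x y; rewrite lf lg scalerDr addrACA. Qed.

Lemma lin_sum (J : finType) (c : J -> C) (F : J -> V -> V) :
  (forall z, lin (F z)) -> lin (fun x => \sum_z c z *: F z x).
Proof.
move=> lF b x y; rewrite scaler_sumr -big_split; apply: eq_bigr => z _.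
by rewrite lF scalerDr !scalerA mulrC.
Qed.

Lemma eq_bnd d (f g : V -> V) x : lin f -> lin g ->
  (forall k, (mdeg k.1 <= d)%N -> f (e k) = g (e k)) -> bnd d x -> f x = g x.
Proof.
have lin0 (f' : V -> V) : lin f' -> f' 0 = 0.
  by move/(_ (-1) 0 0); rewrite !scaleN1r !addNr.
move=> lf lg fg; elim=> [|c k y kd _ IH]; first by rewrite !lin0.
by rewrite lf lg IH fg.
Qed.

Definition top (i : 'I_n) (b : K) : V := e (mU i b.1, b.2).

(* e (m, h) stands for u^m t_h.  Moving u_i to its place in the ordered monomial
   past the leading u_k costs the commutator sum_g a_g(u_i, u_k) t_g; every
   operator called on the right acts in smaller degree, which d bounds. *)
Fixpoint ops (d : nat) : ('I_n -> K -> V) * (gT -> K -> V) :=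
  if d is d'.+1 then
    let L := (ops d').1 in let T := (ops d').2 in
    (fun i b =>
       if (mdeg b.1 <= d')%N then L i b else
       if mhead b.1 is Some (k, m) then
         if (i <= k)%N then top i b else
         top i b + ext (L k) (L i (m, b.2) - top i (m, b.2))
         + \sum_g a g i k *: T g (m, b.2)
       else 0,
     fun g b =>
       if (mdeg b.1 <= d')%N then T g b else
       if mhead b.1 is Some (k, m) then
         \sum_j rG g j k *: ext (L j) (T g (m, b.2))
       else 0)
  else (fun i b => top i b, fun g b => e (b.1, (g * b.2)%g)).

(** Step [d.+1] of the recursion falls back on step [d] in degree at most [d], so every bound above
    the degree gives the same operators. This justifies taking the degree itself as the bound in
    [uop] and [gop]. *)
Lemma ops_stable d (b : K) : (mdeg b.1 <= d)%N ->
  (forall i, (ops d).1 i b = (ops (mdeg b.1)).1 i b) /\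
  (forall g, (ops d).2 g b = (ops (mdeg b.1)).2 g b).
Proof.
elim: d => [|d IH]; first by rewrite leqn0 => /eqP ->.
rewrite leq_eqVlt => /predU1P[-> //|bd].
by have [e1 e2] := IH bd; split=> [i|g] /=; rewrite -ltnS bd.
Qed.

Definition uop i (b : K) := (ops (mdeg b.1)).1 i b.
Definition gop g (b : K) := (ops (mdeg b.1)).2 g b.

(** The operator of u_i has leading term the monomial product, and t_g does not raise the degree.
    Both are proved at once because the correction terms of u_i contain t_g, and t_g of a word is
    assembled from the u_j. The degree bounds are what keeps the recursive calls in [ops] within
    their range. *)
Lemma ops_bnd d (b : K) : (mdeg b.1 <= d)%N ->
  (forall i, bnd (mdeg b.1) ((ops d).1 i b - top i b)) /\
  (forall g, bnd (mdeg b.1) ((ops d).2 g b)).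
Proof.
elim: d b => [|d IH] [m h] /= md.
  by split=> [i|g]; [rewrite subrr; apply: bnd0 | apply: (bnd_e (m, _))].
case: (leqP (mdeg m) d) => [md'|dm]; first exact: (IH (m, h) md').
have [m1|[k [m' [bk mE]]]] := monP m; first by move: dm; rewrite m1 mdeg1.
rewrite mE mheadU //; rewrite {m}mE mdegmU in md dm *.
have m'd : mdeg m' = d by apply/eqP; rewrite eqn_leq; apply/andP.
have bL (x : V) j : bnd d x -> bnd d.+1 (ext ((ops d).1 j) x).
  apply: bnd_ext => c cd; rewrite extE -[_ c](subrK (top j c)).
  apply: bndD; first by apply: bndW (proj1 (IH c cd) j); apply: leqW.
  by apply: bndW (bnd_e _); rewrite /= mdegmU.
have [bL' bT'] := IH (m', h) (eq_leq m'd); rewrite /= m'd in bL' bT' *.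
split=> [i|g].
  case: ifP => _; first by rewrite subrr; apply: bnd0.
  rewrite addrAC [top _ _ + _ - _]addrAC subrr add0r; apply: bndD; first exact: bL.
  by apply: bnd_sum => g; apply: bndZ; apply: bndW (bT' g); apply: leqnSn.
by apply: bnd_sum => j; apply: bndZ; apply: bL.
Qed.

Local Notation L i := (ext (uop i)).
Local Notation T g := (ext (gop g)).

Lemma uop_bnd i m h : bnd (mdeg m) (L i (e (m, h)) - e (mU i m, h)).
Proof. by rewrite extE; have [+ _] := ops_bnd (leqnn (mdeg (m, h).1)); apply. Qed.

Lemma gop_bnd g m h : bnd (mdeg m) (T g (e (m, h))).
Proof. by rewrite extE; have [_] := ops_bnd (leqnn (mdeg (m, h).1)); apply. Qed.

Lemma uop_below i m h : below i m -> L i (e (m, h)) = e (mU i m, h).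
Proof.
rewrite extE /uop /=; have [->|[k [m' [bk ->]]]] := monP m; first by rewrite mdeg1.
move=> bi; rewrite mdegmU /= mdegmU ltnn mheadU //.
rewrite leqNgt; case: ltnP => // ki; move/belowP/(_ k ki): bi.
by rewrite mUE eqxx.
Qed.

Lemma ext_ops d (x : V) : bnd d x ->
  (forall i, ext ((ops d).1 i) x = L i x) /\ (forall g, ext ((ops d).2 g) x = T g x).
Proof.
move=> bx; split=> [i|g]; apply: (eq_bnd (lin_lin _) (lin_lin _) _ bx) => k kd; rewrite !extE.
  exact: (proj1 (ops_stable kd)).
exact: (proj2 (ops_stable kd)).
Qed.

Lemma uop_above i (k : 'I_n) m h : below k m -> (k < i)%N ->
  L i (e (mU k m, h)) = L k (L i (e (m, h))) + \sum_g a g i k *: T g (e (m, h)).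
Proof.
move=> bk ki; rewrite [LHS]extE /uop /= mdegmU /= mdegmU ltnn mheadU // leqNgt ki /=.
have eL j : (ops (mdeg m)).1 j (m, h) = L j (e (m, h)) by rewrite extE.
have eT g : (ops (mdeg m)).2 g (m, h) = T g (e (m, h)) by rewrite extE.
rewrite eL; under eq_bigr do rewrite eT; congr (_ + _).
(* As [k < i], writing u_k in front of [mU i m] is already ordered; so [L k] of the subtracted
   leading term cancels [top i] of the whole word, and [L k (L i _)] remains. *)
have [-> _] := ext_ops (uop_bnd i m h); rewrite linearB /= (@uop_below k); last first.
  by rewrite below_mU // ltnW.
by rewrite /top /= mUC addrC subrK.
Qed.

Lemma gop1 g h : T g (e (mone, h)) = e (mone, (g * h)%g).
Proof. by rewrite extE /gop /= mdeg1. Qed.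

Lemma gopU g (k : 'I_n) m h : below k m ->
  T g (e (mU k m, h)) = \sum_j rG g j k *: L j (T g (e (m, h))).
Proof.
move=> bk; rewrite [LHS]extE /gop /= mdegmU /= mdegmU ltnn mheadU //.
apply: eq_bigr => j _; congr (_ *: _).
have -> : (ops (mdeg m)).2 g (m, h) = T g (e (m, h)) by rewrite extE.
by have [-> _] := ext_ops (gop_bnd g m h).
Qed.

(** [L i] of a word of degree [d] leaves the range of an induction hypothesis only through its
    leading term. That term is treated by hand, usually because a smaller letter can be put in front
    of it directly. *)
Lemma uop_ind d i (f g : V -> V) m h : lin f -> lin g ->
  (mdeg m <= d)%N -> f (e (mU i m, h)) = g (e (mU i m, h)) ->
  (forall m' h', (mdeg m' <= d)%N -> f (e (m', h')) = g (e (m', h'))) ->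
  f (L i (e (m, h))) = g (L i (e (m, h))).
Proof.
move=> lf lg md etop elow; rewrite -[L i _](subrK (e (mU i m, h))).
rewrite addrC -[X in f (X + _)]scale1r -[X in g (X + _)]scale1r lf lg etop; congr (_ + _).
by apply: (@eq_bnd d) => // [[m' h']|]; [apply: elow|apply: bndW md (uop_bnd _ _ _)].
Qed.

(** This and the next two definitions are the relations of A, truncated by degree so that they can
    be proved by one induction: the step to degree [d.+1] for one of them calls on others in degree
    [d]. *)
Definition commP d := forall m h, (mdeg m <= d)%N -> forall i j,
  L i (L j (e (m, h))) = L j (L i (e (m, h))) + \sum_g a g i j *: T g (e (m, h)).

Definition actP d := forall m h, (mdeg m <= d)%N -> forall g i,
  T g (L i (e (m, h))) = \sum_j rG g j i *: L j (T g (e (m, h))).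

Definition mulP_ d := forall m h, (mdeg m <= d)%N -> forall g1 g2,
  T g1 (T g2 (e (m, h))) = T (g1 * g2)%g (e (m, h)).

Lemma actP_below g i m h : below i m ->
  T g (L i (e (m, h))) = \sum_j rG g j i *: L j (T g (e (m, h))).
Proof. by move=> bi; rewrite uop_below // gopU. Qed.

Lemma commP_below i j m h : below j m -> (j <= i)%N ->
  L i (L j (e (m, h))) = L j (L i (e (m, h))) + \sum_g a g i j *: T g (e (m, h)).
Proof.
rewrite leq_eqVlt => bj /predU1P[/val_inj -> | ji].
  by rewrite big1 ?addr0 // => g _; rewrite a_alt scale0r.
by rewrite [in LHS]uop_below // uop_above.
Qed.

Definition Lv (v : 'cV[C]_n) x : V := \sum_i v i 0 *: L i x.

Lemma Lv_delta k x : Lv (delta_mx k 0) x = L k x.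
Proof.
rewrite /Lv (bigD1 k) //= big1 => [|j jk]; rewrite !mxE ?eqxx ?scale1r ?addr0 //.
by rewrite (negbTE jk) scale0r.
Qed.

Lemma LvD c v w x : Lv (c *: v + w) x = c *: Lv v x + Lv w x.
Proof.
rewrite /Lv scaler_sumr -big_split; apply: eq_bigr => i _.
by rewrite !mxE scalerDl scalerA.
Qed.

Lemma actP_Lv d : actP d -> forall m h, (mdeg m <= d)%N -> forall g i,
  T g (L i (e (m, h))) = Lv (rG g *m delta_mx i 0) (T g (e (m, h))).
Proof.
move=> Pd m h md g i; rewrite Pd //; apply: eq_bigr => j _.
by rewrite -colE mxE.
Qed.

Lemma lin_Lv v : lin (Lv v).
Proof. by apply: lin_sum => i; apply: lin_lin. Qed.

Lemma lin_kappa i j : lin (fun x => \sum_g a g i j *: T g x).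
Proof. by apply: lin_sum => g; apply: lin_lin. Qed.

Lemma actP_ext d : actP d -> forall x, bnd d x -> forall g i,
  T g (L i x) = Lv (rG g *m delta_mx i 0) (T g x).
Proof.
move=> Pd x bx g i.
apply: (eq_bnd (f := fun x => T g (L i x)) (g := fun x => Lv _ (T g x)) _ _ _ bx).
- exact/lin_comp/lin_lin/lin_lin.
- exact/lin_comp/lin_lin/lin_Lv.
by case=> m h md; apply: actP_Lv Pd _ _ _ _ _.
Qed.

Lemma commP_ext d : commP d -> forall x, bnd d x -> forall i j,
  L i (L j x) = L j (L i x) + \sum_g a g i j *: T g x.
Proof.
move=> Pd x bx i j.
apply: (eq_bnd (f := fun x => L i (L j x))
  (g := fun x => L j (L i x) + \sum_g a g i j *: T g x) _ _ _ bx).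
- exact/lin_comp/lin_lin/lin_lin.
- exact/lin_add/lin_kappa/lin_comp/lin_lin/lin_lin.
by case=> m h md; apply: Pd.
Qed.

Lemma commP_Lv d : commP d -> forall x, bnd d x -> forall v w,
  Lv v (Lv w x) = Lv w (Lv v x) + \sum_g form_val (a g) v w *: T g x.
Proof.
move=> Pd x bx v w.
have e1 v' w' : Lv v' (Lv w' x) = \sum_i \sum_j (v' i 0 * w' j 0) *: L i (L j x).
  rewrite /Lv; apply: eq_bigr => i _; rewrite linear_sum scaler_sumr.
  by apply: eq_bigr => j _; rewrite linearZ scalerA.
have -> : \sum_g form_val (a g) v w *: T g x =
    \sum_i \sum_j (v i 0 * w j 0) *: \sum_g a g i j *: T g x.
  under eq_bigr do rewrite form_val_sum scaler_suml.
  rewrite exchange_big; apply: eq_bigr => i _.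
  under eq_bigr do rewrite scaler_suml.
  rewrite exchange_big; apply: eq_bigr => j _.
  by rewrite scaler_sumr; apply: eq_bigr => g _; rewrite scalerA.
rewrite !e1 [X in _ = X + _]exchange_big -big_split; apply: eq_bigr => i _.
rewrite -big_split; apply: eq_bigr => j _ /=.
by rewrite (commP_ext Pd bx) scalerDr [w j 0 * _]mulrC.
Qed.

Lemma mul_step d : actP d -> mulP_ d -> forall (k : 'I_n) m h g1 g2,
  (mdeg m <= d)%N -> below k m ->
  T g1 (T g2 (e (mU k m, h))) = T (g1 * g2)%g (e (mU k m, h)).
Proof.
move=> aP mP k m h g1 g2 md bk; rewrite !gopU // linear_sum /=.
under eq_bigr => j _.
  rewrite linearZ /= (actP_ext aP); last by apply: bndW md (gop_bnd _ _ _).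
  rewrite mP // /Lv scaler_sumr; over.
rewrite exchange_big; apply: eq_bigr => l _ /=.
rewrite repr_mxM ?inE // mxE scaler_suml; apply: eq_bigr => j _.
by rewrite -colE mxE scalerA mulrC.
Qed.

(** Rewrite u_i u_k as u_k u_i plus a commutator, carry t_g through both letters, and exchange the
    transformed letters back. The two commutator sums match after reindexing by conjugation by [g],
    where [a_equiv] enters, and cancel by skewness. *)
Lemma act_step d : commP d -> actP d -> mulP_ d -> forall i (k : 'I_n) m h g,
  (mdeg m <= d)%N -> below k m -> (k < i)%N ->
  T g (L i (e (mU k m, h))) = Lv (rG g *m delta_mx i 0) (T g (e (mU k m, h))).
Proof.
move=> cP aP mP i k m h g md bk ki; rewrite uop_above // linearD.
have -> : T g (L k (L i (e (m, h)))) =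
    Lv (rG g *m delta_mx k 0) (T g (L i (e (m, h)))).
  apply: (uop_ind (d := d) (f := fun x => T g (L k x)) (g := fun x => Lv _ (T g x))) => //.
  - exact/lin_comp/lin_lin/lin_lin.
  - exact/lin_comp/lin_lin/lin_Lv.
  - rewrite actP_below ?below_mU 1?ltnW //; apply: eq_bigr => j _.
    by rewrite -colE mxE.
  - by move=> m' h' m'd; apply: actP_Lv aP _ _ _ _ _.
rewrite (actP_Lv aP) // (commP_Lv cP); last by apply: bndW md (gop_bnd _ _ _).
have -> : T g (e (mU k m, h)) = Lv (rG g *m delta_mx k 0) (T g (e (m, h))).
  by rewrite gopU //; apply: eq_bigr => j _; rewrite -colE mxE.
rewrite -addrA linear_sum /= [X in _ + (_ + X)](reindex_inj (conjg_inj g)) /=.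
rewrite -big_split big1 ?addr0 // => x _ /=.
rewrite linearZ /= !mP // form_val_mulmx a_equiv form_val_delta -conjgC -scalerDl.
by rewrite -!form_val_delta (form_val_skew _ _ (a_skew _)) addNr scale0r.
Qed.

Lemma commP_swap i j x :
  L i (L j x) = L j (L i x) + \sum_g a g i j *: T g x ->
  L j (L i x) = L i (L j x) + \sum_g a g j i *: T g x.
Proof.
move=> ->; rewrite -addrA -big_split big1 ?addr0 // => g _ /=.
rewrite -scalerDl -!form_val_delta (form_val_skew _ _ (a_skew _)).
by rewrite addNr scale0r.
Qed.

Lemma comm_above d : commP d -> actP d -> forall i j (k : 'I_n) m h,
  (mdeg m <= d)%N -> below k m -> (k < i)%N -> (k < j)%N ->
  L i (L j (e (mU k m, h))) = L k (L i (L j (e (m, h))))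
   + \sum_g a g i k *: Lv (rG g *m delta_mx j 0) (T g (e (m, h)))
   + \sum_g a g j k *: L i (T g (e (m, h))).
Proof.
move=> cP aP i j k m h md bk ki kj; rewrite (uop_above _ bk kj) linearD linear_sum.
congr (_ + _); last by apply: eq_bigr => g _; rewrite linearZ.
under [X in _ = _ + X]eq_bigr do rewrite -(actP_Lv aP) //.
apply: (uop_ind (d := d) (f := fun x => L i (L k x))
   (g := fun x => L k (L i x) + \sum_g a g i k *: T g x)) => //.
- exact/lin_comp/lin_lin/lin_lin.
- exact/lin_add/lin_kappa/lin_comp/lin_lin/lin_lin.
- by apply: commP_below; rewrite ?below_mU // ltnW.
- by move=> m' h' m'd; apply: cP.
Qed.

(** [comm_above] moves u_k to the front on both sides, and the commutator of u_i and u_j is known on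
    the shorter word. What remains in front of each [T g (e (m, h))] is, up to sign, the cyclic sum
    of [a_jac] at the basis vectors [i], [j], [k]. *)
Lemma comm_step d : commP d -> actP d -> forall i j (k : 'I_n) m h,
  (mdeg m <= d)%N -> below k m -> (k < i)%N -> (k < j)%N ->
  L i (L j (e (mU k m, h))) = L j (L i (e (mU k m, h)))
   + \sum_g a g i j *: T g (e (mU k m, h)).
Proof.
move=> cP aP i j k m h md bk ki kj.
rewrite !(comm_above cP aP) // (cP m h md i j) linearD linear_sum -!addrA.
congr (_ + _); rewrite -!big_split; apply: eq_bigr => g _ /=.
have -> : T g (e (mU k m, h)) = Lv (rG g *m delta_mx k 0) (T g (e (m, h))).
  by rewrite gopU //; apply: eq_bigr => l _; rewrite -colE mxE.
rewrite linearZ /= -!Lv_delta.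
set x := T g (e (m, h)); have := a_jac g (delta_mx i 0) (delta_mx j 0) (delta_mx k 0).
rewrite !form_val_delta => /(congr1 (Lv^~ x)) /=.
have Lv0 : Lv 0 x = 0 by rewrite /Lv big1 // => l _; rewrite mxE scale0r.
have LvDD v w : Lv (v + w) x = Lv v x + Lv w x by rewrite -[v]scale1r LvD !scale1r.
have LvZ c v : Lv (c *: v) x = c *: Lv v x by rewrite -[c *: v]addr0 LvD Lv0 addr0.
have LvN v : Lv (- v) x = - Lv v x by rewrite -[- v]scaleN1r LvZ scaleN1r.
rewrite !(LvDD, LvZ, LvN, Lv0).
have -> : a g k i = - a g i k.
  by rewrite -!form_val_delta (form_val_skew _ _ (a_skew _)).
rewrite !scalerBr !scaleNr => J; apply/eqP; rewrite -subr_eq0 -[X in _ == X]oppr0 -J.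
apply/eqP; rewrite !opprD !opprK !addrA.
by rewrite [RHS](ACl (6*3*2*1*4*5)).
Qed.

(** The cases are the positions of [i] and [j] relative to the first letter [k]. If one of them is
    at most [k], commutation is built into the recursive definition; the cyclic condition is needed
    only when both exceed [k]. *)
Lemma uop_gop_relations d : [/\ commP d, actP d & mulP_ d].
Proof.
have comm1 m h i j : below i m -> below j m ->
    L i (L j (e (m, h))) = L j (L i (e (m, h))) + \sum_g a g i j *: T g (e (m, h)).
  move=> bi bj; case: (leqP j i) => [ji|/ltnW ij]; first exact: commP_below.
  exact/commP_swap/commP_below.
elim: d => [|d [cP aP mP]].
  have m1 m : (mdeg m <= 0)%N -> m = mone by rewrite leqn0 => /eqP/mdeg_eq0I.
  split=> m h /m1 ->.
  - by move=> i j; apply: comm1; apply: below1.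
  - by move=> g i; apply/actP_below/below1.
  - by move=> g1 g2; rewrite !gop1 mulgA.
have stepP m : (mdeg m <= d.+1)%N -> m = mone \/
    exists (k : 'I_n) m', [/\ below k m', (mdeg m' <= d)%N & m = mU k m'].
  have [-> _|[k [m' [bk ->]]]] := monP m; first by left.
  by rewrite mdegmU => md; right; exists k, m'.
split=> m h /stepP [->|[k [m' [bk md ->]]]].
- by move=> i j; apply: comm1; apply: below1.
- move=> i j; have bU := below_mU m' (leqnn k); rewrite bk in bU.
  have [ik|ki] := leqP i k; have [jk|kj] := leqP j k.
  + by apply: comm1; [apply: below_trans ik bU | apply: below_trans jk bU].
  + apply/commP_swap/commP_below; first exact: below_trans ik bU.
    exact/ltnW/(leq_ltn_trans ik).
  + apply/commP_below; first exact: below_trans jk bU.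
    exact/ltnW/(leq_ltn_trans jk).
  + exact: comm_step cP aP i j k m' h md bk ki kj.
- by move=> g i; apply/actP_below/below1.
- move=> g i; have bU := below_mU m' (leqnn k); rewrite bk in bU.
  have [ik|ki] := leqP i k; first exact/actP_below/(below_trans ik bU).
  rewrite (act_step cP) //; apply: eq_bigr => j _; by rewrite -colE mxE.
- by move=> g1 g2; rewrite !gop1 mulgA.
- by move=> g1 g2; apply: mul_step aP mP _ _ _ _ _ md bk.
Qed.

(** * The ordered words span the algebra *)

Section Span.

Variables (R : lalgType C) (I : R -> Prop).
Hypotheses (scaleAr : forall (c : C) (p q : R), p * (c *: q) = c *: (p * q))
  (I0 : I 0) (ID : forall p q, I p -> I q -> I (p + q))
  (IMl : forall q p, I p -> I (q * p)) (IMr : forall q p, I p -> I (p * q)).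
Local Notation "p === q" := (congr_mod I p q) (at level 70).

Variables (t : gT -> R) (u : {linear 'cV[C]_n -> R}).
Hypotheses (t1 : t 1%g === 1) (tM : forall g h, t g * t h === t (g * h)%g)
  (tuV : forall h v, t h * u v * t h^-1%g === u (rG h *m v))
  (comm : forall v w, u v * u w - u w * u v === kappa a t v w).

Local Notation ui i := (u (delta_mx i 0)).

Variables (W : {cmonom 'I_n} -> R) (lift : {linear V -> R}).
Hypotheses (W1 : W mone = 1)
  (WU : forall (k : 'I_n) m, below k m -> W (mU k m) = ui k * W m)
  (liftE : forall m h, lift (e (m, h)) = W m * t h).

(** Modulo the ideal, left multiplication of a lifted word agrees with the operator on [V]. Together
    with [span_t] this makes [lift] compatible with both kinds of generators, so every word reduces
    to ordered ones. *)
Definition span_u d := forall m h, (mdeg m <= d)%N ->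
  forall i, ui i * lift (e (m, h)) === lift (L i (e (m, h))).
Definition span_t d := forall m h, (mdeg m <= d)%N ->
  forall g, t g * lift (e (m, h)) === lift (T g (e (m, h))).

Lemma span_u_below i m h : below i m ->
  ui i * lift (e (m, h)) === lift (L i (e (m, h))).
Proof.
by move=> bi; rewrite uop_below // !liftE WU // mulrA; apply: cgr_refl.
Qed.

Lemma span_u_ext d : span_u d -> forall x, bnd d x ->
  forall i, ui i * lift x === lift (L i x).
Proof.
move=> Pd x bx i; elim: bx => [|c [m h] y md _ IH].
  by rewrite !linear0 mulr0; apply: cgr_refl.
rewrite !linearP mulrDr scaleAr; apply: (cgrD ID) => //.
by apply: (cgrZ IMl); apply: Pd.
Qed.

Lemma span_u_step d : span_u d -> span_t d -> forall i (k : 'I_n) m h,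
  (mdeg m <= d)%N -> below k m -> (k < i)%N ->
  ui i * lift (e (mU k m, h)) === lift (L i (e (mU k m, h))).
Proof.
move=> Pu Pt i k m h md bk ki.
rewrite uop_above // linearD linear_sum liftE WU // -mulrA -liftE mulrA.
have c1 : ui i * ui k === ui k * ui i + kappa a t (delta_mx i 0) (delta_mx k 0).
  rewrite -{1}[ui i * ui k](subrK (ui k * ui i)) addrC.
  by apply: (cgrD ID (cgr_refl I0 _)); apply: comm.
apply: (cgr_trans ID (cgrMr IMr _ c1)).
rewrite mulrDl; apply: (cgrD ID); last first.
  rewrite mulr_suml; apply: (cgr_sum I0 ID) => g _.
  rewrite -scalerAl form_val_delta linearZ; apply: (cgrZ IMl).
  exact: Pt.
rewrite -mulrA; apply: (cgr_trans ID (cgrMl IMl _ (Pu _ _ md i))).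
(* The leading term may have degree [d.+1], out of reach of [Pu], but u_k can be put in front of it
   without a commutator; the rest [lo] has degree at most [d]. *)
have [lo [-> blo]] : exists lo, L i (e (m, h)) = e (mU i m, h) + lo /\ bnd d lo.
  exists (L i (e (m, h)) - e (mU i m, h)); split; first by rewrite addrC subrK.
  exact: bndW md (uop_bnd _ _ _).
rewrite [lift (_ + _)]linearD mulrDr [L k (_ + _)]linearD [lift (_ + _)]linearD.
apply: (cgrD ID); first by apply: span_u_below; rewrite below_mU // ltnW.
exact: span_u_ext Pu _ blo _.
Qed.

Lemma span_t_ext d : span_t d -> forall x, bnd d x ->
  forall g, t g * lift x === lift (T g x).
Proof.
move=> Pd x bx g; elim: bx => [|c [m h] y md _ IH].
  by rewrite !linear0 mulr0; apply: cgr_refl.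
rewrite !linearP mulrDr scaleAr; apply: (cgrD ID) => //.
by apply: (cgrZ IMl); apply: Pd.
Qed.

Lemma u_sum v : u v = \sum_i v i 0 *: ui i.
Proof.
rewrite {1}[v]matrix_sum_delta linear_sum; apply: eq_bigr => i _.
by rewrite big_ord1 linearZ.
Qed.

Lemma span_t_step d : span_u d -> span_t d -> forall g (k : 'I_n) m h,
  (mdeg m <= d)%N -> below k m ->
  t g * lift (e (mU k m, h)) === lift (T g (e (mU k m, h))).
Proof.
move=> Pu Pt g k m h md bk; rewrite gopU // linear_sum liftE WU // -mulrA -liftE mulrA.
apply: (cgr_trans ID (cgrMr IMr _ (cgr_tu ID IMl IMr t1 tM tuV g _))).
rewrite -mulrA; apply: (cgr_trans ID (cgrMl IMl _ (Pt _ _ md g))).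
rewrite u_sum mulr_suml; apply: (cgr_sum I0 ID) => j _.
rewrite -scalerAl linearZ -colE mxE; apply: (cgrZ IMl).
by apply: (span_u_ext Pu); apply: bndW md (gop_bnd _ _ _).
Qed.

Lemma span_relations d : span_u d /\ span_t d.
Proof.
elim: d => [|d [Pu Pt]].
  have m1 m : (mdeg m <= 0)%N -> m = mone by rewrite leqn0 => /eqP/mdeg_eq0I.
  split=> m h /m1 ->.
  - by move=> i; apply/span_u_below/below1.
  - by move=> g; rewrite gop1 !liftE W1 !mul1r; apply: tM.
have stepP m : (mdeg m <= d.+1)%N -> m = mone \/
    exists (k : 'I_n) m', [/\ below k m', (mdeg m' <= d)%N & m = mU k m'].
  have [-> _|[k [m' [bk ->]]]] := monP m; first by left.
  by rewrite mdegmU => md; right; exists k, m'.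
split=> m h /stepP [->|[k [m' [bk md ->]]]].
- by move=> i; apply/span_u_below/below1.
- move=> i; have bU := below_mU m' (leqnn k); rewrite bk in bU.
  have [ik|ki] := leqP i k; first exact/span_u_below/(below_trans ik bU).
  exact: span_u_step Pu Pt _ _ _ _ md bk ki.
- by move=> g; rewrite gop1 !liftE W1 !mul1r; apply: tM.
- by move=> g; apply: span_t_step Pu Pt _ _ _ _ md bk.
Qed.

End Span.

(** * The action of the free algebra, and its vanishing on the ideal *)

Section Action.

Hypothesis bndV : forall x, exists d, bnd d x.

Lemma gop_Lv g v x : T g (Lv v x) = Lv (rG g *m v) (T g x).
Proof.
have [d bx] := bndV x; have [_ aP _] := uop_gop_relations d.
rewrite /Lv linear_sum /=.
under eq_bigr do rewrite linearZ /= (actP_ext aP bx) /Lv scaler_sumr.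
rewrite exchange_big; apply: eq_bigr => j _ /=.
rewrite mxE scaler_suml; apply: eq_bigr => i _.
by rewrite -colE mxE scalerA mulrC.
Qed.

Lemma Lv_comm v w x :
  Lv v (Lv w x) = Lv w (Lv v x) + \sum_g form_val (a g) v w *: T g x.
Proof.
by have [d bx] := bndV x; have [cP _ _] := uop_gop_relations d; apply: commP_Lv cP _ bx _ _.
Qed.

Lemma gopM g1 g2 x : T g1 (T g2 x) = T (g1 * g2)%g x.
Proof.
have [d bx] := bndV x; have [_ _ mP] := uop_gop_relations d.
apply: (eq_bnd (f := fun x => T g1 (T g2 x)) _ (lin_lin _) _ bx).
  exact/lin_comp/lin_lin/lin_lin.
by case=> m h md; apply: mP.
Qed.

Lemma gop_id x : T 1%g x = x.
Proof.
have [d bx] := bndV x.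
apply: (eq_bnd (g := fun x => x) (lin_lin _) _ _ bx) => // -[m h] _.
elim/mon_ind: m => [|k m bk IH]; first by rewrite gop1 mul1g.
rewrite gopU // IH repr_mx1 (bigD1 k) //= mxE eqxx scale1r big1 ?addr0.
  by rewrite uop_below.
by move=> j jk; rewrite mxE (negbTE jk) scale0r.
Qed.

Section RelatorsAct.

Variables (A : lalgType C) (hact : A -> V -> V) (t : gT -> A) (u : 'cV[C]_n -> A).
Hypotheses (hactB : forall p q x, hact (p - q) x = hact p x - hact q x)
  (hactM : forall p q x, hact (p * q) x = hact p (hact q x))
  (hact1 : forall x, hact 1 x = x)
  (hact_sum : forall (c : gT -> C) x,
     hact (\sum_g c g *: t g) x = \sum_g c g *: hact (t g) x)
  (hact_t : forall g x, hact (t g) x = T g x)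
  (hact_u : forall v x, hact (u v) x = Lv v x).

Lemma hact_rel_one x : hact (t 1%g - 1) x = 0.
Proof. by rewrite hactB hact1 hact_t gop_id subrr. Qed.

Lemma hact_rel_mul g h x : hact (t g * t h - t (g * h)%g) x = 0.
Proof. by rewrite hactB hactM !hact_t gopM subrr. Qed.

Lemma hact_rel_act h v x : hact (t h * u v * t h^-1%g - u (rG h *m v)) x = 0.
Proof.
by rewrite hactB !hactM !hact_t !hact_u gop_Lv gopM mulgV gop_id subrr.
Qed.

Lemma hact_rel_comm v w x :
  hact (u v * u w - u w * u v - \sum_g form_val (a g) v w *: t g) x = 0.
Proof.
rewrite !hactB !hactM !hact_u hact_sum Lv_comm.
under [X in _ - X]eq_bigr do rewrite hact_t.
by rewrite addrAC addrK subrr.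
Qed.

End RelatorsAct.

Local Notation A := (freeAlg C gT n).

Definition hact_gen (s : 'I_n + gT) x : V :=
  match s with inl i => L i x | inr g => T g x end.

Definition hact_word (w : seq ('I_n + gT)) x : V := foldr hact_gen x w.

Definition hact (p : A) x : V := lext (fun w : {fmonom ('I_n + gT)%type} => hact_word w x) p.

Lemma hact_word_lin w : lin (hact_word w).
Proof.
rewrite /lin /hact_word; elim: w => [|s w IH] //= c x y; rewrite IH.
by case: s => [i|g]; rewrite /hact_gen linearP.
Qed.

Lemma lin_sumE (f : V -> V) (J : Type) (r : seq J) (c : J -> C) (F : J -> V) :
  lin f -> f (\sum_(z <- r) c z *: F z) = \sum_(z <- r) c z *: f (F z).
Proof.
move=> lf; elim: r => [|z r IH]; last by rewrite !big_cons lf IH.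
by rewrite !big_nil; have := lf (-1) 0 0; rewrite !scaleN1r !addNr.
Qed.

Lemma hactM p q x : hact (p * q) x = hact p (hact q x).
Proof.
rewrite malgME /hact linear_sum /=; apply: eq_bigr => k _.
rewrite linear_sum /= (lin_sumE _ _ _ (hact_word_lin k)) scaler_sumr.
apply: eq_bigr => l _; rewrite lextU -scalerA; congr (_ *: (_ *: _)).
by rewrite fmM /hact_word foldr_cat.
Qed.

Lemma hact_gensE s x : hact (gen C s) x = hact_gen s x.
Proof. by rewrite /hact lextU scale1r fmU. Qed.

Lemma hact1 x : hact 1 x = x.
Proof. by rewrite /hact lextU scale1r fm1. Qed.

Lemma hactB p q x : hact (p - q) x = hact p x - hact q x.
Proof. exact: lextB. Qed.

Lemma hactD p q x : hact (p + q) x = hact p x + hact q x.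
Proof. exact: linearD. Qed.

Lemma hact_vgen v x : hact (vgen gT v) x = Lv v x.
Proof.
rewrite /hact linear_sum; apply: eq_bigr => i _.
by rewrite linearZ; congr (_ *: _); apply: hact_gensE.
Qed.

Lemma hact_tgen g x : hact (tgen C n g) x = T g x.
Proof. exact: hact_gensE. Qed.

Lemma hact_relator r x : hecke_relator rG a r -> hact r x = 0.
Proof.
case=> [|g h|h v|v w].
- exact: (hact_rel_one hactB hact1 hact_tgen).
- exact: (hact_rel_mul hactB hactM hact_tgen).
- exact: (hact_rel_act hactB hactM hact_tgen hact_vgen).
- apply: (hact_rel_comm hactB hactM _ hact_tgen hact_vgen) => c y.
  by rewrite /hact linear_sum; apply: eq_bigr => g _; rewrite linearZ.
Qed.

Lemma hact_ideal p x : hecke_ideal rG a p -> hact p x = 0.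
Proof.
elim=> [|q r _ IHq _ IHr|q r s rr].
- exact: linear0.
- by rewrite hactD IHq IHr addr0.
- rewrite !hactM (hact_relator _ rr) /hact /lext big1 // => k _.
  have := hact_word_lin k (-1) 0 0; rewrite !scaleN1r !addNr => ->.
  exact: scaler0.
Qed.

(** An ordered word adds its letters from the last to the first, each smaller than or equal to those
    present, so no commutator arises. Distinct ordered words thus have distinct basis vectors as
    values, whence their independence in A. *)
Lemma hact_wordmon m h : hact (wordmon C gT m) (e (mone, h)) = e (m, h).
Proof.
elim/mon_ind: m => [|k m bk IH]; first by rewrite wordmon1 hact1.
have -> : wordmon C gT (mU k m) = gen C (inl gT k) * wordmon C gT m.
  by rewrite mU.unlock wordmonU //; apply/belowP.
by rewrite hactM IH [LHS]hact_gensE /= uop_below.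
Qed.

End Action.

End FreeModule.

(** * Sufficiency of Drinfeld's conditions *)

Section Sufficiency.

Variables (C : fieldType) (gT : finGroupType) (n : nat).
Variable rG : mx_representation C [set: gT] n.
Variable a : {ffun gT -> 'M[C]_n}.
Hypothesis two_neq0 : 2 != 0 :> C.
Hypothesis aP : drinfeld rG a.

Lemma drinfeld_skew g : alternating_form (a g).
Proof. by case: aP. Qed.

Lemma drinfeld_equiv g h : (rG h)^T *m a g *m rG h = a (g ^ h)%g.
Proof. by case: aP => _ /(_ g h). Qed.

Lemma drinfeld_jac g : jacobi_at (rG g) (a g).
Proof. by case: aP => _ _ /(_ g). Qed.

Lemma skew_diag (b : 'M[C]_n) i : alternating_form b -> b i i = 0.
Proof.
move=> sb; apply/eqP; have /eqP := congr1 (fun b : 'M_n => b i i) sb.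
by rewrite !mxE -addr_eq0 -mulr2n -mulr_natl mulf_eq0 (negbTE two_neq0).
Qed.

Local Notation K := ({cmonom 'I_n} * gT)%type.
Local Notation V := {malg C[K]}.
Local Notation e := (fun k : K => << k >> : V).
Local Notation A := (freeAlg C gT n).
Definition lextL (f : K -> V) : {linear V -> V} := lext f.

Local Notation uop := (@uop C gT n rG a V e lextL).
Local Notation gop := (@gop C gT n rG a V e lextL).
Local Notation L i := (lextL (uop i)).
Local Notation T g := (lextL (gop g)).
Local Notation hact := (@hact C gT n rG a V e lextL).
Local Notation t := (@tgen C gT n).
Local Notation u := (@vgen C gT n).
Local Notation I := (hecke_ideal rG a).
Local Notation "x === y" := (congr_mod I x y) (at level 70).

Lemma lextE_e (f : K -> V) (k : K) : lextL f << k >> = f k.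
Proof. exact: etrans (lextU _ _ _) (scale1r _). Qed.

Lemma bnd_all (x : V) : exists d, bnd e d x.
Proof.
rewrite [x]malgE_scale; elim: (msupp x : seq K) => [|k s [d bd]].
  by exists 0%N; rewrite big_nil; apply: bnd0.
exists (maxn (mdeg k.1) d); rewrite big_cons; apply: bndS; first exact: leq_maxl.
by apply: bndW bd; apply: leq_maxr.
Qed.

Let a_alt g i : a g i i = 0 := skew_diag i (drinfeld_skew g).

Definition lift : V -> A := lext (fun b : K => wordmon C gT b.1 * t b.2).

HB.instance Definition _ := GRing.Linear.on lift.

Definition liftL : {linear V -> A} := lift.
Definition vgenL : {linear 'cV[C]_n -> A} := u.

Lemma lift_e m h : liftL << (m, h) >> = wordmon C gT m * t h.
Proof. exact: etrans (lextU _ _ _) (scale1r _). Qed.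

Lemma vgen_delta i : vgenL (delta_mx i 0) = gen C (inl gT i).
Proof.
rewrite -[LHS]/(u _) /vgen (bigD1 i) //= big1 => [|j ji]; rewrite !mxE ?eqxx ?scale1r ?addr0 //.
by rewrite (negbTE ji) scale0r.
Qed.

Lemma wordmon_mU (k : 'I_n) m : below k m ->
  wordmon C gT (mU k m) = vgenL (delta_mx k 0) * wordmon C gT m.
Proof. by move=> bk; rewrite vgen_delta mU.unlock wordmonU //; apply/belowP. Qed.

Lemma hecke_span d :
  span_u rG a (e : K -> V) lextL I vgenL liftL d /\
  span_t rG a (e : K -> V) lextL I t liftL d.
Proof.
apply: (span_relations lextE_e (@malg_scaleAr _ _) (HeckeIdeal0 rG a)
  (@HeckeIdealD _ _ _ rG a) (@hecke_idealMl _ _ _ rG a) (@hecke_idealMr _ _ _ rG a)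
  (cgr_t1 rG a) (cgr_tM rG a) (cgr_tuV rG a) (cgr_comm rG a) _ wordmon_mU lift_e).
exact: wordmon1.
Qed.

Lemma cgr_gen s y :
  gen C s * liftL y === liftL (hact_gen rG a (e : K -> V) lextL s y).
Proof.
have [d by_] := bnd_all y; have [Pu Pt] := hecke_span d.
case: s => [i|g]; last first.
  exact: (span_t_ext (@malg_scaleAr _ _) (HeckeIdeal0 rG a)
    (@HeckeIdealD _ _ _ rG a) (@hecke_idealMl _ _ _ rG a) Pt by_ g).
rewrite -vgen_delta.
exact: (span_u_ext (@malg_scaleAr _ _) (HeckeIdeal0 rG a)
  (@HeckeIdealD _ _ _ rG a) (@hecke_idealMl _ _ _ rG a) Pu by_ i).
Qed.

Lemma cgr_word (w : seq ('I_n + gT)) :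
  << FMonom w >> === liftL (hact_word rG a (e : K -> V) lextL w << (mone, 1%g) >>).
Proof.
elim: w => [|s w IH].
  rewrite /= lift_e wordmon1 mul1r -fmoneE.
  exact/(cgr_sym (@hecke_idealMl _ _ _ rG a))/cgr_t1.
have -> : << FMonom (s :: w) >> = gen C s * << FMonom w >> :> A.
  rewrite /gen malgM_def fgmulUU mulr1; congr << _ *g _ >>.
  by rewrite /mmul /= fmmulE fmuE.
apply: (cgr_trans (@HeckeIdealD _ _ _ rG a) (cgrMl (@hecke_idealMl _ _ _ rG a) _ IH)).
exact: cgr_gen.
Qed.

(** The existence half of the normal form: the value of [x] on the vector of the empty word is its
    expansion in ordered words. *)
Lemma cgr_lift_act (x : A) : x === liftL (hact x << (mone, 1%g) >>).
Proof.
rewrite {1}[x]malgE_scale /hact /lext linear_sum.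
apply: (cgr_sum (HeckeIdeal0 rG a) (@HeckeIdealD _ _ _ rG a)) => w _.
rewrite linearZ; apply: (cgrZ (@hecke_idealMl _ _ _ rG a)).
by have := cgr_word w; rewrite fmK.
Qed.

Definition components (y : V) : {ffun gT -> symAlg C n} :=
  [ffun g => lext (fun b : K => if b.2 == g then << b.1 >> else 0) y].

Lemma lift_components y :
  \sum_(g : gT) sym_lift gT (components y g) * t g = liftL y.
Proof.
rewrite -[RHS]/(lift y) /lift.
have e1 g : sym_lift gT (components y g) * t g =
    \sum_(b <- msupp y) y@_b *: (if b.2 == g then wordmon C gT b.1 * t g else 0).
  rewrite (ffunE _ g) sym_lift_lext lext_lext [X in X * _]/lext mulr_suml.
  apply: eq_bigr => b _; rewrite -scalerAl; congr (_ *: _).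
  case: ifP => _; last by rewrite linear0 mul0r.
  by rewrite lextU scale1r.
rewrite (eq_bigr _ (fun g _ => e1 g)) exchange_big; apply: eq_bigr => b _.
rewrite (bigD1 b.2) //= eqxx big1 ?addr0 // => g gb.
by rewrite eq_sym (negbTE gb) scaler0.
Qed.

Lemma hact_sym_lift (p : symAlg C n) g :
  hact (sym_lift gT p) << (mone, g) >> = lext (fun m => << (m, g) >> : V) p.
Proof.
rewrite sym_lift_lext /hact lext_lext; apply: eq_lext => m _.
exact: (hact_wordmon rG a lextE_e).
Qed.

Lemma hact_components (p : gT -> symAlg C n) :
  hact (\sum_(g : gT) sym_lift gT (p g) * t g) << (mone, 1%g) >> =
  \sum_g lext (fun m => << (m, g) >> : V) (p g).
Proof.
rewrite [LHS]linear_sum; apply: eq_bigr => g _.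
apply: etrans (hactM rG a (e : K -> V) lextL _ _ _) _.
rewrite hact_tgen gop1 ?mulg1; last exact: lextE_e.
exact: hact_sym_lift.
Qed.

Lemma lext_pair_coeff (p : symAlg C n) m g h :
  (lext (fun m => << (m, g) >> : V) p)@_(m, h) = if g == h then p@_m else 0.
Proof.
rewrite /lext (big_morph (mcoeff (m, h)) (mcoeffD _) (mcoeff0 _)).
have e1 m' : (p@_m' *: << (m', g) >> : V)@_(m, h) =
    if (m' == m) && (g == h) then p@_m' else 0.
  by rewrite mcoeffZ mcoeffU xpair_eqE; case: ifP => _; rewrite ?mulr1 ?mulr0.
rewrite (eq_bigr _ (fun m' _ => e1 m')).
case: (g =P h) => _; last by rewrite big1 // => m' _; rewrite andbF.
have [ms|ms] := boolP (m \in msupp p).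
  rewrite (big_fsetD1 m) //= eqxx /= big1_fset ?addr0 // => m'.
  by rewrite in_fsetD1 andbT => /andP[/negbTE -> _].
rewrite (mcoeff_outdom ms) big1_fset // => m' m's _; rewrite andbT.
by case: eqP => // em; rewrite -em m's in ms.
Qed.

Lemma drinfeld_graded_hecke : graded_hecke rG a.
Proof.
split=> [g|x]; first exact: drinfeld_skew.
exists (components (hact x << (mone, 1%g) >>)); split.
  apply: (eq_ind_r (fun y => hecke_eq rG a x y) _ (lift_components _)).
  exact: cgr_lift_act.
move=> p xp; apply/ffunP => g; apply/malgP => m.
(* The ideal acts by zero, so any expansion [p] of [x] can be read off from the single vector
   [hact x << (mone, 1%g) >>]. *)
have key : hact x << (mone, 1%g) >> = \sum_g lext (fun m => << (m, g) >> : V) (p g).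
  rewrite -hact_components; apply/eqP; rewrite -subr_eq0; apply/eqP.
  apply: etrans (esym (hactB rG a _ _ _ _ _)) _.
  exact: (hact_ideal a_alt drinfeld_skew drinfeld_equiv drinfeld_jac lextE_e bnd_all).
have co (q : {ffun gT -> symAlg C n}) :
    (\sum_g lext (fun m => << (m, g) >> : V) (q g))@_(m, g) = (q g)@_m.
  rewrite (big_morph (mcoeff (m, g)) (mcoeffD _) (mcoeff0 _)).
  rewrite (eq_bigr _ (fun h _ => lext_pair_coeff (q h) m h g)) (bigD1 g) //=.
  by rewrite eqxx big1 ?addr0 // => h /negbTE ->.
rewrite -(co p) -key -(co (components _)); congr mcoeff.
rewrite -hact_components.
apply/eqP; rewrite -subr_eq0; apply/eqP.
apply: etrans (esym (hactB rG a _ _ _ _ _)) _.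
apply: (hact_ideal a_alt drinfeld_skew drinfeld_equiv drinfeld_jac lextE_e bnd_all).
apply: (cgr_sym (@hecke_idealMl _ _ _ rG a)).
apply: (eq_ind_r (fun y => hecke_eq rG a x y) _ (lift_components _)).
exact: cgr_lift_act.
Qed.

End Sufficiency.
(** The condition on 2 turns skew symmetry into a_g(v, v) = 0, which is what the commutator of u_i
    with itself demands. *)
Theorem graded_heckeP (C : fieldType) (gT : finGroupType) (n : nat)
    (rG : mx_representation C [set: gT] n) (a : {ffun gT -> 'M[C]_n}) :
  2 != 0 :> C -> graded_hecke rG a <-> drinfeld rG a.
Proof.
move=> two_neq0; split=> [aP|]; last exact: drinfeld_graded_hecke.
split; [by case: aP|exact: graded_hecke_equiv|exact: graded_hecke_jacobi].
Qed.

(** * Consequences of the Jacobi condition *)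

Section JacobiForms.

Variables (C : fieldType) (n : nat).
Hypothesis two_neq0 : 2 != 0 :> C.
Implicit Types (M h b : 'M[C]_n) (v w x y : 'cV[C]_n).

Lemma form_val_alt b v : alternating_form b -> form_val b v v = 0.
Proof.
move=> sb; have /eqP := form_val_skew v v sb.
by rewrite -addr_eq0 -mulr2n -mulr_natl mulf_eq0 (negbTE two_neq0) => /eqP.
Qed.

Lemma form_eq0 b : (forall x y, form_val b x y = 0) -> b = 0.
Proof. by move=> b0; apply: form_eqP => v w; rewrite b0 form_val0. Qed.

Lemma cramer2 (al be p1 q1 p2 q2 : C) : al * p1 + be * q1 = 0 ->
  al * p2 + be * q2 = 0 -> p1 * q2 - p2 * q1 != 0 -> al = 0 /\ be = 0.
Proof.
move=> e1 e2 d0; split; apply/eqP; rewrite -(mulIr_eq0 _ (mulIf d0)).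
  have -> : al * (p1 * q2 - p2 * q1) =
    q2 * (al * p1 + be * q1) - q1 * (al * p2 + be * q2) by ring.
  by rewrite e1 e2 !mulr0 subrr.
have -> : be * (p1 * q2 - p2 * q1) =
  p1 * (al * p2 + be * q2) - p2 * (al * p1 + be * q1) by ring.
by rewrite e1 e2 !mulr0 subrr.
Qed.

(** With [v] in the radical, the cyclic identity at v, x, y reduces to b(x, y) (Mv - v) = 0. *)
Lemma jacobi_one M b v i : jacobi_at M b -> (forall x, form_val b v x = 0) ->
  alternating_form b -> (M *m v - v) i 0 != 0 -> b = 0.
Proof.
move=> jb bv sb pi; apply: form_eq0 => x y; have := jb v x y.
rewrite bv (form_val_skew y v sb) bv oppr0 !scale0r !addr0.
move=> /(congr1 (fun z : 'cV_n => z i 0)); rewrite !mxE => /eqP.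
by move: pi; rewrite !mxE mulf_eq0 => /negbTE -> /orP[/eqP|].
Qed.

Definition minor2 (p q : 'cV[C]_n) i j := p i 0 * q j 0 - p j 0 * q i 0.

(** As b(v1, v2) = 0, the identity at v1, v2, x is a relation between the independent vectors M v1 -
    v1 and M v2 - v2, so v1 lies in the radical and [jacobi_one] applies. Applied to a difference of
    forms, this also gives uniqueness up to a scalar. *)
Lemma jacobi_two M b v1 v2 i j : jacobi_at M b -> alternating_form b ->
  form_val b v1 v2 = 0 -> minor2 (M *m v1 - v1) (M *m v2 - v2) i j != 0 -> b = 0.
Proof.
move=> jb sb b12 mij.
have b1 x : form_val b v1 x = 0.
  have := jb v1 v2 x; rewrite b12 scale0r addr0 => e.
  have e' k : form_val b v2 x * (M *m v1 - v1) k 0 +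
      form_val b x v1 * (M *m v2 - v2) k 0 = 0.
    by have := congr1 (fun z : 'cV_n => z k 0) e; rewrite !mxE.
  have [_ h] := cramer2 (e' i) (e' j) mij.
  by rewrite form_val_skew // h oppr0.
move: mij; rewrite /minor2; have [->|pi _] := eqVneq ((M *m v1 - v1) i 0) 0.
  have [->|pj _] := eqVneq ((M *m v1 - v1) j 0) 0; first by rewrite !mul0r subrr eqxx.
  exact: jacobi_one jb b1 sb pj.
exact: jacobi_one jb b1 sb pi.
Qed.

(** The determinant of rows i, j, k of the matrix with columns p, q, r, expanded along row k. *)
Definition minor3 (p q r : 'cV[C]_n) i j k :=
  p k 0 * minor2 q r i j - q k 0 * minor2 p r i j + r k 0 * minor2 p q i j.

Lemma jacobi_three M b v1 v2 v3 i j k : jacobi_at M b -> alternating_form b ->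
  minor2 (M *m v1 - v1) (M *m v2 - v2) i j != 0 ->
  minor3 (M *m v1 - v1) (M *m v2 - v2) (M *m v3 - v3) i j k != 0 -> b = 0.
Proof.
move=> jb sb m2 m3; apply: (jacobi_two jb sb _ m2); apply/eqP.
have := jb v1 v2 v3; rewrite -(mulIr_eq0 _ (mulIf m3)) => e.
set p := M *m v1 - v1 in e *; set q := M *m v2 - v2 in e *.
set r := M *m v3 - v3 in e *; set ga := form_val b v1 v2 in e *.
set al := form_val b v2 v3 in e; set be := form_val b v3 v1 in e.
have e' l : al * p l 0 + be * q l 0 + ga * r l 0 = 0.
  by have := congr1 (fun z : 'cV_n => z l 0) e; rewrite !mxE.
(* Cramer's rule: expansion along the column [r] after replacing it by the combination of the three
   columns that vanishes by the cyclic identity. *)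
have -> : ga * minor3 p q r i j k =
    (al * p k 0 + be * q k 0 + ga * r k 0) * minor2 p q i j
  - (al * p j 0 + be * q j 0 + ga * r j 0) * (p i 0 * q k 0 - p k 0 * q i 0)
  + (al * p i 0 + be * q i 0 + ga * r i 0) * (p j 0 * q k 0 - p k 0 * q j 0).
  by rewrite /minor3 /minor2; ring.
by rewrite !e' !mul0r subrr addr0.
Qed.

(** Invariance gives b(v, x) = b(hv, hx) = - b(v, x) - c b(v, v), and b(v, v) = 0. *)
Lemma reflection_radical h b v x : alternating_form b -> h^T *m b *m h = b ->
  h *m v = - v -> (exists c, h *m x = x + c *: v) -> form_val b v x = 0.
Proof.
move=> sb hb hv [c hx].
have /eqP : form_val b v x = - form_val b v x.
  rewrite -{1}hb -form_val_mulmx hv hx form_valDr form_valZr -scaleN1r !form_valZl.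
  by rewrite form_val_alt // !mulr0 addr0 mulN1r.
by rewrite -addr_eq0 -mulr2n -mulr_natl mulf_eq0 (negbTE two_neq0) => /eqP.
Qed.

Lemma eigen_radical h b v1 v2 c1 c2 : h^T *m b *m h = b ->
  h *m v1 = c1 *: v1 -> h *m v2 = c2 *: v2 -> c1 * c2 != 1 -> form_val b v1 v2 = 0.
Proof.
move=> hb h1 h2 c12; apply/eqP; have /eqP : form_val b v1 v2 = c1 * c2 * form_val b v1 v2.
  by rewrite -{1}hb -form_val_mulmx h1 h2 form_valZl form_valZr mulrA.
rewrite -subr_eq0 -[X in X - _]mul1r -mulrBl mulf_eq0 subr_eq0 eq_sym.
by rewrite (negbTE c12).
Qed.

Lemma jacobi_at_conj M h b : h \in unitmx -> jacobi_at M b ->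
  jacobi_at (invmx h *m M *m h) (h^T *m b *m h).
Proof.
move=> uh jb u v w; rewrite -!form_val_mulmx.
have e x : invmx h *m M *m h *m x - x = invmx h *m (M *m (h *m x) - h *m x).
  by rewrite mulmxBr !mulmxA mulVmx // mul1mx.
by rewrite !e !scalemxAr -!mulmxDr jb mulmx0.
Qed.

Lemma jacobi_at_lin M b b' c : jacobi_at M b -> jacobi_at M b' ->
  jacobi_at M (c *: b + b').
Proof.
move=> jb jb' u v w.
have e x y : form_val (c *: b + b') x y = c * form_val b x y + form_val b' x y.
  by rewrite /form_val mulmxDr mulmxDl -scalemxAr -scalemxAl !mxE.
move: (jb u v w) (jb' u v w); rewrite !e.
move: (M *m u - u) (M *m v - v) (M *m w - w) => P Q S j1 j2.
rewrite !scalerDl -!scalerA !addrA (ACl ((1*3*5)*(2*4*6))) /=.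
by rewrite -!scalerDr j1 j2 scaler0 addr0.
Qed.

Lemma jacobi_at0 M : jacobi_at M 0.
Proof. by move=> u v w; rewrite !form_val0 !scale0r !addr0. Qed.

Lemma alternating_conj h b : alternating_form b -> alternating_form (h^T *m b *m h).
Proof.
rewrite /alternating_form => sb.
by rewrite trmx_mul trmx_mul trmxK sb mulNmx mulmxN mulmxA.
Qed.

Lemma alternating_lin b b' c : alternating_form b -> alternating_form b' ->
  alternating_form (c *: b + b').
Proof. by rewrite /alternating_form linearD linearZ /= => -> ->; rewrite scalerN opprD. Qed.

Lemma alternating0 : alternating_form (0 : 'M[C]_n).
Proof. by rewrite /alternating_form trmx0 oppr0. Qed.

End JacobiForms.

(** * The linear space of solutions of Drinfeld's conditions *)

Section DrinfeldSpace.

Variables (C : numFieldType) (gT : finGroupType) (n : nat).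
Variable rG : mx_representation C [set: gT] n.

Lemma repr_unit g : rG g \in unitmx.
Proof. by apply: repr_mx_unit; rewrite inE. Qed.

Lemma reprM g h : rG (g * h)%g = rG g *m rG h.
Proof. by rewrite repr_mxM ?inE. Qed.

Lemma reprV g : rG g^-1%g = invmx (rG g).
Proof. by rewrite repr_mxV ?inE. Qed.

Lemma drinfeld_conj a x y : drinfeld rG a -> a (x ^ y)%g = 0 -> a x = 0.
Proof.
case=> _ ea _; rewrite -ea => e0.
have := congr1 (fun b => (invmx (rG y))^T *m b *m invmx (rG y)) e0.
rewrite mulmx0 mul0mx !mulmxA -trmx_mul mulmxV ?repr_unit // trmx1 mul1mx.
by rewrite -mulmxA mulmxV ?repr_unit // mulmx1.
Qed.

Lemma drinfeld_scalar a z (c : C) : mx_faithful rG -> drinfeld rG a ->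
  rG z = c%:M -> c ^+ 2 != 1 -> forall g, a g = 0.
Proof.
move=> fG [_ ea _] zc c2 g.
have cz : (g ^ z = g)%g.
  apply: (mx_faithful_inj fG); rewrite ?inE // conjgE !reprM zc scalar_mxC mulmxA.
  by rewrite -zc reprV mulVmx ?repr_unit // mul1mx.
have := ea g z; rewrite cz zc tr_scalar_mx mul_scalar_mx mul_mx_scalar scalerA -expr2.
move/eqP; rewrite -subr_eq0 -[X in _ - X]scale1r -scalerBl scaler_eq0 subr_eq0.
by rewrite (negbTE c2) => /eqP.
Qed.

Lemma drinfeld_lin c a b : drinfeld rG a -> drinfeld rG b -> drinfeld rG (c *: a + b).
Proof.
case=> sa ea ja [sb eb jb]; split=> [g|g h|g]; rewrite !ffunE.
- exact: alternating_lin.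
- by rewrite mulmxDr mulmxDl -scalemxAr -scalemxAl ea eb.
- exact: jacobi_at_lin.
Qed.

Lemma drinfeld0 : drinfeld rG 0.
Proof.
split=> [g|g h|g]; rewrite !ffunE; [exact: alternating0| |exact: jacobi_at0].
by rewrite mulmx0 mul0mx.
Qed.

Lemma drinfeld_sum (J : Type) (r : seq J) (c : J -> C) F :
  (forall j, drinfeld rG (F j)) -> drinfeld rG (\sum_(j <- r) c j *: F j).
Proof.
move=> dF; elim: r => [|j r IH]; first by rewrite big_nil; apply: drinfeld0.
by rewrite big_cons; apply: drinfeld_lin.
Qed.

(** The sum runs over all conjugating elements, not over cosets of the centralizer. For an invariant
    [b] the value at [g] is therefore [b] times the order of the centralizer, which is invertible
    here. *)
Definition averaged_form (g : gT) (b : 'M[C]_n) : {ffun gT -> 'M[C]_n} :=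
  [ffun x => \sum_(h : gT | (g ^ h)%g == x) (rG h)^T *m b *m rG h].

Lemma averaged_drinfeld g b : alternating_form b -> jacobi_at (rG g) b ->
  drinfeld rG (averaged_form g b).
Proof.
move=> sb jb; split=> [x|x k|x]; rewrite !ffunE.
- elim/big_rec: _ => [|h c _ sc]; first exact: alternating0.
  by rewrite -[_ *m rG h]scale1r; apply: alternating_lin => //; apply: alternating_conj.
- rewrite mulmx_sumr mulmx_suml [RHS](reindex_inj (mulIg k)) /=.
  apply: eq_big => [h|h _]; first by rewrite conjgM (inj_eq (conjg_inj k)).
  by rewrite reprM trmx_mul !mulmxA.
- elim/big_rec: _ => [|h c /eqP <- jc]; first exact: jacobi_at0.
  rewrite -[_ *m rG h]scale1r; apply: jacobi_at_lin => //.
  rewrite conjgE !reprM reprV mulmxA; apply: jacobi_at_conj => //; exact: repr_unit.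
Qed.

Section Classification.

Variables (r : nat) (g : 'I_r -> gT) (b : 'I_r -> 'M[C]_n).
Hypotheses (sb : forall i, alternating_form (b i))
  (jb : forall i, jacobi_at (rG (g i)) (b i))
  (ib : forall i h, (g i ^ h)%g = g i -> (rG h)^T *m b i *m rG h = b i)
  (nb : forall i, b i != 0)
  (ub : forall i c, alternating_form c -> jacobi_at (rG (g i)) c ->
          exists k, c = k *: b i)
  (dis : forall i j y, (g i ^ y)%g = g j -> i = j)
  (cov : forall x, (exists i y, (x ^ y)%g = g i) \/
           (forall a, drinfeld rG a -> a x = 0)).

Let f i := averaged_form (g i) (b i).
Let N i := #|[pred h | (g i ^ h)%g == g i]|.

Let fE i j : f i (g j) = if i == j then (N i)%:R *: b i else 0.
Proof.
rewrite ffunE; case: eqP => [<-|ij]; last first.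
  by rewrite big1 // => h /eqP /dis.
by rewrite (eq_bigr (fun=> b i)) => [|h /eqP/ib //]; rewrite sumr_const scaler_nat.
Qed.

Let N_neq0 i : (N i)%:R != 0 :> C.
Proof.
rewrite pnatr_eq0 -lt0n; apply/card_gt0P; exists 1%g.
by rewrite inE conjg1.
Qed.

Let fD i : drinfeld rG (f i).
Proof. exact: averaged_drinfeld. Qed.

(** Choose the coefficients so that both sides agree at the representatives [g i]. The difference
    then vanishes on their classes by invariance, and on all other classes by [cov]. *)
Lemma drinfeld_span a : drinfeld rG a -> exists k : 'I_r -> C, a = \sum_i k i *: f i.
Proof.
move=> da; have [sa ea ja] := da.
have ci i : exists k, a (g i) = k *: f i (g i).
  have [k ak] := ub (sa (g i)) (ja (g i)); exists (k / (N i)%:R).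
  by rewrite fE eqxx scalerA divfK.
have /fin_all_exists [k kP] := ci; exists k.
apply/eqP; rewrite -subr_eq0; apply/eqP/ffunP => x; rewrite [RHS]ffunE.
have dd : drinfeld rG (a - \sum_i k i *: f i).
  by rewrite addrC -scaleN1r; apply: drinfeld_lin => //; apply: drinfeld_sum.
have [[i [y xy]]|] := cov x; last exact.
apply: (drinfeld_conj (y := y) dd); rewrite xy.
have -> : (a - \sum_i k i *: f i) (g i) = a (g i) - \sum_j k j *: f j (g i).
  rewrite ffunE [X in _ + X]ffunE sum_ffunE; congr (_ - _).
  by apply: eq_bigr => j _; rewrite ffunE.
rewrite kP (bigD1 i) //= big1 ?addr0 ?subrr // => j ji.
by rewrite fE (negbTE ji) scaler0.
Qed.

Theorem drinfeld_classification :
  (forall x, (exists a, drinfeld rG a /\ a x <> 0) <-> (exists i y, (x ^ y)%g = g i)) /\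
  (exists U : {vspace {ffun gT -> 'M[C]_n}},
     (forall a, a \in U <-> drinfeld rG a) /\ \dim U = r).
Proof.
split=> [x|].
  split=> [[a [da ax]]|[i [y xy]]].
    by have [//|/(_ a da)] := cov x.
  exists (f i); split=> // fx0; have [_ ef _] := fD i.
  have := ef x y; rewrite fx0 mulmx0 mul0mx xy fE eqxx => /esym/eqP.
  by rewrite scaler_eq0 (negbTE (N_neq0 i)) (negbTE (nb i)).
pose X := [tuple f i | i < r].
have Xi (i : 'I_r) : X`_i = f i by rewrite -tnth_nth tnth_mktuple.
exists <<X>>%VS; split=> [a|].
  split=> [/coord_span ->|/drinfeld_span [k ->]].
    by apply: drinfeld_sum => i; rewrite Xi.
  apply: memv_suml => i _; apply/memvZ/memv_span.
  by apply/tnthP; exists i; rewrite tnth_mktuple.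
suff /eqP : free X by rewrite size_tuple.
apply/freeP => k k0 i; have := congr1 (fun a : {ffun gT -> 'M[C]_n} => a (g i)) k0.
rewrite sum_ffunE ffunE (bigD1 i) //= big1 => [|j ji]; last first.
  by rewrite ffunE Xi fE (negbTE ji) scaler0.
rewrite ffunE Xi fE eqxx addr0 scalerA => /eqP; rewrite scaler_eq0 (negbTE (nb i)).
by rewrite mulf_eq0 (negbTE (N_neq0 i)) !orbF => /eqP.
Qed.

End Classification.
End DrinfeldSpace.

(** * Exact arithmetic *)

(* The tests neqb, nisz and nnz only need to be sound, so that the latter may
   compute a single norm. *)
Record numRing := NumRing {
  car :> Type; n0 : car; n1 : car; nadd : car -> car -> car; nopp : car -> car;
  nmul : car -> car -> car; nconj : car -> car; neqb : car -> car -> bool;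
  nisz : car -> bool; nnz : car -> bool }.

Arguments n0 {n}. Arguments n1 {n}. Arguments nadd {n}. Arguments nopp {n}.
Arguments nmul {n}. Arguments nconj {n}. Arguments neqb {n}. Arguments nnz {n}.
Arguments nisz {n}.

Definition intRing : numRing :=
  @NumRing Z Z0 (Zpos xH) Z.add Z.opp Z.mul id Z.eqb
    (fun x => if x is Z0 then true else false) (fun x => if x is Z0 then false else true).

(* (x, y) stands for x + y t, where t^2 = p t + q and the complex conjugate of t
   is c0 + c1 t. *)
Section QuadRing.

Variables (R : numRing) (p q c0 c1 : R).

Definition quadRing : numRing :=
  let norm (x : R * R) :=
    nadd (nmul x.1 (nadd x.1 (nmul p x.2))) (nopp (nmul q (nmul x.2 x.2))) in
  @NumRing (R * R)%type (n0, n0) (n1, n0)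
    (fun x y => (nadd x.1 y.1, nadd x.2 y.2)) (fun x => (nopp x.1, nopp x.2))
    (fun x y => let z := nmul x.2 y.2 in
       (nadd (nmul x.1 y.1) (nmul q z),
        nadd (nadd (nmul x.1 y.2) (nmul x.2 y.1)) (nmul p z)))
    (fun x => (nadd (nconj x.1) (nmul (nconj x.2) c0), nmul (nconj x.2) c1))
    (fun x y => neqb x.1 y.1 && neqb x.2 y.2)
    (fun x => nisz x.1 && nisz x.2)
    (fun x => nnz (norm x)).

End QuadRing.

Section SeqMatrix.

Variable R : numRing.
Implicit Types (A B : seq (seq R)) (r : seq R).

Fixpoint vadd r r' : seq R :=
  match r, r' with x :: r, y :: r' => nadd x y :: vadd r r' | _, _ => [::] end.

Definition vaddZ (x : R) r r' : seq R :=
  if nisz x then r' else vadd [seq nmul x y | y <- r] r'.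

Fixpoint vmul n r B : seq R :=
  match r, B with x :: r, b :: B => vaddZ x b (vmul n r B) | _, _ => nseq n n0 end.

Definition smul n A B := [seq vmul n r B | r <- A].

Definition sscale (x : R) A := [seq [seq nmul x y | y <- r] | r <- A].

Definition sopp A := [seq [seq nopp y | y <- r] | r <- A].

Definition sone n : seq (seq R) :=
  mkseq (fun i => mkseq (fun j => if i == j then n1 else n0) n) n.

Definition seqm A B := all2 (all2 neqb) A B.

Definition swf n A := (size A == n) && all (fun r => size r == n) A.

Definition sword n (gens : seq (seq (seq R))) (w : seq nat) :=
  foldr (fun i A => smul n (nth (sone n) gens i) A) (sone n) w.

Definition sget A i j := nth n0 (nth [::] A i) j.

End SeqMatrix.

Arguments sone {R} n.

Record numEval (R : numRing) (C : numClosedFieldType) := NumEval {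
  ev :> R -> C;
  ev0 : ev n0 = 0;
  ev1 : ev n1 = 1;
  evD : forall x y, ev (nadd x y) = ev x + ev y;
  evN : forall x, ev (nopp x) = - ev x;
  evM : forall x y, ev (nmul x y) = ev x * ev y;
  evJ : forall x, ev (nconj x) = (ev x)^*;
  ev_eq : forall x y, neqb x y -> ev x = ev y;
  ev_isz : forall x, nisz x -> ev x = 0;
  ev_nz : forall x, nnz x -> ev x != 0 }.

Section IntEval.

Variable C : numClosedFieldType.

Definition evZ (x : Z) : C := (int_of_Z x)%:~R.

Lemma evZ_nz x : (if x is Z0 then false else true) -> evZ x != 0.
Proof.
rewrite /evZ intr_eq0 => nx; apply/eqP => x0.
by move: nx; have := congr1 Z_of_int x0; rewrite int_of_ZK => ->.
Qed.

Definition intEval : numEval intRing C.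
Proof.
refine (@NumEval intRing C evZ _ _ _ _ _ _ _ _ evZ_nz) => //=.
- by move=> x y; rewrite /evZ -[Z.add x y]/(x + y)%R rmorphD rmorphD.
- by move=> x; rewrite /evZ -[Z.opp x]/(- x)%R rmorphN rmorphN.
- by move=> x y; rewrite /evZ -[Z.mul x y]/(x * y)%R rmorphM rmorphM.
- by move=> x; rewrite /evZ conj_Creal // realz.
- by move=> x y /Z.eqb_eq ->.
- by case.
Defined.

End IntEval.

Section QuadIdentities.

Variables (F : comNzRingType) (a b c d p q t : F).
Hypothesis t2 : t ^+ 2 = p * t + q.

(** The other root of T^2 = p T + q is p - t, so this is the norm of a + b t over the base ring; if
    it is nonzero, so is a + b t. *)
Lemma quad_norm :
  a * (a + p * b) - q * (b * b) = (a + b * t) * (a + p * b - b * t).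
Proof.
have -> : (a + b * t) * (a + p * b - b * t) =
   a ^+ 2 + a * p * b + b ^+ 2 * (p * t) - b ^+ 2 * t ^+ 2 by ring.
by rewrite t2; ring.
Qed.

Lemma quad_mul :
  a * c + q * (b * d) + (a * d + b * c + p * (b * d)) * t = (a + b * t) * (c + d * t).
Proof.
have -> : (a + b * t) * (c + d * t) = a * c + (a * d + b * c) * t + b * d * t ^+ 2.
  by ring.
by rewrite t2; ring.
Qed.

Lemma quad_add : a + c + (b + d) * t = a + b * t + (c + d * t).
Proof. by ring. Qed.

Lemma quad_conj : a + b * p + b * q * t = a + b * (p + q * t).
Proof. by ring. Qed.

End QuadIdentities.

Section QuadEval.

Variables (C : numClosedFieldType) (R : numRing) (E : numEval R C).
Variables (p q c0 c1 : R) (t : C).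
Hypotheses (t2 : t ^+ 2 = E p * t + E q) (tJ : t^* = E c0 + E c1 * t).

Definition evQ (x : R * R) : C := E x.1 + E x.2 * t.

Lemma evQ_nz (x : quadRing p q c0 c1) : nnz x -> evQ x != 0.
Proof.
case: x => a b /= /(ev_nz E); apply: contraNneq => ab0.
by rewrite !(evD, evN, evM) (quad_norm _ _ t2) -/(evQ (a, b)) ab0 mul0r.
Qed.

Definition quadEval : numEval (quadRing p q c0 c1) C.
Proof.
refine (@NumEval (quadRing p q c0 c1) C evQ _ _ _ _ _ _ _ _ evQ_nz); rewrite /evQ /=.
- by rewrite ev0 mul0r addr0.
- by rewrite ev1 ev0 mul0r addr0.
- by move=> [a b] [c d] /=; rewrite !evD quad_add.
- by move=> [a b] /=; rewrite !evN mulNr opprD.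
- by move=> [a b] [c d] /=; rewrite !(evD, evM) (quad_mul _ _ _ _ t2).
- by move=> [a b] /=; rewrite !(evD, evM, evJ) rmorphD rmorphM /= tJ quad_conj.
- by move=> [a b] [c d] /= /andP[/ev_eq -> /ev_eq ->].
- by move=> [a b] /= /andP[/ev_isz -> /ev_isz ->]; rewrite mul0r addr0.
Defined.

End QuadEval.

Section EvalMatrix.

Variables (C : numClosedFieldType) (R : numRing) (E : numEval R C).
Implicit Types (A B : seq (seq R)) (r : seq R).

Definition emx n A : 'M[C]_n := \matrix_(i, j) E (sget A i j).

Lemma size_vadd r r' : size (vadd r r') = minn (size r) (size r').
Proof. by elim: r r' => [|x r IH] [|y r'] //=; rewrite IH minnSS. Qed.

Lemma nth_vadd r r' j : size r = size r' ->
  E (nth n0 (vadd r r') j) = E (nth n0 r j) + E (nth n0 r' j).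
Proof.
elim: r r' j => [|x r IH] [|y r'] // [|j] //= => [_|_|[/IH]//|[/IH]//].
- by rewrite ev0 addr0.
- by rewrite ev0 addr0.
- by move=> _; rewrite evD.
Qed.

Lemma nth_map_ev (f : R -> R) (c : C) r j : (forall x, E (f x) = c * E x) ->
  E (nth n0 [seq f y | y <- r] j) = c * E (nth n0 r j).
Proof.
move=> fc; elim: r j => [|x r IH] [|j] //=; first by rewrite ev0 mulr0.
by rewrite ev0 mulr0.
Qed.

Lemma size_vaddZ n x r r' : size r = n -> size r' = n -> size (vaddZ x r r') = n.
Proof.
move=> rn r'n; rewrite /vaddZ; case: ifP => // _.
by rewrite size_vadd size_map rn r'n minnn.
Qed.

Lemma nth_vaddZ n x r r' j : size r = n -> size r' = n ->
  E (nth n0 (vaddZ x r r') j) = E x * E (nth n0 r j) + E (nth n0 r' j).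
Proof.
move=> rn r'n; rewrite /vaddZ; case: ifP => [/ev_isz ->|_]; first by rewrite mul0r add0r.
rewrite nth_vadd ?size_map ?rn //; congr (_ + _).
by apply: nth_map_ev => y; rewrite evM.
Qed.

Lemma size_vmul n r B : all (fun r => size r == n) B -> size (vmul n r B) = n.
Proof.
elim: B r => [|b B IH] [|x r] /=; rewrite ?size_nseq // => /andP[/eqP bn /IH BE].
exact: size_vaddZ.
Qed.

Lemma nth_vmul n r B j : all (fun r => size r == n) B ->
  E (nth n0 (vmul n r B) j) = \sum_(k < size B) E (nth n0 r k) * E (sget B k j).
Proof.
elim: B r => [|b B IH] [|x r] /= nB.
- by rewrite big_ord0 nth_nseq if_same ev0.
- by rewrite big_ord0 nth_nseq if_same ev0.
- by rewrite big1 => [|k _]; rewrite ?nth_nseq ?if_same ?ev0 // nth_nil ev0 mul0r.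
move/andP: nB => [/eqP bn BE]; rewrite (nth_vaddZ _ _ bn) ?size_vmul //.
by rewrite big_ord_recl IH.
Qed.

Lemma emx_mul n A B : swf n A -> swf n B -> emx n (smul n A B) = emx n A *m emx n B.
Proof.
case/andP => /eqP An _ /andP[/eqP Bn rB]; apply/matrixP => i j; rewrite !mxE.
rewrite /sget /smul (nth_map [::]) ?An // nth_vmul // Bn.
by apply: eq_bigr => k _; rewrite !mxE.
Qed.

Lemma swf_mul n A B : swf n A -> swf n B -> swf n (smul n A B).
Proof.
case/andP => /eqP An _ /andP[/eqP Bn rB]; rewrite /swf size_map An eqxx /=.
rewrite all_map; apply/(all_nthP [::]) => i _ /=; apply/eqP; exact: size_vmul.
Qed.

Lemma all2_nth (S T : Type) (f : S -> T -> bool) s t x y i :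
  all2 f s t -> (i < size s)%N -> f (nth x s i) (nth y t i).
Proof.
by elim: s t i => [|a s IH] [|b t] [|i] //= /andP[// _ /IH]; apply.
Qed.

Lemma all2_size (S T : Type) (f : S -> T -> bool) s t : all2 f s t -> size s = size t.
Proof. by elim: s t => [|a s IH] [|b t] //= /andP[_ /IH ->]. Qed.

Lemma sget_eq A B i j : seqm A B -> E (sget A i j) = E (sget B i j).
Proof.
move=> AB; rewrite /sget; have [iA|iA] := ltnP i (size A); last first.
  by rewrite !nth_default // ?size_nil // -(all2_size AB).
have rr := all2_nth [::] [::] AB iA; have [jr|jr] := ltnP j (size (nth [::] A i)).
  exact/ev_eq/all2_nth.
by rewrite (nth_default _ jr) (@nth_default _ _ (nth [::] B i)) // -(all2_size rr).
Qed.

Lemma emx_eq n A B : seqm A B -> emx n A = emx n B.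
Proof. by move=> AB; apply/matrixP => i j; rewrite !mxE (sget_eq _ _ AB). Qed.

Lemma emx_one n : emx n (sone n) = 1%:M.
Proof.
apply/matrixP => i j; rewrite !mxE /sget nth_mkseq // nth_mkseq //.
by rewrite -val_eqE; case: ifP; rewrite ?ev0 ?ev1.
Qed.

Lemma swf_one n : swf n (@sone R n).
Proof.
rewrite /swf size_mkseq eqxx; apply/(all_nthP [::]) => i; rewrite size_mkseq => ni.
by rewrite nth_mkseq // size_mkseq.
Qed.

Lemma sget_map (f : R -> R) (c : C) A i j : (forall x, E (f x) = c * E x) ->
  E (sget [seq [seq f y | y <- r] | r <- A] i j) = c * E (sget A i j).
Proof.
move=> fc; rewrite /sget; elim: A i => [|r A IH] [|i] //=; rewrite ?nth_nil ?ev0 ?mulr0 //.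
exact: nth_map_ev.
Qed.

Lemma emx_scale n c A : emx n (sscale c A) = E c *: emx n A.
Proof. by apply/matrixP => i j; rewrite !mxE (sget_map (c := E c)) // => x; rewrite evM. Qed.

Lemma emx_opp n A : emx n (sopp A) = - emx n A.
Proof.
apply/matrixP => i j; rewrite !mxE (sget_map (c := -1)) ?mulN1r // => x.
by rewrite evN mulN1r.
Qed.

Lemma swf_map n (f : R -> R) A : swf n A -> swf n [seq [seq f y | y <- r] | r <- A].
Proof.
by case/andP => An rA; rewrite /swf size_map An all_map; apply: sub_all rA => r /=;
  rewrite size_map.
Qed.

Lemma swf_nth n (gens : seq (seq (seq R))) i : all (swf n) gens ->
  swf n (nth (sone n) gens i).
Proof.
move=> /all_nthP h; have [ig|ig] := ltnP i (size gens); first exact: h.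
by rewrite nth_default // swf_one.
Qed.

Lemma swf_word n gens w : all (swf n) gens -> swf n (@sword R n gens w).
Proof.
by move=> gn; elim: w => [|i w IH] /=; [apply: swf_one|apply/swf_mul/IH/swf_nth].
Qed.

End EvalMatrix.

(** * Certificates *)

Section Checks.

Variable R : numRing.
Variables (n : nat) (gens : seq (seq (seq R))).
Implicit Types (A c : seq (seq R)).

Definition scommute A B := seqm (smul n A B) (smul n B A).

(* cs is stable under conjugation by the generators and contains them; the entry
   (w, j) of cert at (c, t) to satisfy t * c * X = X * c_j for X the word w. *)
Definition cover_check (cs reps : seq (seq (seq R)))
    (cert : seq (seq (seq nat * nat))) (sgn : bool) :=
  [&& has (seqm (sone n)) reps, all (fun s => has (seqm s) cs) gens,
      all (fun s => all (fun t => has (fun t' => seqm (smul n t s) (smul n s t')) cs) cs)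
        gens &
      all2 (fun c row => all2 (fun t (wj : seq nat * nat) =>
          let X := sword n gens wj.1 in
          let L := smul n t (smul n c X) in
          let M := smul n X (nth (sone n) reps wj.2) in
          (wj.2 < size reps)%N && (seqm L M || (sgn && seqm (sopp L) M))) cs row) reps cert].

(** Entries of c - 1, whose column j is the image of the j-th basis vector. In the minors below,
    rows precede columns, so they match [minor2] and [minor3] at images of basis vectors. *)
Definition sminus1 c (i j : nat) := nadd (sget c i j) (nopp (if i == j then n1 else n0)).

Definition sminor2 c i1 i2 j1 j2 :=
  nadd (nmul (sminus1 c i1 j1) (sminus1 c i2 j2))
       (nopp (nmul (sminus1 c i2 j1) (sminus1 c i1 j2))).

Definition sminor3 c i1 i2 i3 j1 j2 j3 :=
  nadd (nadd (nmul (sminus1 c i3 j1) (sminor2 c i1 i2 j2 j3))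
             (nopp (nmul (sminus1 c i3 j2) (sminor2 c i1 i2 j1 j3))))
       (nmul (sminus1 c i3 j3) (sminor2 c i1 i2 j1 j2)).

(** Row k is free apart from its diagonal entry -1, and the other rows are those of the identity:
    [H] is a reflection of order 2 with root the k-th basis vector. A basis of roots brings
    reflections into this form. *)
Definition srefl (k : nat) (H : seq (seq R)) :=
  all (fun i => all (fun j => ((i == k) && (j != k)) ||
     neqb (sget H i j) (if i == j then if i == k then nopp n1 else n1 else n0))
    (iota 0 n)) (iota 0 n).

Definition seigen (mu : R) (j : nat) (H : seq (seq R)) :=
  all (fun i => neqb (sget H i j) (if i == j then mu else n0)) (iota 0 n).

(* Reasons for a_g = 0: the image of g - 1 has dimension at least 3; a generator
   commuting with g has its root in the radical of a_g but not in ker (g - 1); an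
   element commuting with g acts by a scalar mu with mu^2 <> 1 on a plane where
   g - 1 is injective; all generators are reflections commuting with g; in rank 2,
   an element commuting with g has determinant <> 1. *)
Inductive vcert :=
| VRegular of nat & nat & nat & nat & nat & nat
| VReflection of nat & nat
| VEigen of seq nat & R & nat & nat & nat & nat
| VCentral
| VDet of seq nat.

Definition vcheck c (v : vcert) : bool :=
  match v with
  | VRegular i1 i2 i3 j1 j2 j3 =>
      [&& all (fun i => (i < n)%N) [:: i1; i2; i3; j1; j2; j3],
          nnz (sminor2 c i1 i2 j1 j2) & nnz (sminor3 c i1 i2 i3 j1 j2 j3)]
  | VReflection k i =>
      let H := nth (sone n) gens k in
      [&& (k < n)%N, (i < n)%N, srefl k H, scommute c H & nnz (sminus1 c i k)]
  | VEigen w mu i1 i2 j1 j2 =>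
      let H := sword n gens w in
      [&& all (fun i => (i < n)%N) [:: i1; i2; j1; j2], scommute c H,
          seigen mu j1 H, seigen mu j2 H,
          nnz (nadd (nmul mu mu) (nopp n1)) & nnz (sminor2 c i1 i2 j1 j2)]
  | VCentral =>
      all (fun k => let H := nth (sone n) gens k in srefl k H && scommute c H)
        (iota 0 n)
  | VDet w =>
      let H := sword n gens w in
      [&& n == 2%N, scommute c H &
          nnz (nadd (nadd (nmul (sget H 0 0) (sget H 1 1))
                          (nopp (nmul (sget H 0 1) (sget H 1 0)))) (nopp n1))]
  end.

(** In a finite group every element is a product of generators without inverses, so a list
    containing 1 and stable under left multiplication by the generators meets every element.
    Repetitions do no harm. *)
Definition enum_check (L : seq (seq (seq R))) :=
  [&& has (seqm (sone n)) L, all (swf n) L &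
      all (fun s => all (fun M => has (seqm (smul n s M)) L) L) gens].

(** Breadth-first closure under the generators. Its result is validated afterwards by [enum_check],
    so soundness does not rest on the fuel. *)
Fixpoint sclosure fuel (front L : seq (seq (seq R))) :=
  if fuel is fuel.+1 then
    let: (new, L') :=
      foldl (fun (p : seq (seq (seq R)) * seq (seq (seq R))) A =>
          if has (seqm A) p.2 then p else (A :: p.1, A :: p.2))
        ([::], L) [seq smul n s A | s <- gens, A <- front] in
    if new is [::] then L else sclosure fuel new L'
  else L.

(** A proof of inequality by one entry with a nonzero difference. Failure of [seqm] would not do,
    since the equality test is sound in one direction only. *)
Definition sdiffer A B :=
  has (fun i => has (fun j => nnz (nadd (sget A i j) (nopp (sget B i j)))) (iota 0 n))
    (iota 0 n).

Definition str A := mkseq (fun i => mkseq (fun j => sget A j i) n) n.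

(* b spans the forms allowed at an element with matrix c. *)
Definition good_check L c b i1 i2 j1 j2 :=
  let I := iota 0 n in
  [&& all (fun i => (i < n)%N) [:: i1; i2; j1; j2],
      nnz (sget b j1 j2), nnz (sminor2 c i1 i2 j1 j2), swf n b,
      all (fun i => all (fun j => neqb (sget b j i) (nopp (sget b i j))) I) I,
      all (fun i => all (fun j => all (fun k => all (fun l =>
        neqb (nadd (nadd (nmul (sget b j k) (sminus1 c l i))
                         (nmul (sget b k i) (sminus1 c l j)))
                   (nmul (sget b i j) (sminus1 c l k))) n0) I) I) I) I &
      all (fun M => sdiffer (smul n c M) (smul n M c) ||
                    seqm (smul n (str M) (smul n b M)) b) L].

Definition order_check c o :=
  let P d := iter d (smul n c) (sone n) in
  [&& (0 < o)%N, seqm (P o) (sone n) &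
      all (fun d => sdiffer (P d) (sone n)) (iota 1 o.-1)].

(** An entry of [goods] is a class carrying a form, with the form and the rows and columns of a
    nonzero 2 by 2 minor of c - 1. The order of the elements alone tells these classes apart, hence
    the [uniq] test. All remaining classes need a certificate from [vs]. *)
Definition classify_check (wcs wreps : seq (seq nat))
    (cert : seq (seq (seq nat * nat))) (orders : seq nat) (vs : seq vcert)
    (goods : seq (nat * seq (seq R) * (nat * nat * nat * nat)))
    (L : seq (seq (seq R))) :=
  let reps := [seq sword n gens w | w <- wreps] in
  let gi := [seq gd.1.1 | gd <- goods] in
  [&& cover_check [seq sword n gens w | w <- wcs] reps cert false,
      enum_check L, all2 order_check reps orders,
      uniq [seq nth 0%N orders j | j <- gi],
      all (fun gd : nat * seq (seq R) * (nat * nat * nat * nat) =>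
        let: (j, b, (i1, i2, j1, j2)) := gd in
        (j < size reps)%N && good_check L (nth (sone n) reps j) b i1 i2 j1 j2) goods &
      all (fun j => (j \in gi) || vcheck (nth (sone n) reps j) (nth VCentral vs j))
        (iota 0 (size reps))].

End Checks.

(** On a plane, pulling back an alternating form by [H] multiplies it by det H. *)
Lemma alternating_det (C : fieldType) (n : nat) (H b : 'M[C]_n) (i0 i1 : 'I_n) :
  2 != 0 :> C -> n = 2%N -> val i0 = 0%N -> val i1 = 1%N -> alternating_form b ->
  H^T *m b *m H = b -> H i0 i0 * H i1 i1 - H i0 i1 * H i1 i0 != 1 -> b = 0.
Proof.
move=> two_neq0 n2; subst n => i00 i11 sb Hb d1.
have {}i00 : i0 = 0 by apply: val_inj.
have {}i11 : i1 = 1 by apply: val_inj.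
subst i0 i1; have b00 := skew_diag two_neq0 0 sb; have b11 := skew_diag two_neq0 1 sb.
have b10 : b 1 0 = - b 0 1 by have := congr1 (fun m : 'M_2 => m 0 1) sb; rewrite !mxE.
have b01 : b 0 1 = 0.
  have := congr1 (fun m : 'M_2 => m 0 1) Hb.
  have S2 (F : 'I_2 -> C) : \sum_i F i = F 0 + F 1.
    by rewrite !big_ord_recl big_ord0 addr0; congr (F _ + F _); apply: val_inj.
  rewrite !mxE S2 !mxE !S2 !mxE b00 b11 b10 => e; apply/eqP; move: d1.
  rewrite -subr_eq0 => /mulfI i.
  apply/eqP/i; rewrite mulr0 -[RHS](subrr (b 0 1)) -[X in _ = X - _]e; ring.
apply/matrixP => i j; rewrite mxE.
have I2 (k : 'I_2) : k = 0 \/ k = 1.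
  by case: k => [[|[|k]] kP] //; [left|right]; apply: val_inj.
by case: (I2 i) => ->; case: (I2 j) => ->; rewrite ?b00 ?b11 ?b10 ?b01 ?oppr0.
Qed.

(** * Group elements realized by computed matrices *)

Section Realization.

Variables (C : numClosedFieldType) (R : numRing) (E : numEval R C).
Variables (gT : finGroupType) (n : nat) (rG : mx_representation C [set: gT] n).
Variables (Q : 'M[C]_n) (gs : seq gT) (gens : seq (seq (seq R))).
Hypotheses (fG : mx_faithful rG) (uQ : Q \in unitmx)
  (gsG : <<[set:: gs]>>%g = [set: gT]) (wfg : all (swf n) gens)
  (gsE : forall i, rG (nth 1%g gs i) *m Q = Q *m emx E n (nth (sone n) gens i)).

Local Notation emx := (emx E n).
Implicit Types (A B c : seq (seq R)) (x y : gT).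

(** [M] is the matrix of [x] in the basis of columns of [Q], in which all computations take
    place. *)
Definition real x (M : 'M[C]_n) := rG x *m Q = Q *m M.

Lemma two_neq0 : 2 != 0 :> C.
Proof. by rewrite pnatr_eq0. Qed.

Lemma realM x y M N : real x M -> real y N -> real (x * y)%g (M *m N).
Proof.
by rewrite /real reprM => xM yN; rewrite -mulmxA yN [LHS]mulmxA xM -mulmxA.
Qed.

Lemma real1 : real 1%g 1%:M.
Proof. by rewrite /real repr_mx1 mul1mx mulmx1. Qed.

Lemma real_fun x M N : real x M -> real x N -> M = N.
Proof.
rewrite /real => -> /(congr1 (mulmx (invmx Q))).
by rewrite !mulmxA mulVmx // !mul1mx.
Qed.

Lemma real_inj x y M : real x M -> real y M -> x = y.
Proof.
rewrite /real => xM yM; apply: (mx_faithful_inj fG); rewrite ?inE //.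
have := etrans xM (esym yM); move=> /(congr1 (mulmx^~ (invmx Q))).
by rewrite -!mulmxA mulmxV // !mulmx1.
Qed.

Lemma realJ x y M N X : real x M -> real y X -> M *m X = X *m N -> real (x ^ y)%g N.
Proof.
move=> xM yX MX; rewrite /real conjgE !reprM reprV -!mulmxA yX.
rewrite [rG x *m _]mulmxA xM -mulmxA MX [Q *m (X *m N)]mulmxA -yX !mulmxA.
by rewrite mulVmx ?mul1mx //; apply: repr_unit.
Qed.

Definition gword w := foldr (fun i x => nth 1%g gs i * x)%g 1%g w.

Lemma real_word w : real (gword w) (emx (sword n gens w)).
Proof.
elim: w => [|i w IH] /=; first by rewrite emx_one; apply: real1.
by rewrite emx_mul ?swf_nth ?swf_word //; apply: realM.
Qed.

Lemma gs_ind (P : gT -> Prop) : P 1%g ->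
  (forall i x, (i < size gs)%N -> P x -> P (nth 1%g gs i * x)%g) -> forall x, P x.
Proof.
move=> P1 PM x; have : x \in <<[set:: gs]>>%g by rewrite gsG inE.
case/gen_prodgP => m [f fgs ->]; elim: m f fgs => [|m IH] f fgs.
  by rewrite big_ord0.
rewrite big_ord_recl; have := fgs ord0; rewrite inE => /(nthP 1%g) [i im <-].
by apply: PM => //; apply: IH.
Qed.

Section Cover.

Variables (wcs wreps : seq (seq nat)) (cert : seq (seq (seq nat * nat))) (sgn : bool).
Let cs := [seq sword n gens w | w <- wcs].
Let reps := [seq sword n gens w | w <- wreps].
Hypotheses (size_gs : size gs = size gens) (chk : cover_check n gens cs reps cert sgn).

Let wf_cs i : swf n (nth (sone n) cs i).
Proof.
have [ic|ic] := ltnP i (size wcs); first by rewrite (nth_map [::]) // swf_word.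
by rewrite nth_default ?size_map // swf_one.
Qed.

Let wf_reps i : swf n (nth (sone n) reps i).
Proof.
have [ic|ic] := ltnP i (size wreps); first by rewrite (nth_map [::]) // swf_word.
by rewrite nth_default ?size_map // swf_one.
Qed.

Let conj_cs y x i : (i < size cs)%N -> real x (emx (nth (sone n) cs i)) ->
  exists2 j, (j < size cs)%N & real (x ^ y)%g (emx (nth (sone n) cs j)).
Proof.
case/and4P: chk => _ _ /(all_nthP (sone n)) c3 _.
elim/gs_ind: y x i => [|k y kg IH] x i ic xi; first by exists i; rewrite ?conjg1.
rewrite conjgM; move: (kg); rewrite size_gs => /c3 /(all_nthP (sone n)) /(_ i ic).
case/(has_nthP (sone n)) => j jc e; apply: (IH _ j jc).
apply: (realJ xi (gsE k)); rewrite -!emx_mul ?wf_cs ?(swf_nth _ wfg) //.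
exact: emx_eq e.
Qed.

(** Induction on the length of [x] as a word. If x^y is a representative up to sign and s is a
    generator, then (s x)^y = s^y x^y, where s^y is again in [cs]; the certificate conjugates this
    product back into the list. The boolean [b] carries the sign. *)
Lemma coverP x : exists y j (b : bool), [/\ (j < size reps)%N, b -> sgn &
  real (x ^ y)%g ((-1) ^+ b *: emx (nth (sone n) reps j))].
Proof.
case/and4P: (chk) => c1 /(all_nthP (sone n)) c2 _ c4.
elim/gs_ind: x => [|k x kg [y [j [b [jr bs xy]]]]].
  have [j jr e] := has_nthP (sone n) c1.
  exists 1%g, j, false; split=> //; rewrite conjg1 expr0 scale1r -(emx_eq E n e).
  by rewrite emx_one; apply: real1.
have [i ic e] : exists2 i, (i < size cs)%N & real (nth 1%g gs k) (emx (nth (sone n) cs i)).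
  have /(has_nthP (sone n)) [i ic e] := c2 k ltac:(by rewrite -size_gs).
  by exists i => //; rewrite -(emx_eq E n e); apply: gsE.
have [i' ic' xi] := conj_cs y ic e.
have rowP := all2_nth (sone n) [::] c4 jr.
have := all2_nth (sone n) ([::], 0%N) rowP ic'.
set wj := nth _ _ i'; set t := nth _ cs i' in xi *; set c := nth _ reps j in xy *.
move=> tc; pose X := sword n gens wj.1.
have tX (d : bool) :
     (if d then seqm (sopp (smul n t (smul n c X))) (smul n X (nth (sone n) reps wj.2))
     else seqm (smul n t (smul n c X)) (smul n X (nth (sone n) reps wj.2))) ->
   real ((nth 1%g gs k * x) ^ (y * gword wj.1))%g
     ((-1) ^+ (d (+) b) *: emx (nth (sone n) reps wj.2)).
  move=> h; rewrite conjgM [((_ * x) ^ y)%g]conjMg; apply: (realJ (realM xi xy) (real_word _)).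
  have {h}: emx (smul n X (nth (sone n) reps wj.2)) = (-1) ^+ d *: emx (smul n t (smul n c X)).
    case: d h => /(emx_eq E n) <-; first by rewrite emx_opp expr1 scaleN1r.
    by rewrite expr0 scale1r.
  rewrite !emx_mul ?swf_mul ?swf_word ?wf_cs ?wf_reps // => h.
  rewrite -[RHS]scalemxAr h scalerA -signr_addb addbAC addbb addFb.
  by rewrite -scalemxAr -scalemxAl mulmxA.
case/andP: tc => jr' /orP[tc|/andP[sg tc]].
  by exists (y * gword wj.1)%g, wj.2, (false (+) b); split=> //; apply: tX.
by exists (y * gword wj.1)%g, wj.2, (true (+) b); split=> //; apply: tX.
Qed.

End Cover.

Lemma delta_minus c (i j : 'I_n) :
  (emx c *m delta_mx j 0 - delta_mx j 0 : 'cV_n) i 0 = E (sminus1 c i j).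
Proof.
rewrite /sminus1 evD evN -colE !mxE andbT.
by case: eqP => [->|ij]; [rewrite eqxx ev1|rewrite ifN ?ev0 //; apply/eqP => /val_inj].
Qed.

Lemma minor2E c (i1 i2 j1 j2 : 'I_n) : nnz (sminor2 c i1 i2 j1 j2) ->
  minor2 (emx c *m delta_mx j1 0 - delta_mx j1 0) (emx c *m delta_mx j2 0 - delta_mx j2 0)
    i1 i2 != 0.
Proof. by move=> /(ev_nz E); rewrite /minor2 !delta_minus evD evN !evM. Qed.

Section Form.

Variables (a : {ffun gT -> 'M[C]_n}) (x : gT) (c : seq (seq R)).
Hypotheses (da : drinfeld rG a) (wc : swf n c) (xc : real x (emx c)).

Let b := Q^T *m a x *m Q.

Let sb : alternating_form b.
Proof. by case: da => sa _ _; apply: alternating_conj. Qed.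

Let jb : jacobi_at (emx c) b.
Proof.
case: da => _ _ ja; have := jacobi_at_conj uQ (ja x).
by rewrite -mulmxA xc mulmxA mulVmx // mul1mx.
Qed.

Let b0 : b = 0 -> a x = 0.
Proof.
move=> e; have := congr1 (fun m => (invmx Q)^T *m m *m invmx Q) e.
rewrite mulmx0 mul0mx /b !mulmxA -trmx_mul mulmxV // trmx1 mul1mx.
by rewrite -mulmxA mulmxV // mulmx1.
Qed.

Let ib y H : real y (emx H) -> swf n H -> scommute n c H ->
  (emx H)^T *m b *m emx H = b.
Proof.
move=> yH wH cH; have xy : (x ^ y = x)%g.
  apply: real_inj xc; apply: (realJ xc yH).
  by rewrite -!emx_mul //; apply: emx_eq.
have axy : (rG y)^T *m a x *m rG y = a x by case: da => _ ea _; rewrite ea xy.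
have -> : (emx H)^T *m b *m emx H = (Q *m emx H)^T *m a x *m (Q *m emx H).
  by rewrite trmx_mul !mulmxA.
by rewrite -yH trmx_mul /b -[in RHS]axy !mulmxA.
Qed.

Let srefl_radical (k : 'I_n) H y : srefl n k H -> real y (emx H) -> swf n H ->
  scommute n c H -> forall v, form_val b (delta_mx k 0) v = 0.
Proof.
move=> rH yH wH cH v.
have e (i j : 'I_n) : ~~ ((i == k) && (j != k)) ->
    E (sget H i j) = if i == j then if i == k then -1 else 1 else 0.
  move=> nij; have := rH; rewrite /srefl => /allP /(_ (val i)).
  rewrite mem_iota ltn_ord => /(_ isT) /allP /(_ (val j)).
  rewrite mem_iota ltn_ord => /(_ isT); rewrite -!val_eqE in nij *.
  rewrite (negbTE nij) => /(ev_eq E) ->.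
  by do 2?case: ifP => _; rewrite ?evN ?ev1 ?ev0.
apply: (reflection_radical two_neq0 sb (ib yH wH cH)).
  apply/matrixP => i z; rewrite !mxE (bigD1 k) //= big1 => [|l lk]; last first.
    by rewrite !mxE (negbTE lk) mulr0.
  rewrite !mxE e ?eqxx ?andbF // ord1 eqxx mulr1 addr0 andbT.
  by case: eqP => // _; rewrite oppr0.
exists ((emx H *m v) k 0 - v k 0); apply/matrixP => i z; rewrite ord1 {z} [RHS]mxE.
have [->|ik] := eqVneq i k; first by rewrite !mxE !eqxx mulr1 addrC subrK.
rewrite !mxE (negbTE ik) mulr0 addr0 (bigD1 i) //= big1 => [|l li].
  by rewrite !mxE e ?eqxx ?(negbTE ik) // mul1r addr0.
by rewrite !mxE e ?(negbTE ik) // eq_sym (negbTE li) mul0r.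
Qed.

Lemma vcheckP v : vcheck n gens c v -> a x = 0.
Proof.
have dval m (mn : (m < n)%N) : m = Ordinal mn by [].
move=> h; apply: b0; case: v h => [i1 i2 i3 j1 j2 j3|k i|w mu i1 i2 j1 j2||w] /=.
- case/and3P => /and5P[I1 I2 I3 J1 /and3P[J2 J3 _]] m2 /(ev_nz E) m3.
  apply: (@jacobi_three _ _ _ _ (delta_mx (Ordinal J1) 0) (delta_mx (Ordinal J2) 0)
    (delta_mx (Ordinal J3) 0) (Ordinal I1) (Ordinal I2) (Ordinal I3) jb sb).
    exact: minor2E.
  move: m3; rewrite /sminor3 /sminor2 /minor3 /minor2 !delta_minus.
  by rewrite !(evD, evN, evM).
- case/and5P => K I rk cH /(ev_nz E) m1.
  apply: (jacobi_one (v := delta_mx (Ordinal K) 0) (i := Ordinal I) jb _ sb).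
    exact: (srefl_radical (k := Ordinal K) rk (gsE k) (swf_nth _ wfg) cH).
  by rewrite delta_minus.
- case/and5P => /and5P[I1 I2 J1 J2 _] cH e1 e2 /andP[mu2 m2].
  have eig j (J : (j < n)%N) : seigen n mu j (sword n gens w) ->
      emx (sword n gens w) *m delta_mx (Ordinal J) 0 = E mu *: delta_mx (Ordinal J) 0 :> 'cV_n.
    move=> /allP h; apply/matrixP => i z; rewrite -colE ord1 !mxE andbT.
    have := h (val i); rewrite mem_iota ltn_ord => /(_ isT) /(ev_eq E) ->.
    by rewrite -val_eqE /=; case: ifP; rewrite ?mulr1 ?mulr0 ?ev0.
  apply: (@jacobi_two _ _ _ _ (delta_mx (Ordinal J1) 0) (delta_mx (Ordinal J2) 0)
    (Ordinal I1) (Ordinal I2) jb sb); last exact: minor2E.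
  apply: (eigen_radical (ib (real_word w) (swf_word _ wfg) cH) (eig _ _ e1) (eig _ _ e2)).
  by have := ev_nz E mu2; rewrite evD evN evM ev1 subr_eq0.
(* Every basis vector is the root of a generator commuting with [x], so the radical is the whole
   space. *)
- move=> /allP h; apply: form_eq0 => p q.
  rewrite [p]matrix_sum_delta; under eq_bigr do rewrite big_ord1.
  have -> : form_val b (\sum_i p i 0 *: delta_mx i 0) q =
      \sum_i p i 0 * form_val b (delta_mx i 0) q.
    elim/big_rec2: _ => [|i y1 y2 _ <-]; first by rewrite /form_val trmx0 !mul0mx mxE.
    by rewrite form_valDl form_valZl.
  apply: big1 => k _; have := h (val k); rewrite mem_iota ltn_ord.
  move=> /(_ isT) /andP[rk cH].
  by rewrite (srefl_radical rk (gsE k) (swf_nth _ wfg) cH) mulr0.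
- case/and3P => /eqP n2 cH /(ev_nz E); rewrite !(evD, evN, evM) ev1 subr_eq0 => d1.
  have I0 : (0 < n)%N by rewrite n2.
  have I1 : (1 < n)%N by rewrite n2.
  apply: (@alternating_det _ _ (emx (sword n gens w)) b (Ordinal I0) (Ordinal I1)
    two_neq0 n2 _ _ sb (ib (real_word w) (swf_word _ wfg) cH)) => //.
  by rewrite !mxE.
Qed.

End Form.

Lemma emx_str A : emx (str n A) = (emx A)^T.
Proof. by apply/matrixP => i j; rewrite !mxE /sget nth_mkseq // nth_mkseq. Qed.

Lemma swf_str A : swf n (str n A).
Proof.
rewrite /swf size_mkseq eqxx; apply/(all_nthP [::]) => i; rewrite size_mkseq => ni.
by rewrite nth_mkseq // size_mkseq.
Qed.

Lemma sdifferP A B : sdiffer n A B -> emx A <> emx B.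
Proof.
case/hasP => i; rewrite mem_iota => /andP[_ ni]; case/hasP => j; rewrite mem_iota.
case/andP => _ nj /(ev_nz E); rewrite evD evN subr_eq0 => /eqP ne.
by move/matrixP/(_ (Ordinal ni) (Ordinal nj)); rewrite !mxE.
Qed.

Lemma enumP L x : enum_check n gens L -> size gs = size gens ->
  exists2 i, (i < size L)%N & real x (emx (nth (sone n) L i)).
Proof.
case/and3P => L1 /(all_nthP (sone n)) wL /(all_nthP (sone n)) Lg sgs.
elim/gs_ind: x => [|k x kg [i iL xi]].
  have [i iL e] := has_nthP (sone n) L1.
  by exists i => //; rewrite -(emx_eq E n e) emx_one; apply: real1.
move: (kg); rewrite sgs => /Lg /(all_nthP (sone n)) /(_ i iL).
case/(has_nthP (sone n)) => j jL e; exists j => //; rewrite -(emx_eq E n e).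
rewrite emx_mul ?(swf_nth _ wfg) ?wL //; exact: realM (gsE k) xi.
Qed.

Lemma swf_iter c d : swf n c -> swf n (iter d (smul n c) (sone n)).
Proof. by move=> wc; elim: d => [|d IH]; [apply: swf_one|apply: swf_mul]. Qed.

Lemma real_iter x c d : swf n c -> real x (emx c) ->
  real (x ^+ d)%g (emx (iter d (smul n c) (sone n))).
Proof.
move=> wc xc; elim: d => [|d IH]; first by rewrite emx_one; apply: real1.
by rewrite expgS /= emx_mul ?swf_iter //; apply: realM.
Qed.

Lemma real_order x c o : swf n c -> order_check n c o -> real x (emx c) -> #[x]%g = o.
Proof.
move=> wc /and3P[o0 co /allP cd] xc.
have xo : (x ^+ o = 1)%g.
  apply: (real_inj (real_iter o wc xc)).
  by rewrite (emx_eq E n co) emx_one; apply: real1.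
apply/eqP; rewrite eqn_leq dvdn_leq ?order_dvdn ?xo //= leqNgt; apply/negP => xlo.
have := cd #[x]%g; rewrite mem_iota order_gt0 add1n prednK // => /(_ xlo)/sdifferP.
case; rewrite emx_one; apply: (real_fun _ real1).
by have := real_iter #[x]%g wc xc; rewrite expg_order.
Qed.

Section Good.

Variables (L : seq (seq (seq R))) (x : gT) (c b : seq (seq R)) (i1 i2 j1 j2 : nat).
Hypotheses (enumL : enum_check n gens L) (size_gs : size gs = size gens)
  (wc : swf n c) (xc : real x (emx c)) (good : good_check n L c b i1 i2 j1 j2).

(** The computed form, carried from the coordinates of [Q] back to those of [rG]. *)
Definition pull_form := (invmx Q)^T *m emx b *m invmx Q.

Let sbb : alternating_form (emx b).
Proof.
apply/matrixP => i j; rewrite !mxE.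
case/and5P: good => _ _ _ _ /and3P[/allP h _ _].
have /h/allP/(_ (val j)) : val i \in iota 0 n by rewrite mem_iota ltn_ord.
by rewrite mem_iota ltn_ord => /(_ isT)/(ev_eq E) ->; rewrite evN.
Qed.

Let jbb : jacobi_at (emx c) (emx b).
Proof.
have D (i j : 'I_n) : (emx c - 1%:M) i j = E (sminus1 c i j).
  rewrite !mxE /sminus1 evD evN; congr (_ - _).
  by rewrite -val_eqE; case: ifP; rewrite ?ev1 ?ev0.
have J i j k l : emx b j k * (emx c - 1%:M) l i + emx b k i * (emx c - 1%:M) l j
   + emx b i j * (emx c - 1%:M) l k = 0.
  case/and5P: good => _ _ _ _ /and3P[_ /allP h _].
  have In (m : 'I_n) : val m \in iota 0 n by rewrite mem_iota ltn_ord.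
  have /allP/(_ _ (In j))/allP/(_ _ (In k))/allP/(_ _ (In l)) := h _ (In i).
  move/(ev_eq E); rewrite ev0 !D => <-.
  by rewrite !mxE !(evD, evM).
move=> u v w; apply/matrixP => l z; rewrite ord1 {z}.
have e (p : 'cV_n) : emx c *m p - p = (emx c - 1%:M) *m p by rewrite mulmxBl mul1mx.
rewrite !e; move: J; move: (emx c - 1%:M) (emx b) => M B J.
have T (p q r : 'cV_n) : form_val B q r * (M *m p) l 0 =
    \sum_i \sum_j \sum_k p i 0 * q j 0 * r k 0 * (B j k * M l i).
  rewrite form_val_sum mxE mulr_sumr; apply: eq_bigr => i _.
  rewrite mulr_suml; apply: eq_bigr => j _; rewrite mulr_suml; apply: eq_bigr => k _.
  by ring.
have X (k1 k2 k3 : C) (p q r : 'cV[C]_n) :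
  (k1 *: p + k2 *: q + k3 *: r) l 0 = k1 * p l 0 + k2 * q l 0 + k3 * r l 0.
  by rewrite !mxE.
rewrite X [RHS]mxE !T.
(* The three terms of the cyclic sum come with rotated summation indices; [rot] brings them to the
   common order i, j, k, where [J] applies termwise. *)
have rot (F : 'I_n -> 'I_n -> 'I_n -> C) :
    \sum_j \sum_k \sum_i F j k i = \sum_i \sum_j \sum_k F j k i.
  rewrite [RHS]exchange_big; apply: eq_bigr => j _; exact: exchange_big.
rewrite [X in _ + X + _]rot [X in _ + X]rot [X in _ + X]rot -!big_split /=.
apply: big1 => i _; rewrite -!big_split; apply: big1 => j _ /=.
rewrite -!big_split; apply: big1 => k _ /=.
rewrite -[RHS](mulr0 (u i 0 * v j 0 * w k 0)) -(J i j k l); ring.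
Qed.

Lemma good_alternating : alternating_form pull_form.
Proof. exact: alternating_conj. Qed.

Lemma good_jacobi : jacobi_at (rG x) pull_form.
Proof.
have uQi : invmx Q \in unitmx by rewrite unitmx_inv.
by have := jacobi_at_conj uQi jbb; rewrite invmxK -xc mulmxK.
Qed.

Lemma good_neq0 : pull_form != 0.
Proof.
case/and5P: good => /and5P[_ _ J1 J2 _] /(ev_nz E) b0 _ _ _.
apply: contraNneq b0 => e; have : emx b = 0.
  have := congr1 (fun m => Q^T *m m *m Q) e; rewrite /pull_form mulmx0 mul0mx !mulmxA.
  by rewrite -trmx_mul mulVmx // trmx1 mul1mx -mulmxA mulVmx // mulmx1.
by move=> /matrixP/(_ (Ordinal J1) (Ordinal J2)); rewrite !mxE => ->.
Qed.

(** The matrix of [h] occurs in [L], and for each matrix there the check found either a failure to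
    commute with [c] or invariance of [b]; the first is excluded here. *)
Lemma good_invariant h : (x ^ h)%g = x -> (rG h)^T *m pull_form *m rG h = pull_form.
Proof.
move=> xh; have [i iL hi] := enumP h enumL size_gs.
have wi : swf n (nth (sone n) L i) by case/and3P: enumL => _ /all_nthP wL _; apply: wL.
set M := nth _ L i in hi wi; have [_ _ _ wb /and3P[_ _ /all_nthP inv]] := and5P good.
have cM : emx c *m emx M = emx M *m emx c.
  apply: (real_fun (realM xc hi)).
  have -> : (x * h = h * x)%g by rewrite conjgC xh.
  exact: realM.
have /orP[/sdifferP[]|/(emx_eq E n)] := inv (sone n) i iL; first by rewrite !emx_mul.
rewrite !emx_mul ?swf_mul ?swf_str // emx_str -/M mulmxA => iM.
have hQ : invmx Q *m rG h = emx M *m invmx Q.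
  by apply: (canRL (mulmxK uQ)); rewrite -mulmxA hi mulmxA mulVmx // mul1mx.
rewrite /pull_form -[in RHS]iM !mulmxA -trmx_mul hQ trmx_mul -!mulmxA hQ !mulmxA //.
Qed.

Lemma good_unique (c' : 'M[C]_n) : alternating_form c' -> jacobi_at (rG x) c' ->
  exists k, c' = k *: pull_form.
Proof.
move=> sc jc.
case/and5P: good => /and5P[I1 I2 J1 J2 _] /(ev_nz E) b0 m2 _ _.
pose d := Q^T *m c' *m Q.
have jd : jacobi_at (emx c) d.
  by have := jacobi_at_conj uQ jc; rewrite -mulmxA xc mulmxA mulVmx // mul1mx.
(* This scalar makes d - k b vanish at the pair of basis vectors j1, j2, whose images under c - 1
   are independent, so [jacobi_two] gives d = k b. *)
pose k := d (Ordinal J1) (Ordinal J2) / E (sget b j1 j2).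
have d0 : d = k *: emx b.
  apply/eqP; rewrite -subr_eq0 addrC -scaleNr; apply/eqP.
  apply: (@jacobi_two _ _ (emx c) _ (delta_mx (Ordinal J1) 0) (delta_mx (Ordinal J2) 0)
    (Ordinal I1) (Ordinal I2)).
  - exact: jacobi_at_lin.
  - by apply: alternating_lin => //; apply: alternating_conj.
  - rewrite form_val_delta mxE [X in X + _]mxE [X in _ * X + _]mxE.
    by rewrite /k mulNr divfK ?addNr.
  - exact: (@minor2E c (Ordinal I1) (Ordinal I2) (Ordinal J1) (Ordinal J2)).
exists k; have := congr1 (fun m => (invmx Q)^T *m m *m invmx Q) d0.
rewrite /d !mulmxA -trmx_mul mulmxV // trmx1 mul1mx -mulmxA mulmxV // mulmx1 => ->.
by rewrite -scalemxAr -scalemxAl.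
Qed.

End Good.

Lemma real_det x M : real x M -> \det (rG x) = \det M.
Proof.
move=> /(congr1 determinant); rewrite !det_mulmx mulrC; apply: mulfI.
by rewrite -unitfE -unitmxE.
Qed.

Section Classify.

Variables (wcs wreps : seq (seq nat)) (cert : seq (seq (seq nat * nat))).
Variables (orders : seq nat) (vs : seq (vcert R)).
Variables (goods : seq (nat * seq (seq R) * (nat * nat * nat * nat))).
Variables (L : seq (seq (seq R))).
Hypotheses (size_gs : size gs = size gens)
  (chk : classify_check n gens wcs wreps cert orders vs goods L).

Let reps := [seq sword n gens w | w <- wreps].
Let gi := [seq gd.1.1 | gd <- goods].

Let wf_rep j : swf n (nth (sone n) reps j).
Proof.
have [jr|jr] := ltnP j (size wreps); first by rewrite (nth_map [::]) // swf_word.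
by rewrite nth_default ?size_map // swf_one.
Qed.

Let cover x : exists y j, (j < size reps)%N /\ real (x ^ y)%g (emx (nth (sone n) reps j)).
Proof.
case/and5P: chk => c1 _ _ _ _; have [y [j [b [jr bs xy]]]] := coverP size_gs c1 x.
by exists y, j; split=> //; move: bs xy; case: b => [/(_ isT)//|_]; rewrite scale1r.
Qed.

Let rep_order x j : (j < size reps)%N -> real x (emx (nth (sone n) reps j)) ->
  #[x]%g = nth 0%N orders j.
Proof.
move=> jr; apply: real_order (wf_rep j) _.
by case/and5P: chk => _ _ c3 _ _; apply: all2_nth c3 jr.
Qed.

Let bad x j a : (j < size reps)%N -> j \notin gi ->
  real x (emx (nth (sone n) reps j)) -> drinfeld rG a -> a x = 0.
Proof.
move=> jr jg xj da; case/and5P: chk => _ _ _ _ /andP[_ /allP/(_ j)].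
rewrite mem_iota jr => /(_ isT); rewrite -/gi (negbTE jg) => v.
exact: (vcheckP da (wf_rep j) xj v).
Qed.

Let gd0 : nat * seq (seq R) * (nat * nat * nat * nat) := (0%N, [::], (0, 0, 0, 0)%N).
Let gd (i : 'I_(size goods)) := nth gd0 goods i.
Let grep i := gword (nth [::] wreps (gd i).1.1).

Let gdP i : ((gd i).1.1 < size reps)%N /\
  good_check n L (nth (sone n) reps (gd i).1.1) (gd i).1.2 (gd i).2.1.1.1 (gd i).2.1.1.2
    (gd i).2.1.2 (gd i).2.2.
Proof.
case/and5P: chk => _ _ _ _ /andP[/(all_nthP gd0)/(_ i (ltn_ord i)) + _].
by rewrite -/(gd i); case: (gd i) => [[j b] [[[i1 i2] j1] j2]] /= /andP[].
Qed.

Let grepP i : real (grep i) (emx (nth (sone n) reps (gd i).1.1)).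
Proof.
have [jr _] := gdP i; rewrite (nth_map [::]); first exact: real_word.
by rewrite size_map in jr.
Qed.

Let enumL : enum_check n gens L. Proof. by case/and5P: chk. Qed.

Let classification :
  (forall x, (exists a, drinfeld rG a /\ a x <> 0) <-> (exists i y, (x ^ y)%g = grep i)) /\
  (exists U : {vspace {ffun gT -> 'M[C]_n}},
     (forall a, a \in U <-> drinfeld rG a) /\ \dim U = size goods).
Proof.
apply: (@drinfeld_classification C gT n rG (size goods) grep
  (fun i => pull_form (gd i).1.2)) => [i|i|i h|i|i c|i j y e|x].
- by have [_ g] := gdP i; apply: good_alternating g.
- by have [_ g] := gdP i; apply: good_jacobi (grepP i) g.
- have [_ g] := gdP i; move=> xh; exact: (good_invariant enumL size_gs (wf_rep _) (grepP i) g xh).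
- by have [_ g] := gdP i; apply: good_neq0 g.
- have [_ g] := gdP i; move=> sc jc; exact: (good_unique (grepP i) g sc jc).
- case/and5P: chk => _ _ _ u _; have [[ir _] [jr _]] := (gdP i, gdP j).
  have oe : nth 0%N orders (gd i).1.1 = nth 0%N orders (gd j).1.1.
    by rewrite -(rep_order ir (grepP i)) -(rep_order jr (grepP j)) -e orderJ.
  have gE (k : 'I_(size goods)) :
      nth 0%N orders (gd k).1.1 = nth 0%N [seq nth 0%N orders j | j <- gi] k.
    by rewrite -map_comp (nth_map gd0).
  apply/val_inj/eqP; move/eqP: oe; rewrite !gE nth_uniq ?size_map //.
have [y [j [jr xy]]] := cover x; have [jg|jg] := boolP (j \in gi); last first.
  by right => a da; apply: (drinfeld_conj (y := y) da); apply: bad xy da.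
left; move: jg; case/(nthP 0%N) => i; rewrite size_map => ig ij.
exists (Ordinal ig), y; apply: (real_inj xy).
rewrite -ij (nth_map gd0) //; exact: (grepP (Ordinal ig)).
Qed.

Lemma classified_dim : exists U : {vspace {ffun gT -> 'M[C]_n}},
  (forall a, a \in U <-> drinfeld rG a) /\ \dim U = size goods.
Proof. by case: classification. Qed.

Lemma classified_class x : exists2 j, (j < size reps)%N &
  [/\ #[x]%g = nth 0%N orders j, \det (rG x) = \det (emx (nth (sone n) reps j)) &
      (exists a, drinfeld rG a /\ a x <> 0) <-> j \in gi].
Proof.
have [y [j [jr xy]]] := cover x; exists j => //; split.
- by rewrite -(rep_order jr xy) orderJ.
- rewrite -(real_det xy) conjgE !reprM reprV !det_mulmx det_inv.
  by rewrite mulrCA mulVf ?mulr1 // -unitfE -unitmxE repr_unit.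
split=> [[a [da ax]]|jg].
  apply: contraT => jg; case: ax; apply: (drinfeld_conj (y := y) da).
  exact: bad xy da.
have [-> _] := classification; case/(nthP 0%N): jg => i; rewrite size_map => ig ij.
exists (Ordinal ig), y; apply: (real_inj xy).
rewrite -ij (nth_map gd0) //; exact: (grepP (Ordinal ig)).
Qed.

End Classify.

End Realization.

(** * Quadratic equations and conjugates of the irrational entries *)

Section Numbers.

Variable C : numClosedFieldType.

Lemma sqrtC_nat_conj (x : C) : 0 <= x -> (sqrtC x)^* = sqrtC x.
Proof. by move=> x0; rewrite conj_Creal // ger0_real // sqrtC_ge0. Qed.

Local Notation s3 := (sqrtC 3 : C).
Local Notation s5 := (sqrtC 5 : C).
Local Notation s7 := (sqrtC 7 : C).

Let i2 : 'i ^+ 2 = -1 :> C. Proof. exact: sqrCi. Qed.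
Let n2 : 2 != 0 :> C. Proof. by rewrite pnatr_eq0. Qed.
(** The quadratic formula for T^2 + T - q. It is used with discriminant -3 (q = -1) for [zeta3] and
    -7 (q = -2) for [klein]. *)
Lemma half_sq (y q : C) : y ^+ 2 = 1 + 4 * q ->
  ((-1 + y) / 2) ^+ 2 = - ((-1 + y) / 2) + q.
Proof.
move=> yq; have -> : ((-1 + y) / 2) ^+ 2 = (1 - 2 * y + y ^+ 2) / 4 by field.
by rewrite yq; field.
Qed.

Lemma half_conj (y : C) : y^* = - y -> ((-1 + y) / 2)^* = -1 - (-1 + y) / 2.
Proof.
move=> yJ; rewrite rmorphM rmorphD rmorphN1 fmorphV rmorph_nat /= yJ.
by field.
Qed.

Lemma i_sqrt_conj (x : C) : 0 <= x -> ('i * sqrtC x)^* = - ('i * sqrtC x).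
Proof. by move=> x0; rewrite rmorphM /= conjCi sqrtC_nat_conj // mulNr. Qed.

Lemma zeta3_sq : zeta3 C ^+ 2 = - zeta3 C - 1.
Proof. by apply: half_sq; rewrite exprMn i2 sqrtCK; ring. Qed.

Lemma zeta3_conj : (zeta3 C)^* = -1 - zeta3 C.
Proof. by apply/half_conj/i_sqrt_conj; rewrite ler0n. Qed.

Lemma klein_sq : klein C ^+ 2 = - klein C - 2.
Proof. by apply: half_sq; rewrite exprMn i2 sqrtCK; ring. Qed.

Lemma klein_conj : (klein C)^* = -1 - klein C.
Proof. by apply/half_conj/i_sqrt_conj; rewrite ler0n. Qed.

Lemma golden_sq : golden C ^+ 2 = golden C + 1.
Proof.
rewrite /golden; have -> : ((1 + s5) / 2) ^+ 2 = (1 + 2 * s5 + s5 ^+ 2) / 4 by field.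
by rewrite sqrtCK; field.
Qed.

Lemma golden_conj : (golden C)^* = golden C.
Proof.
by rewrite /golden rmorphM rmorphD rmorph1 fmorphV rmorph_nat /= sqrtC_nat_conj ?ler0n.
Qed.

Lemma sqrt5_golden : s5 = 2 * golden C - 1.
Proof. by rewrite /golden; field. Qed.

(** Over the field of [golden], [zeta5] has norm 1 and trace [golden C - 1], which is 2 cos(2 pi /
    5). *)
Lemma zeta5_sq : zeta5 C ^+ 2 = (golden C - 1) * zeta5 C - 1.
Proof.
rewrite /zeta5 /golden; set r := sqrtC (10 + _).
have r2 : r ^+ 2 = 10 + 2 * s5 by rewrite sqrtCK.
have -> : ((s5 - 1 + 'i * r) / 4) ^+ 2 =
   (s5 ^+ 2 - 2 * s5 + 1 + 2 * (s5 - 1) * ('i * r) + 'i ^+ 2 * r ^+ 2) / 16 :> C by field.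
have -> : ((1 + s5) / 2 - 1) * ((s5 - 1 + 'i * r) / 4) - 1 =
   (s5 ^+ 2 - 2 * s5 + 1 + (s5 - 1) * ('i * r)) / 8 - 1 :> C by field.
by rewrite i2 r2 sqrtCK; field.
Qed.

Lemma zeta5_conj : (zeta5 C)^* = golden C - 1 - zeta5 C.
Proof.
have r0 : 0 <= 10 + 2 * s5 by rewrite addr_ge0 ?mulr_ge0 ?ler0n ?sqrtC_ge0 ?ler0n.
rewrite /zeta5 /golden rmorphM 2!rmorphD rmorphN1 fmorphV rmorph_nat /=.
by rewrite (i_sqrt_conj r0) sqrtC_nat_conj ?ler0n //; field.
Qed.

End Numbers.

Delimit Scope Z_scope with BZ.

Definition quadZ (R : numRing) (p q c0 c1 : Z) (f : Z -> R) : numRing :=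
  quadRing (f p) (f q) (f c0) (f c1).
Definition litQ (R : numRing) (p q c0 c1 : Z) (f : Z -> R) (x : Z) :
  quadZ p q c0 c1 f := (f x, f 0%BZ).
Definition lit0 (x : Z) : intRing := x.

(* Z[i], Z[zeta3], Z[klein], Z[golden], and quadratic extensions of these. *)
Definition Zi := quadZ 0 (-1) 0 (-1) lit0.
Definition Zw := quadZ (-1) (-1) (-1) (-1) lit0.
Definition Zk := quadZ (-1) (-2) (-1) (-1) lit0.
Definition Zf := quadZ 1 1 0 1 lit0.
Definition liti : Z -> Zi := @litQ _ _ _ _ _ lit0.
Definition litw : Z -> Zw := @litQ _ _ _ _ _ lit0.
Definition Zi2 := quadZ 0 2 0 1 liti.
Definition Ziw := quadZ (-1) (-1) (-1) (-1) liti.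
Definition Zw2 := quadZ 0 2 0 1 litw.
Definition Zwf := quadZ 1 1 0 1 litw.
Definition Zf5 := @quadRing Zf (-1, 1)%BZ (-1, 0)%BZ (-1, 1)%BZ (-1, 0)%BZ.

Section Evaluations.

Variable C : numClosedFieldType.

Lemma evZE (x : Z) : intEval C x = (int_of_Z x)%:~R. Proof. by []. Qed.

Section QuadZ.

Variables (R : numRing) (E : numEval R C) (f : Z -> R).
Hypothesis fE : forall x, E (f x) = (int_of_Z x)%:~R.
Variables (p q c0 c1 : Z) (t : C).
Hypotheses (t2 : t ^+ 2 = (int_of_Z p)%:~R * t + (int_of_Z q)%:~R)
  (tJ : t^* = (int_of_Z c0)%:~R + (int_of_Z c1)%:~R * t).

Definition quadZEval : numEval (quadZ p q c0 c1 f) C.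
Proof.
by refine (quadEval (t := t) (E := E) _ _); rewrite !fE.
Defined.

Lemma quadZ_lit x : quadZEval (litQ p q c0 c1 f x) = (int_of_Z x)%:~R.
Proof. by rewrite /= /evQ /= !fE mul0r addr0. Qed.

End QuadZ.

Definition Ei : numEval Zi C.
Proof.
refine (@quadZEval _ (intEval C) lit0 evZE 0 (-1) 0 (-1) 'i _ _).
- by rewrite sqrCi mul0r add0r.
- by rewrite conjCi add0r mulN1r.
Defined.

Definition Ew : numEval Zw C.
Proof.
refine (@quadZEval _ (intEval C) lit0 evZE (-1) (-1) (-1) (-1) (zeta3 C) _ _).
- by rewrite zeta3_sq mulN1r.
- by rewrite zeta3_conj mulN1r.
Defined.

Definition Ek : numEval Zk C.
Proof.
refine (@quadZEval _ (intEval C) lit0 evZE (-1) (-2) (-1) (-1) (klein C) _ _).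
- by rewrite klein_sq mulN1r.
- by rewrite klein_conj mulN1r.
Defined.

Definition Ef : numEval Zf C.
Proof.
refine (@quadZEval _ (intEval C) lit0 evZE 1 1 0 1 (golden C) _ _).
- by rewrite golden_sq mul1r.
- by rewrite golden_conj add0r mul1r.
Defined.

Lemma Ef_E x y : Ef (x, y) = (int_of_Z x)%:~R + (int_of_Z y)%:~R * golden C.
Proof. by []. Qed.

Lemma Ei_lit x : Ei (liti x) = (int_of_Z x)%:~R. Proof. exact: quadZ_lit. Qed.
Lemma Ew_lit x : Ew (litw x) = (int_of_Z x)%:~R. Proof. exact: quadZ_lit. Qed.

Definition Ei2 : numEval Zi2 C.
Proof.
refine (@quadZEval _ Ei liti Ei_lit 0 2 0 1 (sqrtC 2) _ _).
- by rewrite sqrtCK mul0r add0r.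
- by rewrite sqrtC_nat_conj ?ler0n // add0r mul1r.
Defined.

Definition Ew2 : numEval Zw2 C.
Proof.
refine (@quadZEval _ Ew litw Ew_lit 0 2 0 1 (sqrtC 2) _ _).
- by rewrite sqrtCK mul0r add0r.
- by rewrite sqrtC_nat_conj ?ler0n // add0r mul1r.
Defined.

Definition Eiw : numEval Ziw C.
Proof.
refine (@quadZEval _ Ei liti Ei_lit (-1) (-1) (-1) (-1) (zeta3 C) _ _).
- by rewrite zeta3_sq mulN1r.
- by rewrite zeta3_conj mulN1r.
Defined.

Definition Ewf : numEval Zwf C.
Proof.
refine (@quadZEval _ Ew litw Ew_lit 1 1 0 1 (golden C) _ _).
- by rewrite golden_sq mul1r.
- by rewrite golden_conj add0r mul1r.
Defined.

Definition Ef5 : numEval Zf5 C.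
Proof.
refine (@quadEval _ _ Ef _ _ _ _ (zeta5 C) _ _); rewrite !Ef_E.
- by rewrite zeta5_sq mul0r addr0 mul1r [-1 + _]addrC.
- by rewrite zeta5_conj mul0r addr0 mul1r mulN1r [-1 + _]addrC.
Defined.

End Evaluations.
Section Reflections.

Variables (C : numClosedFieldType) (R : numRing) (E : numEval R C).
Implicit Types (r : seq R) (z : R).

Definition normK r : R := foldr (fun x acc => nadd (nmul x (nconj x)) acc) n0 r.

(* The reflection refl n z r multiplied by <r, r>, to stay in the ring. *)
Definition reflK n z r : seq (seq R) :=
  mkseq (fun i => mkseq (fun j =>
    nadd (if i == j then normK r else n0)
      (nopp (nmul (nmul (nadd n1 (nopp z)) (nth n0 r i)) (nconj (nth n0 r j))))) n) n.

Lemma normKE n r : size r = n ->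
  E (normK r) = \sum_(k < n) `|[seq E x | x <- r]`_k| ^+ 2.
Proof.
move=> <-; rewrite -(big_mkord xpredT (fun k => `|[seq E x | x <- r]`_k| ^+ 2)).
have -> : size r = size [seq E x | x <- r] by rewrite size_map.
rewrite -(big_nth 0 xpredT (fun x => `|x| ^+ 2)).
rewrite big_map; elim: r => [|x r IH] /=; first by rewrite big_nil ev0.
by rewrite big_cons evD evM evJ IH normCK.
Qed.

Lemma emx_refl n z r : size r = n -> E (normK r) != 0 ->
  emx E n (reflK n z r) = E (normK r) *: refl n (E z) [seq E x | x <- r].
Proof.
move=> rn N0; apply/matrixP => i j; rewrite !mxE /sget nth_mkseq // nth_mkseq //.
rewrite -(normKE rn) !(evD, evN, evM, evJ) ev1.
have rE k : E (nth n0 r k) = [seq E x | x <- r]`_k.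
  have [kr|kr] := ltnP k (size r); first by rewrite (nth_map n0).
  by rewrite !nth_default ?size_map // ev0.
have -> : E (if val i == val j then normK r else n0) = E (normK r) * (i == j)%:R.
  by rewrite -val_eqE; case: ifP; rewrite ?mulr1 ?mulr0 ?ev0.
by rewrite !rE mulrBr [E (normK r) * (_ / _)]mulrC divfK.
Qed.

Lemma swf_refl n z r : swf n (reflK n z r).
Proof.
rewrite /swf size_mkseq eqxx; apply/(all_nthP [::]) => i; rewrite size_mkseq => ni.
by rewrite nth_mkseq // size_mkseq.
Qed.

Lemma emx_rows n A : emx E n A = mx_rows n [seq [seq E x | x <- r] | r <- A].
Proof.
apply/matrixP => i j; rewrite !mxE /sget.
have <- : [seq E x | x <- nth [::] A i] = nth [::] [seq [seq E x | x <- r] | r <- A] i.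
  have [iA|iA] := ltnP i (size A); first by rewrite (nth_map [::]).
  by rewrite !nth_default ?size_map.
have [jr|jr] := ltnP j (size (nth [::] A i)); first by rewrite (nth_map n0).
by rewrite (nth_default _ jr) [RHS]nth_default ?size_map // ev0.
Qed.

End Reflections.

(** * Central scalars *)

Section ScalarWords.

Variables (C : numClosedFieldType) (gT : finGroupType) (n : nat).
Variable rG : mx_representation C [set: gT] n.
Variables (P : 'M[C]_n) (gs : seq gT) (ss : seq 'M[C]_n).
Hypotheses (fG : mx_faithful rG) (uP : P \in unitmx)
  (gsP : [seq rG g | g <- gs] = [seq P *m s *m invmx P | s <- ss]).

Lemma size_gens : size gs = size ss.
Proof. by rewrite -(size_map rG) gsP size_map. Qed.

Lemma gen_conj i : rG (nth 1%g gs i) *m P = P *m nth 1%:M ss i.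
Proof.
have [ig|ig] := ltnP i (size gs); last first.
  by rewrite !nth_default -?size_gens // repr_mx1 mul1mx mulmx1.
rewrite -(nth_map _ (rG 1%g)) // gsP (nth_map 1%:M) -?size_gens //.
by rewrite mulmxKV.
Qed.

Definition mpow (M : 'M[C]_n) p := iter p (mulmx M) 1%:M.

Lemma mpowZ c M p : mpow (c *: M) p = c ^+ p *: mpow M p.
Proof.
rewrite /mpow; elim: p => [|p IH] /=; first by rewrite scale1r.
by rewrite IH -scalemxAr -scalemxAl scalerA exprSr.
Qed.

Lemma conj_mpow g M p : rG g *m P = P *m M -> rG (g ^+ p)%g *m P = P *m mpow M p.
Proof.
move=> gM; elim: p => [|p IH]; first by rewrite repr_mx1 mul1mx mulmx1.
by rewrite expgS reprM -mulmxA IH mulmxA gM -mulmxA.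
Qed.

Lemma vanish_scalar g (c : C) : rG g *m P = P *m c%:M -> c ^+ 2 != 1 ->
  forall a, drinfeld rG a -> forall x, a x = 0.
Proof.
move=> gc c2 a da; apply: (drinfeld_scalar fG da (z := g) _ c2).
by rewrite -[rG g](mulmxK uP) gc scalar_mxC mulmxK.
Qed.

(** The p-th power of [g] acts by the scalar l^p e, whose square is l^(2p). *)
Lemma vanish_power g l M p (e : C) : rG g *m P = P *m (l *: M) ->
  mpow M p = e%:M -> e ^+ 2 = 1 -> l ^+ (p * 2) != 1 ->
  forall a, drinfeld rG a -> forall x, a x = 0.
Proof.
move=> /(conj_mpow p); rewrite mpowZ => h Me e2 lp.
apply: (vanish_scalar (c := l ^+ p * e) (g := (g ^+ p)%g)).
  by rewrite h Me scale_scalar_mx.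
by rewrite exprMn e2 mulr1 -exprM.
Qed.

Variables (R : numRing) (E : numEval R C).

Lemma mpow_scalar A (nu z : R) M p : swf n A -> emx E n A = E nu *: M ->
  seqm (iter p (smul n A) (sone n)) (sscale z (sone n)) -> E nu != 0 ->
  mpow M p = (E z / E nu ^+ p)%:M.
Proof.
move=> wA AM /(emx_eq E n); rewrite emx_scale emx_one => e nu0.
have : emx E n (iter p (smul n A) (sone n)) = mpow (E nu *: M) p.
  rewrite /mpow -AM; elim: p {e} => [|p IH] /=; first exact: emx_one.
  by rewrite emx_mul ?IH ?swf_iter.
rewrite e mpowZ => h.
have -> : mpow M p = (E nu ^+ p)^-1 *: (E nu ^+ p *: mpow M p).
  by rewrite scalerA mulVf ?expf_neq0 // scale1r.
by rewrite -h scalerA scale_scalar_mx mulr1 mulrC.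
Qed.

Variables (As : seq (seq (seq R))) (nus : seq R).

(** The computed matrices are [nus] times the true generators, so the word really acts by z / N. The
    condition that its square differs from 1 is tested without division. *)
Definition scalar_check (w : seq nat) (z : R) :=
  let N := foldr (fun i acc => nmul (nth n1 nus i) acc) n1 w in
  [&& nnz N, nnz (nadd (nmul z z) (nopp (nmul N N))) &
      seqm (sword n As w) (sscale z (sone n))].

Hypotheses (wfA : all (swf n) As)
  (AE : forall i, emx E n (nth (sone n) As i) = E (nth n1 nus i) *: nth 1%:M ss i).

Lemma vanish_word w z : scalar_check w z -> forall a, drinfeld rG a -> forall x, a x = 0.
Proof.
case/and3P => /(ev_nz E); set N := foldr _ _ _ => N0 /(ev_nz E).
rewrite evD evN !evM => zN /(emx_eq E n); rewrite emx_scale emx_one => e.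
pose M := foldr (fun i M => nth 1%:M ss i *m M) 1%:M w.
have gM : rG (gword gs w) *m P = P *m M.
  rewrite /M; elim: w {e zN N0 N M} => [|i w IH] /=.
    by rewrite repr_mx1 mul1mx mulmx1.
  by rewrite reprM -mulmxA IH [LHS]mulmxA gen_conj -mulmxA.
have NM : emx E n (sword n As w) = E N *: M.
  rewrite /N /M; elim: w {e zN N0 N M gM} => [|i w IH] /=.
    by rewrite emx_one ev1 scale1r.
  rewrite emx_mul ?swf_nth ?swf_word // IH AE evM.
  by rewrite -scalemxAr -scalemxAl scalerA mulrC.
apply: (vanish_scalar (g := gword gs w) (c := E z / E N)).
  have -> : (E z / E N)%:M = (E N)^-1 *: (E N *: M).
    by rewrite -NM e scalerA scale_scalar_mx mulr1 mulrC.
  by rewrite scalerA mulVf // scale1r.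
apply: contraNneq zN; rewrite expr_div_n => h.
by rewrite -!expr2 -[E z ^+ 2](divfK (expf_neq0 2 N0)) h mul1r subrr.
Qed.

End ScalarWords.

Section ReflectionGroups.

Variables (C : numClosedFieldType) (R : numRing) (E : numEval R C).
Variables (n : nat) (sr : seq (R * seq R)).

Definition refl_list : seq 'M[C]_n := [seq refl n (E zr.1) [seq E x | x <- zr.2] | zr <- sr].
Definition reflKs := [seq reflK n zr.1 zr.2 | zr <- sr].
Definition normKs := [seq normK zr.2 | zr <- sr].
Definition refl_check := all (fun zr : R * seq R => (size zr.2 == n) && nnz (normK zr.2)) sr.

Lemma reflKs_swf : all (swf n) reflKs.
Proof.
apply/(all_nthP [::]) => i; rewrite size_map => ir.
by rewrite (nth_map (n0, [::])) // swf_refl.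
Qed.

Lemma reflKsE i : refl_check ->
  emx E n (nth (sone n) reflKs i) = E (nth n1 normKs i) *: nth 1%:M refl_list i.
Proof.
move=> /(all_nthP (n0, [::])) ok; have [ir|ir] := ltnP i (size sr); last first.
  by rewrite !nth_default ?size_map // emx_one ev1 scale1r.
rewrite !(nth_map (n0, [::])) //; have /andP[/eqP sz nz] := ok i ir.
by rewrite emx_refl // ev_nz.
Qed.

End ReflectionGroups.

(** * Central scalars in rank two *)

Section RankTwoMatrices.

Variables (C : numClosedFieldType) (R : numRing) (E : numEval R C).

Lemma mx_rowsZ n (c : C) (s : seq (seq C)) :
  c *: mx_rows n s = mx_rows n [seq [seq c * x | x <- r] | r <- s].
Proof.
apply/matrixP => i j; rewrite !mxE.
have <- : [seq c * x | x <- nth [::] s i] = nth [::] [seq [seq c * x | x <- r] | r <- s] i.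
  have [iA|iA] := ltnP i (size s); first by rewrite (nth_map [::]).
  by rewrite !nth_default ?size_map.
have [jr|jr] := ltnP j (size (nth [::] s i)); first by rewrite (nth_map 0).
by rewrite (nth_default _ jr) [RHS]nth_default ?size_map // mulr0.
Qed.

Lemma mpow_sign n (A : seq (seq R)) (nu : R) (M : 'M[C]_n) p (b : bool) :
  swf n A -> emx E n A = E nu *: M -> nnz nu ->
  seqm (iter p (smul n A) (sone n))
    (sscale ((if b then nopp else id) (iter p (nmul nu) n1)) (sone n)) ->
  mpow M p = ((-1) ^+ b)%:M.
Proof.
move=> wA AM /(ev_nz E) nu0 e; rewrite (mpow_scalar wA AM e nu0).
have nuE : E (iter p (nmul nu) n1) = E nu ^+ p.
  by elim: (p) => [|q IH] /=; rewrite ?ev1 ?expr0 // evM IH exprS.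
have nup : E nu ^+ p != 0 by rewrite expf_neq0.
by congr _%:M; case: (b); rewrite ?evN nuE ?mulNr divff.
Qed.

Variables (i s e s' : R).

(** The fixed binary polyhedral generators with denominators cleared: [tetraT], [octaS], [octaT]
    carry a factor 2, and [icosaS], [icosaT] a factor 5. The identity sqrt(2) zeta8 = 1 + i removes
    [zeta8] from the entries. *)
Definition tetraS : seq (seq R) := [:: [:: i; n0]; [:: n0; nopp i]].
Definition tetraT : seq (seq R) :=
  [:: [:: nadd n1 i; nadd i (nopp n1)]; [:: nadd n1 i; nadd n1 (nopp i)]].
Definition octaS : seq (seq R) :=
  [:: [:: nmul s i; s]; [:: nopp s; nopp (nmul s i)]].
Definition octaT : seq (seq R) :=
  [:: [:: nadd n1 i; nadd n1 i]; [:: nadd i (nopp n1); nadd n1 (nopp i)]].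
Definition ntwo : R := nadd n1 n1.
Definition npow (x : R) p := iter p (nmul x) n1.
Arguments npow : simpl never.
Definition nsub (x y : R) := nadd x (nopp y).
Definition icosaS : seq (seq R) :=
  [:: [:: nmul s' (nsub (npow e 4) e); nmul s' (nsub (npow e 2) (npow e 3))];
      [:: nmul s' (nsub (npow e 2) (npow e 3)); nmul s' (nsub e (npow e 4))]].
Definition icosaT : seq (seq R) :=
  [:: [:: nmul s' (nsub (npow e 2) (npow e 4)); nmul s' (nsub (npow e 4) n1)];
      [:: nmul s' (nsub n1 e); nmul s' (nsub (npow e 3) e)]].

Hypotheses (iE : E i = 'i).

Lemma sqrt2_neq0 : sqrtC 2 != 0 :> C.
Proof. by rewrite sqrtC_eq0 pnatr_eq0. Qed.

Lemma zeta8_sq : zeta8 C ^+ 2 = 'i.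
Proof.
rewrite /zeta8 expr_div_n sqrtCK sqrrD sqrCi expr1n mul1r mulr2n.
by field.
Qed.

Lemma zeta8_half : 2 * ((sqrtC 2)^-1 * zeta8 C) = 1 + 'i.
Proof.
by rewrite /zeta8 [_^-1 * _]mulrCA -invfM -expr2 sqrtCK mulrCA divff ?mulr1 ?pnatr_eq0.
Qed.

Lemma zeta8_7 : zeta8 C ^+ 7 = - 'i * zeta8 C.
Proof. by rewrite exprSr -[6%N]/(2 * 3)%N exprM zeta8_sq exprS sqrCi mulrN1. Qed.

Lemma zeta8_3 : zeta8 C ^+ 3 = 'i * zeta8 C.
Proof. by rewrite exprSr zeta8_sq. Qed.

Lemma tetraSE n : emx E n tetraS = E n1 *: mx_rows n [:: [:: 'i; 0]; [:: 0; - 'i]].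
Proof. by rewrite ev1 scale1r emx_rows /= evN ev0 iE. Qed.

Lemma tetraTE n : emx E n tetraT = E ntwo *: ((sqrtC 2)^-1 *:
   mx_rows n [:: [:: zeta8 C; zeta8 C ^+ 3]; [:: zeta8 C; zeta8 C ^+ 7]]).
Proof.
rewrite emx_rows !mx_rowsZ /= !(evD, evN, ev1) iE zeta8_3 zeta8_7.
have h (c : C) : (1 + 1) * ((sqrtC 2)^-1 * (c * zeta8 C)) = c * (1 + 'i).
  by rewrite -zeta8_half; ring.
have h1 := h 1; rewrite !mul1r in h1.
by rewrite !h !h1 !mulrDr !mulr1 mulNr -expr2 sqrCi opprK [_ - 1]addrC [- 'i + 1]addrC.
Qed.

Lemma octaTE n : emx E n octaT = E ntwo *: ((sqrtC 2)^-1 *: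
   mx_rows n [:: [:: zeta8 C; zeta8 C]; [:: zeta8 C ^+ 3; zeta8 C ^+ 7]]).
Proof.
rewrite emx_rows !mx_rowsZ /= !(evD, evN, ev1) iE zeta8_3 zeta8_7.
have h (c : C) : (1 + 1) * ((sqrtC 2)^-1 * (c * zeta8 C)) = c * (1 + 'i).
  by rewrite -zeta8_half; ring.
have h1 := h 1; rewrite !mul1r in h1.
by rewrite !h !h1 !mulrDr !mulr1 mulNr -expr2 sqrCi opprK [_ - 1]addrC [- 'i + 1]addrC.
Qed.

Lemma octaSE n : E s = sqrtC 2 -> emx E n octaS = E ntwo *: ((sqrtC 2)^-1 *:
   mx_rows n [:: [:: 'i; 1]; [:: -1; - 'i]]).
Proof.
move=> sE; rewrite emx_rows !mx_rowsZ /= !(evD, evN, evM, ev1) iE sE.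
have h (c : C) : (1 + 1) * ((sqrtC 2)^-1 * c) = sqrtC 2 * c.
  rewrite mulrA; congr (_ * c).
  by apply: (mulIf sqrt2_neq0); rewrite divfK ?sqrt2_neq0 // -expr2 sqrtCK.
by rewrite !h !mulrN !mulr1.
Qed.

Definition nfive : R := nadd ntwo (nadd ntwo n1).

Let five_sqrt c : E s' = sqrtC 5 -> E nfive * ((sqrtC 5)^-1 * c) = E s' * c.
Proof.
move=> sE; rewrite mulrA; congr (_ * c).
have s0 : sqrtC 5 != 0 :> C by rewrite sqrtC_eq0 pnatr_eq0.
apply: (mulIf s0); rewrite divfK // sE -expr2 sqrtCK !evD ev1; ring.
Qed.

Lemma npowE p : E (npow e p) = E e ^+ p.
Proof. by elim: p => [|p IH]; rewrite ?ev1 // exprS /= evM IH. Qed.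

Lemma icosaSE n : E s' = sqrtC 5 -> E e = zeta5 C -> emx E n icosaS =
  E nfive *: ((sqrtC 5)^-1 *: mx_rows n
    [:: [:: zeta5 C ^+ 4 - zeta5 C; zeta5 C ^+ 2 - zeta5 C ^+ 3];
        [:: zeta5 C ^+ 2 - zeta5 C ^+ 3; zeta5 C - zeta5 C ^+ 4]]).
Proof.
move=> sE eE; rewrite emx_rows !mx_rowsZ.
by rewrite /icosaS [LHS]/= [RHS]/= !five_sqrt // !evM !evD !evN !npowE eE.
Qed.

Lemma icosaTE n : E s' = sqrtC 5 -> E e = zeta5 C -> emx E n icosaT =
  E nfive *: ((sqrtC 5)^-1 *: mx_rows n
    [:: [:: zeta5 C ^+ 2 - zeta5 C ^+ 4; zeta5 C ^+ 4 - 1];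
        [:: 1 - zeta5 C; zeta5 C ^+ 3 - zeta5 C]]).
Proof.
move=> sE eE; rewrite emx_rows !mx_rowsZ.
by rewrite /icosaT [LHS]/= [RHS]/= !five_sqrt // !evM !evD !evN !npowE ev1 eE.
Qed.

End RankTwoMatrices.

Section RankTwoVanishing.

Variable C : numClosedFieldType.
Local Notation w := (zeta3 C).
Local Notation e := (zeta5 C).

Lemma mpow_prod_sign (R : numRing) (E : numEval R C) (A B : seq (seq R)) (nu mu : R)
    (S T : 'M[C]_2) p (b : bool) :
  swf 2 A -> swf 2 B -> emx E 2 A = E nu *: S -> emx E 2 B = E mu *: T ->
  nnz (nmul nu mu) ->
  seqm (iter p (smul 2 (smul 2 A B)) (sone 2))
    (sscale ((if b then nopp else id) (iter p (nmul (nmul nu mu)) n1)) (sone 2)) ->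
  mpow (S *m T) p = ((-1) ^+ b)%:M.
Proof.
move=> wA wB AS BT nz; apply: (mpow_sign (E := E)) nz; first exact: swf_mul.
by rewrite emx_mul // AS BT evM -scalemxAr -scalemxAl scalerA mulrC.
Qed.

Definition Zi_i : Zi := (0, 1)%BZ.
Definition Zi2_i : Zi2 := ((0, 1), (0, 0))%BZ.
Definition Zi2_s : Zi2 := ((0, 0), (1, 0))%BZ.
Definition Zf5_e : Zf5 := ((0, 0), (1, 0))%BZ.
Definition Zf5_s : Zf5 := ((-1, 2), (0, 0))%BZ.

Lemma ZiE : Ei C Zi_i = 'i.
Proof. by rewrite /= /evQ /= /evZ /= mul1r add0r. Qed.
Lemma Zi2E : Ei2 C Zi2_i = 'i.
Proof. by rewrite /= /evQ /= /evQ /= /evZ /= !(mul0r, addr0, mul1r, add0r). Qed.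
Lemma Zi2_sE : Ei2 C Zi2_s = sqrtC 2.
Proof. by rewrite /= /evQ /= /evQ /= /evZ /= !(mul0r, addr0, mul1r, add0r). Qed.
Lemma Zf5_eE : Ef5 C Zf5_e = e.
Proof. by rewrite /= /evQ /= /evQ /= /evZ /= !(mul0r, addr0, mul1r, add0r). Qed.
Lemma Zf5_sE : Ef5 C Zf5_s = sqrtC 5.
Proof.
rewrite sqrt5_golden /= /evQ /= /evQ /= /evZ /= !(mul0r, addr0, mul1r, add0r).
by rewrite addrC.
Qed.

Section Group.

Variables (gT : finGroupType) (rG : mx_representation C [set: gT] 2).
Variables (P : 'M[C]_2) (gs : seq gT) (l m : C).
Hypotheses (fG : mx_faithful rG) (uP : P \in unitmx).

Let realizes (ss : seq 'M[C]_2) := [seq rG g | g <- gs] = [seq P *m s *m invmx P | s <- ss].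

(** In the polyhedral rotation groups the images of S, T and ST have orders 2, 3 and p = 3, 4 or 5.
    Hence up to sign l^2, m^3 and (lm)^p are scalars in the group, and the last hypothesis says that
    the square of one of them is not 1. *)
Lemma vanish_rank2 (S T : 'M[C]_2) p (b1 b2 b3 : bool) : realizes [:: l *: S; m *: T] ->
  mpow S 2 = ((-1) ^+ b1)%:M -> mpow T 3 = ((-1) ^+ b2)%:M ->
  mpow (S *m T) p = ((-1) ^+ b3)%:M ->
  [|| l ^+ 4 != 1, m ^+ 6 != 1 | (l * m) ^+ (p * 2) != 1] ->
  forall a, drinfeld rG a -> forall x, a x = 0.
Proof.
move=> gsE eS eT eST; have s1 (b : bool) : ((-1) ^+ b) ^+ 2 = 1 :> C by rewrite sqrr_sign.
have g0 : rG (nth 1%g gs 0) *m P = P *m (l *: S) := gen_conj uP gsE 0.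
have g1 : rG (nth 1%g gs 1) *m P = P *m (m *: T) := gen_conj uP gsE 1.
have g01 : rG (nth 1%g gs 0 * nth 1%g gs 1)%g *m P = P *m ((l * m) *: (S *m T)).
  rewrite reprM -mulmxA g1 mulmxA g0 -mulmxA; congr (_ *m _).
  by rewrite -scalemxAr -scalemxAl scalerA mulrC.
case/or3P => ne.
- exact: (vanish_power fG uP g0 eS (s1 b1) ne).
- exact: (vanish_power fG uP g1 eT (s1 b2) ne).
- exact: (vanish_power fG uP g01 eST (s1 b3) ne).
Qed.

Lemma vanish_tetra : realizes (tetra_gens 2 l m) ->
  [|| l ^+ 4 != 1, m ^+ 6 != 1 | (l * m) ^+ 6 != 1] ->
  forall a, drinfeld rG a -> forall x, a x = 0.
Proof.
move=> h; have SE := tetraSE ZiE 2; have TE := tetraTE ZiE 2.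
apply: (vanish_rank2 (b1 := true) (b2 := true) (b3 := false) (p := 3) h).
- by apply: (mpow_sign (A := tetraS Zi_i) _ SE); vm_compute.
- by apply: (mpow_sign (A := tetraT Zi_i) _ TE); vm_compute.
- by apply: (mpow_prod_sign (A := tetraS Zi_i) (B := tetraT Zi_i) _ _ SE TE); vm_compute.
Qed.

Lemma vanish_octa : realizes (octa_gens 2 l m) ->
  [|| l ^+ 4 != 1, m ^+ 6 != 1 | (l * m) ^+ 8 != 1] ->
  forall a, drinfeld rG a -> forall x, a x = 0.
Proof.
move=> h; have SE := octaSE Zi2E 2 Zi2_sE; have TE := octaTE Zi2E 2.
apply: (vanish_rank2 (b1 := true) (b2 := true) (b3 := true) (p := 4) h).
- by apply: (mpow_sign (A := octaS Zi2_i Zi2_s) _ SE); vm_compute.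
- by apply: (mpow_sign (A := octaT Zi2_i) _ TE); vm_compute.
- by apply: (mpow_prod_sign (A := octaS Zi2_i Zi2_s) (B := octaT Zi2_i) _ _ SE TE); vm_compute.
Qed.

Lemma vanish_icosa : realizes (icosa_gens 2 l m) ->
  [|| l ^+ 4 != 1, m ^+ 6 != 1 | (l * m) ^+ 10 != 1] ->
  forall a, drinfeld rG a -> forall x, a x = 0.
Proof.
move=> h; have SE := icosaSE 2 Zf5_sE Zf5_eE; have TE := icosaTE 2 Zf5_sE Zf5_eE.
apply: (vanish_rank2 (b1 := true) (b2 := false) (b3 := true) (p := 5) h).
- by apply: (mpow_sign (A := icosaS Zf5_e Zf5_s) _ SE); vm_compute.
- by apply: (mpow_sign (A := icosaT Zf5_e Zf5_s) _ TE); vm_compute.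
- by apply: (mpow_prod_sign (A := icosaS Zf5_e Zf5_s) (B := icosaT Zf5_e Zf5_s) _ _ SE TE);
  vm_compute.
Qed.

End Group.

Definition Zw_w : Zw := (0, 1)%BZ.

Lemma Zw_wE : Ew C Zw_w = w.
Proof. by rewrite /= /evQ /= /evZ /= mul1r add0r. Qed.

Lemma zeta3_cubed : w ^+ 3 = 1.
Proof. by rewrite -Zw_wE -npowE -(ev1 (Ew C)); apply: ev_eq; vm_compute. Qed.

Lemma zeta3_neq1 : w != 1.
Proof.
have: Ew C (nsub Zw_w n1) != 0 by apply: ev_nz.
by rewrite evD evN ev1 Zw_wE subr_eq0.
Qed.

Lemma zeta5_fifth : e ^+ 5 = 1.
Proof. by rewrite -Zf5_eE -npowE -(ev1 (Ef5 C)); apply: ev_eq; vm_compute. Qed.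

Lemma zeta5_neq1 : e != 1.
Proof.
have: Ef5 C (nsub Zf5_e n1) != 0 by apply: ev_nz.
by rewrite evD evN ev1 Zf5_eE subr_eq0.
Qed.

End RankTwoVanishing.

Section RankTwoScalars.

Variable C : numClosedFieldType.
Local Notation w := (zeta3 C).
Local Notation e := (zeta5 C).
Local Notation z8 := (zeta8 C).

Lemma expr_neq1 (x u : C) d m : x ^+ (d * m) = u -> u != 1 -> x ^+ d != 1.
Proof. by move=> xu; apply: contraNneq => xd; rewrite -xu exprM xd expr1n. Qed.

Lemma opp1_neq1 : -1 != 1 :> C.
Proof. by rewrite -subr_eq0 -opprD oppr_eq0 (pnatr_eq0 C 2). Qed.

(** All scalars l, m of the rank 2 generators are such monomials, with -1 = zeta8^4 and 'i =
    zeta8^2, so they can be compared through exponents. *)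
Definition root_monomial (t : nat * nat * nat) : C :=
  z8 ^+ t.1.1 * w ^+ t.1.2 * e ^+ t.2.

Lemma root_monomialM s t :
  root_monomial s * root_monomial t =
  root_monomial (s.1.1 + t.1.1, s.1.2 + t.1.2, s.2 + t.2)%N.
Proof. by rewrite /root_monomial !exprD; ring. Qed.

(** Some further power of the d-th power is exactly -1, zeta3 or zeta5, none of which is 1;
    exponents are reduced modulo 8, 3 and 5. *)
Definition nontrivial_power (s : nat * nat * nat) d :=
  has (fun m => ((s.1.1 * d * m) %% 8, (s.1.2 * d * m) %% 3, (s.2 * d * m) %% 5)%N
    \in [:: (4, 0, 0); (0, 1, 0); (0, 0, 1)]%N) (iota 1 5).

Lemma root_monomial_neq1 s d : nontrivial_power s d -> root_monomial s ^+ d != 1.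
Proof.
have z84 : z8 ^+ 4 = -1 by rewrite -[4%N]/(2 * 2)%N exprM zeta8_sq sqrCi.
have z88 : z8 ^+ 8 = 1 by rewrite -[8%N]/(4 * 2)%N exprM z84 sqrrN expr1n.
case/hasP => m _ h; apply: (@expr_neq1 _ _ d m erefl); move: h.
rewrite /root_monomial 2!exprMn -!exprM !mulnA.
rewrite -(expr_mod _ z88) -(expr_mod _ (zeta3_cubed C)) -(expr_mod _ (zeta5_fifth C)).
rewrite !inE => /or3P[] /eqP[-> -> ->]; rewrite !expr0 ?mulr1 ?mul1r ?expr1.
- by rewrite z84 opp1_neq1.
- exact: zeta3_neq1.
- exact: zeta5_neq1.
Qed.

(** The exponents of the two scalars in [ST_gens]. The indices 4 and 12 are left out, as their
    centers contain only 1 and -1. *)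
Definition rank2_scalars (k : nat) : option ((nat * nat * nat) * (nat * nat * nat)) :=
  match k with
  | 5 => Some ((4, 1, 0), (4, 1, 0))
  | 6 => Some ((2, 0, 0), (4, 1, 0))
  | 7 => Some ((2, 1, 0), (4, 1, 0))
  | 8 => Some ((3, 0, 0), (0, 0, 0))
  | 9 => Some ((2, 0, 0), (1, 0, 0))
  | 10 => Some ((7, 2, 0), (4, 1, 0))
  | 11 => Some ((2, 0, 0), (1, 1, 0))
  | 13 => Some ((2, 0, 0), (2, 0, 0))
  | 14 => Some ((2, 0, 0), (4, 1, 0))
  | 15 => Some ((2, 0, 0), (2, 1, 0))
  | 16 => Some ((4, 0, 3), (0, 0, 0))
  | 17 => Some ((2, 0, 0), (2, 0, 3))
  | 18 => Some ((4, 1, 3), (0, 2, 0))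
  | 19 => Some ((2, 1, 0), (2, 0, 3))
  | 20 => Some ((0, 0, 0), (0, 2, 0))
  | 21 => Some ((2, 0, 0), (0, 2, 0))
  | 22 => Some ((2, 0, 0), (0, 0, 0))
  | _ => None
  end%N.

Lemma ST_gens_rank2 n k :
  if rank2_scalars k is Some (s, t) then
    let l := root_monomial s in let m := root_monomial t in
    ST_gens C n k = if (k <= 7)%N then tetra_gens n l m
      else if (k <= 15)%N then octa_gens n l m else icosa_gens n l m
  else True.
Proof.
have z2 := zeta8_sq C; have i2 := sqrCi C.
have z84 : z8 ^+ 4 = -1 by rewrite -[4%N]/(2 * 2)%N exprM z2 i2.
case: k => [|[|[|[|[|k]]]]] //.
do 18?[case: k => [|k] //];
  rewrite /root_monomial /= ?(z84, z2, expr0, mulr1, mul1r, expr1, mulN1r) //.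
Qed.

Lemma ST_rank2_vanish k (gT : finGroupType) (rG : mx_representation C [set: gT] 2)
    (P : 'M[C]_2) (gs : seq gT) :
  mx_faithful rG -> P \in unitmx ->
  [seq rG g | g <- gs] = [seq P *m s *m invmx P | s <- ST_gens C 2 k] ->
  k \in [:: 5; 6; 7; 8; 9; 10; 11; 13; 14; 15; 16; 17; 18; 19; 20; 21; 22]%N ->
  forall a, drinfeld rG a -> forall x, a x = 0.
Proof.
move=> fG uP gsE kL; have := ST_gens_rank2 2 k.
have: is_true (if rank2_scalars k is Some (s, t) then
    let p := if (k <= 7)%N then 6 else if (k <= 15)%N then 8 else 10 in
    [|| nontrivial_power s 4, nontrivial_power t 6 |
        nontrivial_power (s.1.1 + t.1.1, s.1.2 + t.1.2, s.2 + t.2)%N p]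
  else false).
  by move: kL; rewrite !inE; do 16?[case/orP; first by move=> /eqP ->]; move=> /eqP ->.
case: (rank2_scalars k) => // -[s t] /=; rewrite -/(root_monomial s) => h kE.
have {h}ne : [|| root_monomial s ^+ 4 != 1, root_monomial t ^+ 6 != 1 |
    (root_monomial s * root_monomial t) ^+
      (if (k <= 7)%N then 6 else if (k <= 15)%N then 8 else 10) != 1].
  rewrite root_monomialM; apply/or3P; move/or3P: h.
  by case=> /root_monomial_neq1 h; [constructor 1|constructor 2|constructor 3].
move: gsE; rewrite kE; case: ifP ne => [_ ne gsE|_]; first exact: vanish_tetra fG uP gsE ne.
by case: ifP => _ ne gsE; [exact: vanish_octa fG uP gsE ne|exact: vanish_icosa fG uP gsE ne].
Qed.

End RankTwoScalars.

(** * Central scalars in rank at least three *)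

Section RootLists.

Variables (C : numClosedFieldType) (R : numRing) (E : numEval R C).
Variables (i w t : R).
Let o : R := n1.
Let z : R := n0.
Let m : R := nopp n1.

Definition ST_roots (k : nat) : seq (R * seq R) :=
  match k with
  | 24 => [seq (m, r) | r <- [:: [:: z; z; o]; [:: z; o; m]; [:: o; o; t]]]
  | 25 => [seq (w, r) | r <- [:: [:: o; z; z]; [:: z; o; z]; [:: o; o; o]]]
  | 26 => [:: (w, [:: o; z; z]); (w, [:: o; o; o]); (m, [:: o; m; z])]
  | 27 => [seq (m, r) | r <- [:: [:: z; o; z]; [:: o; t; nsub t o]; [:: z; o; w]]]
  | 29 => [seq (m, r) | r <-
      [:: [:: z; o; m; z]; [:: z; z; o; m]; [:: z; z; o; nopp i]; [:: o; o; o; o]]]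
  | 31 => [seq (m, r) | r <-
      [:: [:: o; m; z; z]; [:: z; o; m; z]; [:: z; z; o; nopp i]; [:: z; z; z; o];
          [:: o; o; o; o]]]
  | 32 => [seq (w, r) | r <-
      [:: [:: o; z; z; z]; [:: z; o; o; o]; [:: z; z; o; z]; [:: o; z; o; m]]]
  | 33 => [seq (m, r) | r <-
      [:: [:: o; m; z; z; z]; [:: z; o; m; z; z]; [:: z; z; o; m; z];
          [:: z; z; o; nopp w; z]; [:: o; o; o; o; t]]]
  | 34 => [seq (m, r) | r <-
      [:: [:: z; o; m; z; z; z]; [:: z; z; o; m; z; z]; [:: z; z; z; o; m; z];
          [:: z; z; z; z; o; m]; [:: z; z; z; z; o; nopp w]; [:: o; o; o; o; o; o]]]
  | _ => [::]
  end%N.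

Lemma ST_gens_roots n k : k \in [:: 24; 25; 26; 27; 29; 31; 32; 33; 34]%N ->
  (k \in [:: 29; 31]%N -> E i = 'i) ->
  (k \in [:: 25; 26; 27; 32; 33; 34]%N -> E w = zeta3 C) ->
  (k \in [:: 24; 27; 33]%N ->
     E t = if k == 24%N then klein C else if k == 27%N then golden C else sqrtC 2) ->
  ST_gens C n k = refl_list E n (ST_roots k).
Proof.
rewrite !inE => kL iE wE tE; move: kL iE wE tE.
do 8?[case/orP; first by move=> /eqP -> /= iE wE tE;
  rewrite /refl_list /= ?evD ?evN !ev1 ?ev0 ?iE ?wE ?tE].
by move=> /eqP -> /= iE wE tE; rewrite /refl_list /= ?evD ?evN !ev1 ?ev0 ?iE ?wE ?tE.
Qed.

End RootLists.

(** The expected scalar is read off the top left entry; [scalar_check] then compares the whole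
    matrix with it. *)
Definition refl_word_check n (R : numRing) (sr : seq (R * seq R)) (w : seq nat) :=
  refl_check n sr &&
  let As := reflKs n sr in
  scalar_check n As (normKs sr) w (sget (sword n As w) 0 0).

Section HighRankVanishing.

Variable C : numClosedFieldType.
Variables (gT : finGroupType) (n : nat) (rG : mx_representation C [set: gT] n).
Variables (P : 'M[C]_n) (gs : seq gT).
Hypotheses (fG : mx_faithful rG) (uP : P \in unitmx).

Let realizes (ss : seq 'M[C]_n) := [seq rG g | g <- gs] = [seq P *m s *m invmx P | s <- ss].

Lemma vanish_refl_word (R : numRing) (E : numEval R C) (sr : seq (R * seq R)) w :
  realizes (refl_list E n sr) -> refl_word_check n sr w ->
  forall a, drinfeld rG a -> forall x, a x = 0.
Proof.
move=> gsE /andP[sr_ok w_ok].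
exact: (vanish_word fG uP gsE (reflKs_swf n sr) (fun i => reflKsE E i sr_ok) w_ok).
Qed.

Definition Zwf_w : Zwf := ((0, 1), (0, 0))%BZ.
Definition Zwf_f : Zwf := ((0, 0), (1, 0))%BZ.

Lemma Zwf_wE : Ewf C Zwf_w = zeta3 C.
Proof. by rewrite /= /evQ /= /evQ /= /evZ /= !(mul0r, addr0, mul1r, add0r). Qed.

Lemma Zwf_fE : Ewf C Zwf_f = golden C.
Proof. by rewrite /= /evQ /= /evQ /= /evZ /= !(mul0r, addr0, mul1r, add0r). Qed.

Definition word_power (s : seq nat) p := flatten (nseq p s).

(** For G_25, G_26, G_29, G_32 and G_34 the exponents 4, 3, 5, 5, 7 are the largest degree 12, 18,
    20, 30, 42 divided by the order 3, 6, 4, 6, 6 of the center. In G_31, given by five reflections,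
    a power of the product of the last four is already a suitable scalar. *)
Lemma ST_high_rank_vanish k : n = ST_rank k ->
  k \in [:: 25; 26; 27; 29; 31; 32; 34]%N -> realizes (ST_gens C n k) ->
  forall a, drinfeld rG a -> forall x, a x = 0.
Proof.
move=> nk; rewrite !inE; do 6?[case/predU1P => [kE|]]; last move=> /eqP kE; rewrite ?kE in nk *.
- rewrite (ST_gens_roots (E := Ew C) (i := n0) (w := Zw_w) (t := n0) n) => // [h|_];
  last exact: Zw_wE.
  apply: (vanish_refl_word (w := word_power [:: 0; 1; 2]%N 4) h).
  by rewrite nk; vm_compute.
- rewrite (ST_gens_roots (E := Ew C) (i := n0) (w := Zw_w) (t := n0) n) => // [h|_];
  last exact: Zw_wE.
  apply: (vanish_refl_word (w := word_power [:: 0; 1; 2]%N 3) h).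
  by rewrite nk; vm_compute.
- rewrite (ST_gens_roots (E := Ewf C) (i := n0) (w := Zwf_w) (t := Zwf_f) n) => // [h|_|_];
  [|exact: Zwf_wE|exact: Zwf_fE].
  apply: (vanish_refl_word (w := word_power [:: 0; 1; 2]%N 4) h).
  by rewrite nk; vm_compute.
- rewrite (ST_gens_roots (E := Ei C) (i := Zi_i) (w := n0) (t := n0) n) => // [h|_];
  last exact: ZiE.
  apply: (vanish_refl_word (w := word_power [:: 0; 1; 2; 3]%N 5) h).
  by rewrite nk; vm_compute.
- rewrite (ST_gens_roots (E := Ei C) (i := Zi_i) (w := n0) (t := n0) n) => // [h|_];
  last exact: ZiE.
  apply: (vanish_refl_word (w := word_power [:: 1; 2; 3; 4]%N 5) h).
  by rewrite nk; vm_compute.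
- rewrite (ST_gens_roots (E := Ew C) (i := n0) (w := Zw_w) (t := n0) n) => // [h|_];
  last exact: Zw_wE.
  apply: (vanish_refl_word (w := word_power [:: 0; 1; 2; 3]%N 5) h).
  by rewrite nk; vm_compute.
- rewrite (ST_gens_roots (E := Ew C) (i := n0) (w := Zw_w) (t := n0) n) => // [h|_];
  last exact: Zw_wE.
  apply: (vanish_refl_word (w := word_power [:: 0; 1; 2; 3; 4; 5]%N 7) h).
  by rewrite nk; vm_compute.
Qed.

End HighRankVanishing.

(** * The group G_33 *)

Section ChangeOfBasis.

Variables (C : numClosedFieldType) (R : numRing) (E : numEval R C) (n : nat).
Variables (As gens : seq (seq (seq R))) (nus : seq R) (B B' : seq (seq R)) (N : R).

(** [B'] and [N] certify that [B] is invertible without leaving the ring, and conjugation of A_i by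
    [B] is tested in the form A_i B = nu_i B s_i. *)
Definition basis_check := [&& swf n B, swf n B', all (swf n) As, all (swf n) gens, nnz N,
  seqm (smul n B B') (sscale N (sone n)), size gens == size As &
  all (fun i => let nu := nth n1 nus i in nnz nu &&
        seqm (smul n (nth (sone n) As i) B) (sscale nu (smul n B (nth (sone n) gens i))))
    (iota 0 (size As))].

Variables (gT : finGroupType) (rG : mx_representation C [set: gT] n).
Variables (P : 'M[C]_n) (gs : seq gT) (ss : seq 'M[C]_n).
Hypotheses (uP : P \in unitmx)
  (gsP : [seq rG g | g <- gs] = [seq P *m s *m invmx P | s <- ss]).
Hypothesis AE : forall i,
  emx E n (nth (sone n) As i) = E (nth n1 nus i) *: nth 1%:M ss i.
Hypotheses (size_ss : size ss = size As) (chk : basis_check).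

Lemma basis_unit : P *m emx E n B \in unitmx.
Proof.
case/and5P: chk => wB wB' _ _ /and4P[/(ev_nz E) N0 /(emx_eq E n) BB _ _].
rewrite unitmx_mul uP /=; move: BB; rewrite emx_mul // emx_scale emx_one => BB.
have : emx E n B *m ((E N)^-1 *: emx E n B') = 1%:M.
  by rewrite -scalemxAr BB scalerA mulVf // scale1r.
by case/mulmx1_unit.
Qed.

Lemma basis_gens i : rG (nth 1%g gs i) *m (P *m emx E n B) =
  P *m emx E n B *m emx E n (nth (sone n) gens i).
Proof.
case/and5P: chk => wB _ wA wg /and4P[_ _ /eqP sg /allP h].
rewrite mulmxA (gen_conj uP gsP) -!mulmxA; congr (_ *m _).
have [iA|iA] := ltnP i (size As); last first.
  by rewrite !nth_default ?size_ss ?sg // emx_one mulmx1 mul1mx.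
have := h i; rewrite mem_iota iA => /(_ isT) /andP[/(ev_nz E) nu0] /(emx_eq E n).
rewrite emx_scale !emx_mul ?swf_nth // AE -scalemxAl.
by move/(scalerI nu0).
Qed.

End ChangeOfBasis.

(* Decimal digits, least significant first, shifted down by one: 213 is the word 2, 0, 1. *)
Fixpoint digit_word fuel (z : Z) : seq nat :=
  if fuel isn't fuel.+1 then [::] else if Z.eqb z 0 then [::] else
  let: (q, r) := Z.div_eucl z 10 in Z.to_nat (Z.pred r) :: digit_word fuel q.

Definition digit_words := map (digit_word 40).

Definition digit_cert : seq (seq (Z * Z)) -> seq (seq (seq nat * nat)) :=
  map (map (fun x => (digit_word 40 x.1, Z.to_nat x.2))).

Definition sone_row (R : numRing) n k (r : seq R) : seq (seq R) :=
  mkseq (fun i => if i == k then r else nth [::] (sone n) i) n.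

(** The 45 reflections of G_33. Since the generators are involutions, conjugates of generators are
    palindromes. *)
Definition g33_conj := digit_words
  [:: 1; 2; 3; 4; 5; 212; 323; 424; 434; 545; 32123; 42124; 43234; 34243; 54245; 24342;
      54345; 4321234; 3421243; 5421245; 5432345; 5342435; 1243421; 5243425; 243212342;
      543212345; 234212432; 534212435; 453424354; 512434215; 452434254; 52432123425;
      52342124325; 45342124354; 45124342154; 4524321234254; 4523421243254; 2453421243542;
      2451243421542; 345243212342543; 245234212432542; 345234212432543; 324534212435423;
      324512434215423; 23452432123425432]%BZ.

(** G_33 is {1, -1} times a simple group of order 25920, which has 20 classes; there is one word for
    each of them. *)
Definition g33_reps := digit_words
  [:: 0; 1; 12; 13; 123; 125; 234; 243; 1234; 1243; 1245; 121324; 234234; 243243;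
      1234234; 1234254; 1243243; 1243245; 121324354; 1213214254]%BZ.

Definition g33_cert := digit_cert [::
  [:: (0,1); (21,1); (2132,1); (2142,1); (214254,1); (2,1); (213,1); (214,1); (21324,1);
    (21425,1); (23,1); (24,1); (2134,1); (2143,1); (2145,1); (21343,1); (213245,1); (234,1);
    (243,1); (245,1); (21345,1); (21435,1); (2343,1); (213435,1); (2342,1); (2345,1);
    (2432,1); (2435,1); (214354,1); (23435,1); (2134354,1); (23425,1); (24325,1); (24354,1);
    (234354,1); (234254,1); (243254,1); (243542,1); (2343542,1); (2342543,1); (2432542,1);
    (2432543,1); (2435423,1); (23435423,1); (23425432,1)];
  [:: (0,0); (0,2); (0,3); (43,3); (4354,3); (1,2); (3,2); (4,2); (4,3); (435,3); (13,2);
    (14,2); (34,2); (43,2); (45,2); (343,2); (45,3); (134,2); (143,2); (145,2); (345,2);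
    (435,2); (1343,2); (3435,2); (421354213425,2); (1345,2); (1421354213425,2); (1435,2);
    (4354,2); (13435,2); (34354,2); (42135421342,2); (142135421342,2); (14354,2); (134354,2);
    (421354213242,2); (342154321432,2); (421354213242,3); (421543214232,3); (423215421342,2);
    (42135421342,3); (1423215421342,2); (421543214325,3); (42154321432,3); (243245432142,3)];
  [:: (2,1); (0,1); (0,4); (142134234,4); (0,5); (21,1); (3,4); (14213423,4); (14321423,4);
    (1421342345,4); (21,4); (4213423,4); (123,7); (123,6); (142134235,4); (4321423,4);
    (143214235,4); (12321,6); (12321,7); (42134235,4); (1235,7); (1235,6); (214321423,4);
    (43214235,4); (1324,7); (123215,6); (1423,6); (123215,7); (1432454213423,4);
    (2143214235,4); (1423454321423,4); (13245,7); (14235,6); (21432454213423,4);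
    (21423454321423,4); (21423454213423,4); (423454213423,4); (432454213423,4);
    (423454321423,4); (1432454321423,4); (1423454213423,4); (432454321423,4); (1342134234,5);
    (1432143243,5); (21432454321423,4)];
  [:: (2132,1); (3,4); (0,1); (421542345,5); (21435421324,3); (13,4); (0,4); (43214234,4);
    (1421542345,5); (42154234,5); (1,4); (343214234,4); (14213242,4); (143214234,4);
    (432142345,4); (142132423,4); (142154234,5); (24213242,4); (432142324,4); (3432142345,4);
    (142132425,4); (1432142345,4); (34213242,4); (1421324235,4); (421354213425,5);
    (242132425,4); (1421354213425,5); (4321423245,4); (4354,5); (342132425,4); (34354,5);
    (42135421342,5); (142135421342,5); (14354,5); (134354,5); (1421324542132421,4);
    (142132454213242,4); (43542132,5); (343542132,5); (342132454213242,4); (21425432,3);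
    (242132454213242,4); (143542132,5); (1343542132,5); (21421542,3)];
  [:: (32,2); (3,2); (0,2); (0,8); (134213245421324,4); (21,3); (0,3); (2,11); (0,9); (5,8);
    (321,2); (321,9); (123,9); (4,8); (25,11); (132,11); (5,9); (1432,11); (42,11); (3215,9);
    (1235,9); (45,8); (321,8); (1325,11); (2132,9); (14325,11); (1423,8); (425,11);
    (1321432435,10); (3215,8); (132143243,10); (21325,9); (14235,8); (12321432145,10);
    (1232143214,10); (4324354324,5); (34213214,19); (2432143245,10); (243214324,10);
    (342132423,19); (42342542134,5); (1423454234,5); (13215432435,10); (1321543243,10);
    (34324543214,5)];
  [:: (43542,3); (4354,3); (134213245421324,4); (5,10); (0,2); (435421,3); (14215423214254,4);
    (125,10); (342321542134254,10); (0,10); (42132454213242,4); (215,10); (123543214254,9);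
    (543214254,8); (12,10); (342135421342354,10); (1234213542134254,10); (12543214254,8);
    (4543214254,9); (21,10); (1213543214254,9); (1543214254,8); (3214254321435423,10);
    (3421354213423454,10); (3543214254,9); (121543214254,8); (34543214254,8);
    (14543214254,9); (13214232543,10); (321432454321423,10); (132142324543,10);
    (13543214254,9); (134543214254,8); (1321423254321,10); (12321423215432,10);
    (242345421342,4); (2423454234,4); (23214232543,10); (123214232543,10); (4324354324,4);
    (214234542134,4); (432435432142,4); (12134354,18); (1214354,18); (4324543214,4)];
  [:: (1,8); (4215423425,2); (34321,2); (321,2); (1543214254321,8); (21,8); (142132,2);
    (342321,2); (421,2); (543214254321,8); (1432,11); (1,11); (421542345,2); (0,13);
    (1234543214254321,11); (3214,2); (1542134235421,11); (0,8); (3421,8); (1543245,8);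
    (1543214254321,11); (234542134235421,8); (1234,11); (21543214254321,8); (234,8);
    (1542345,8); (21432,8); (1425432435,11); (542134235421,8); (21542345,8);
    (1345421342345421,8); (1425423425,11); (21543245,8); (543245,8); (1542345,11);
    (542345,8); (1543245,11); (1234543245,11); (21425423425,8); (234542345,8);
    (3421543245,8); (21425432435,8); (234543245,8); (3421542345,8); (1234542345,11)];
  [:: (1,9); (14215423425,2); (421,2); (34321,2); (125421342135421,9); (21,9); (343214,2);
    (132142,2); (321,2); (5432143254321,11); (42,11); (3243,11); (0,12); (1421542345,2);
    (54213421345421,9); (4213,2); (15421342354213,9); (4321,9); (0,9); (1213543245,9);
    (245432143254321,9); (2542134235421,11); (3,11); (35421342354213,11); (21342,9);
    (21542345,11); (243,9); (123543245,9); (1454321432454321,9); (125423425,9);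
    (5421342354213,9); (1215423425,9); (43543245,11); (5432435,11); (25423425,9);
    (14234542345,9); (245432435,9); (21343543245,9); (2542342543,11); (2542345,11);
    (2454324354,11); (23543245,9); (4254324354,9); (242542345,9); (123243542345,9)];
  [:: (1,6); (12,6); (14321423,4); (0,4); (21435421324,9); (42154234215,5); (14213242,4);
    (1432142,4); (142134234,4); (214354213245,9); (14234,4); (142132432,4); (421542345,5);
    (0,16); (5,15); (4,4); (321423215423,10); (0,6); (21,16); (324321542134,10);
    (143214235421,10); (21421354,15); (4321,4); (21421345,15); (142134542345,5); (54321,15);
    (243,16); (321421543214,10); (21343542132,9); (2435423,9); (3242135432,10);
    (32432542,10); (3215421345,15); (2425,15); (215421345,15); (1432142543,10);
    (2142354234,15); (321421542132,10); (242542134,9); (23542132423,15); (142345432,9);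
    (13214542321,9); (21343543214,9); (2421542,9); (3243542321,10)];
  [:: (1,7); (12,7); (142134234,4); (14321423,4); (242354213245,8); (142154234215,5);
    (143214234,4); (343,4); (0,4); (43214232542,10); (4324,4); (3421,4); (0,14);
    (1421542345,5); (12145421,17); (21421342,4); (24235421324,8); (21,14); (0,7);
    (234354232,8); (213432543,17); (432142342542,10); (214213214,4); (435,17); (234,14);
    (23425423245,10); (1421542342543,5); (45421,17); (234215423245,10); (43214542134,10);
    (21435421321,8); (142135432145,17); (4321425421321,10); (21343245421,17); (23435,17);
    (242154213,8); (42543214234,17); (234543214,8); (34324543214,10); (423214254324,17);
    (121321421542132,10); (24321435432,10); (321425432,8); (21425423421,8); (2142542,8)];
  [:: (142134234542,4); (14213423454,4); (242354213245,8); (1421342345,4); (142134234,4);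
    (4254,5); (2423421543243,10); (45,5); (321423215423,10); (0,5); (242543214234,9);
    (421,5); (45,17); (2142154,15); (421542,5); (215421,17); (21435421324,9); (45421,15);
    (2134254232,10); (1421342345421,4); (234354213214,8); (2423214235423,10); (24235423,8);
    (4,15); (121342132435,10); (234213543214,10); (14234254234,9); (21,17);
    (1232435421321,9); (3432142354,10); (2324215432,10); (124254,17); (21542,15); (12425,15);
    (21421542,17); (234354213425,8); (1432154234,10); (123243542321,10); (3421542134,8);
    (12154324,11); (1232435421345,9); (1254321425,11); (1234543214,11); (12435432,11);
    (24543214354,11)];
  [:: (142132432,4); (143214,4); (21421324,4); (2,4); (23421354324,10); (1321,7); (1232,6);
    (1,6); (432142342,4); (234213543245,10); (42342,4); (1432142,4); (34213423,4); (3432,4);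
    (2,15); (2,14); (5,18); (3,7); (213,16); (12421,17); (4542,15); (213423,17); (4213,4);
    (213421325423,10); (2421321,4); (42321,17); (24,4); (24234254,10); (234321542321,10);
    (2421321,15); (125421,17); (234235421,10); (5421321,18); (2543245,15);
    (3242154321435,10); (3435,18); (23421345432,10); (21421342,17); (13421342542134,10);
    (1234213454232,10); (21324213,15); (13423542345,10); (23435421,10); (1321432143,15);
    (12154324,17)];
  [:: (1,14); (43,7); (42,7); (232,7); (1543214254321,14); (12,14); (4,7); (23,7); (32,7);
    (1542134235421,14); (24,14); (124,14); (0,7); (2,7); (5421342354213,14); (3,7);
    (15421342354213,14); (2,14); (234,14); (1543245,14); (5421342135421,14);
    (542134235421,14); (23,14); (12543214254321,14); (0,14); (1542345,14); (2342,14);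
    (15432435,14); (543214254321,14); (12542345,14); (54234215423421,14); (15423425,14);
    (12543245,14); (2543245,14); (124542345,14); (2542345,14); (124543245,14); (5432435,14);
    (542342543,14); (542345,14); (54324354,14); (1245432435,14); (543245,14); (54234254,14);
    (5423425,14)];
  [:: (1,16); (34,6); (242,6); (32,6); (1543214254321,16); (12,16); (24,6); (3,6); (42,6);
    (1542134235421,16); (123,16); (23,16); (2,6); (0,6); (15421342135421,16); (4,6);
    (5421342135421,16); (243,16); (2,16); (1543245,16); (5421342354213,16);
    (2543214254321,16); (24,16); (542134235421,16); (2432,16); (1542345,16); (0,16);
    (15432435,16); (25432142543214,16); (12542345,16); (543214254321,16); (15423425,16);
    (12543245,16); (154324354,16); (5423425,16); (154234254,16); (5432435,16); (24543245,16);
    (542345,16); (245423425,16); (2543245,16); (543245,16); (245432435,16); (2542345,16);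
    (24542345,16)];
  [:: (1,12); (43,9); (24,11); (23,11); (2134215432145,15); (14321,9); (4,9); (123,9); (2,11);
    (2134543214232,15); (4324,9); (142342,9); (0,9); (12,9); (213421542321,15); (3,9);
    (213454321432,15); (432,9); (21342,9); (21454232,16); (245421321423,16);
    (21342154321,15); (4232,9); (24542132142,16); (0,12); (324354232,15); (234213245,18);
    (2145432,16); (213421543214,15); (32435432,15); (2454232142,16); (2143542134,16);
    (234354234,15); (21454324,16); (142543245,15); (214354213,16); (23435423,15);
    (2342154,15); (3245421,15); (21435421,16); (234215,15); (2343542,15); (23421543,15);
    (32454213,15); (324542134,15)];
  [:: (21354213423542,11); (15432142,8); (1543214235,8); (15432142543,8); (154321425,8);
    (13435421342345,10); (232,19); (5,8); (2134543214232,15); (2,11); (142321,10);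
    (1543214,8); (3543,8); (3243,19); (3423215421342543,10); (543214234,8); (15421342345,8);
    (15423214,8); (1432143,10); (0,19); (34,10); (121542132142,14); (142342154234254,10);
    (2454,11); (5423425,11); (54234,8); (1245423,14); (125432,14); (342135421342345,10);
    (24254321,11); (4,10); (123423454,10); (1543243,17); (343,19); (2542,8);
    (213542134235421,11); (542132423542,14); (542342154,14); (12321432154321,10);
    (14234254,10); (2421354,17); (154232,17); (242154,17); (54321435,14); (1423214254321,10)];
  [:: (1,13); (34,8); (12324,11); (132,11); (2132421354324,17); (13421,8); (124,8); (3,8);
    (1232,11); (213242135432,17); (132432,8); (3423,8); (12,8); (0,8); (234254213243,14);
    (4,8); (24213214542,17); (21432,8); (342,8); (24234542,17); (242321542345,17);
    (23425421324,14); (3242,8); (421342154321,17); (2154213245,18); (2134542,14); (0,13);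
    (154234254,17); (2342542132,14); (21345423,14); (2432145423421,17); (4324354324,17);
    (1214543214,14); (15423425,17); (213454234,14); (432435432,17); (121454321,14);
    (423454321,17); (243214543,17); (143543245,17); (4234543214,17); (1214542321,14);
    (4234542321,17); (24321454,17); (2432145,17)];
  [:: (13542134234542,11); (3543,9); (2132421354324,17); (121354321425,9); (12324,11);
    (135421,9); (354,9); (32435,19); (125421342154,9); (1254213421354,9); (1354213,9);
    (2321432145432,10); (2542134213,9); (3245,19); (1234213542134254,10); (254213421,9);
    (1213543214254,9); (13542134,10); (21432142543245,10); (35432,9); (12,10);
    (1232143245432142,10); (2134321,10); (123,10); (24354324,16); (421,19); (124543245,11);
    (354232,9); (123245,11); (1432,19); (12132542132,16); (21454213242,16);
    (135421342345421,11); (3214542134,11); (1542342,16); (1425423,15); (2342321542134,10);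
    (13245432,10); (232145,15); (142542,15); (245421345,16); (21343215423421,10);
    (2143245,10); (2321435,15); (25432145,16)];
  [:: (154213214,11); (34234543214,5); (154213245,11); (4321454234,5); (15421324,11);
    (12435421342354,11); (54321432542,11); (121542132145,14); (5,11); (13,11); (432454234,5);
    (15423214,11); (2542,11); (14254321423,11); (1542134,11); (54321435,11);
    (3421345432435,5); (2454213243,16); (12542345,11); (125432143245,11); (5421342345,11);
    (123245432,11); (435421342,11); (12354213243,16); (142543245,5); (54324,11);
    (43542132,11); (542132432,14); (543214325432,11); (2454213,11); (342134254321,5);
    (13435421321,11); (134235423,5); (342345432142,5); (15421342354213,11); (3543,11);
    (432145423,5); (13435423,5); (2454213242,11); (43215421,5); (1542132432,14); (13454,11);
    (2454213242135,11); (1435421,5); (2354213243,16)];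
  [:: (124215,17); (14213454321432,4); (235,15); (14321425423,4); (1421345432143,4);
    (121421,17); (232,15); (1421324325,4); (421321542,17); (14213243,4); (4213421354321,4);
    (25,15); (2154213214,15); (213425,17); (43214254232,4); (42134234,15); (2543214,15);
    (14213243542,4); (243214,17); (0,15); (2134,17); (12142135423,15); (42542321,17);
    (421321454,17); (2432142542345,4); (143214254234,4); (2142321542,15); (2142321454,15);
    (124,17); (2425421321,17); (12425,17); (421324354,4); (24321425,17); (2134235423,17);
    (1421324,15); (421342135421,4); (1215421,15); (142132425,15); (142321542345,17);
    (1454234254,17); (1245421,15); (4254,19); (12454213423,15); (12543214254,15);
    (24235423,17)]]%BZ.

(** In a basis of roots each generator alters one coordinate only. Its special row is a row of the
    identity minus one of a Cartan matrix over Z[zeta3]; the entries zeta3^2 = -1 - zeta3 and zeta3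
    come from the triangle of roots 1, 2, 3. *)
Definition g33_gens : seq (seq (seq Zw)) :=
  let z : Zw := n0 in let o : Zw := n1 in let m : Zw := nopp n1 in
  [:: sone_row 5 0 [:: m; o; z; z; z]; sone_row 5 1 [:: o; m; o; o; z];
      sone_row 5 2 [:: z; o; m; (-1, -1)%BZ : Zw; z];
      sone_row 5 3 [:: z; o; (0, 1)%BZ : Zw; m; m]; sone_row 5 4 [:: z; z; z; m; m]].

(* The two certificates of each entry concern the representative and its negative. *)
Definition g33_vcerts : seq (vcert Zw * vcert Zw) :=
  let reg := VRegular Zw in let rfl := VReflection Zw in
  [:: (VCentral Zw, reg 0 1 2 0 1 2);
      (rfl 0 0, reg 0 2 3 1 2 3);
      (VEigen [:: 3; 2; 1; 3; 2; 0; 1; 3; 2; 0; 1; 0]%N ((-1, -1)%BZ : Zw) 0 1 0 1,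
       reg 0 1 2 0 1 2);
      (rfl 0 0, reg 0 2 4 1 3 4);
      (reg 0 1 2 0 1 2, reg 0 1 2 0 1 3);
      (reg 0 1 4 0 1 3, reg 0 1 2 0 1 2);
      (reg 1 2 3 0 1 2, reg 0 2 1 0 1 2);
      (reg 1 2 3 0 1 2, reg 0 2 1 0 1 2);
      (reg 0 1 2 0 1 2, reg 0 1 3 0 1 2);
      (reg 0 1 2 0 1 2, reg 0 1 2 0 1 2);
      (reg 0 1 3 0 1 2, reg 0 1 2 0 1 2);
      (reg 0 1 2 0 1 2, reg 0 2 3 0 1 2);
      (reg 1 2 3 0 1 2, reg 0 1 2 0 1 2);
      (reg 1 2 3 0 1 2, reg 0 1 2 0 1 2);
      (reg 0 1 2 0 1 2, reg 0 1 2 0 1 2);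
      (reg 0 1 2 0 1 2, reg 0 1 2 0 1 2);
      (reg 0 1 2 0 1 2, reg 0 1 2 0 1 2);
      (reg 0 1 2 0 1 2, reg 0 1 2 0 1 2);
      (reg 0 1 2 0 1 2, reg 0 2 3 0 1 2);
      (reg 0 1 3 0 1 2, reg 0 1 3 0 1 2)].

Definition Zw2_emb (x : Zw) : Zw2 := (x, n0).
Definition Zw2_s : Zw2 := (n0, n1).

(* The columns are the multiples of the roots in which the generators of the group
   become g33_gens; g33_cobasis is 18 times the inverse. *)
Definition g33_basis : seq (seq Zw2) :=
  let z := n0 in let a := Zw2_emb (3, 0)%BZ in let b := nopp a in
  let c := Zw2_emb (1, -1)%BZ in
  [:: [:: a; z; z; z; c]; [:: b; a; z; z; c]; [:: z; b; a; a; c];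
      [:: z; z; b; Zw2_emb (0, -3)%BZ; c]; [:: z; z; z; z; nmul Zw2_s c]].

Definition g33_cobasis : seq (seq Zw2) :=
  let z := n0 in let e := fun x y => Zw2_emb (x, y)%BZ in
  let s := fun x y => nmul Zw2_s (Zw2_emb (x, y)%BZ) in
  [:: [:: e 6 0; z; z; z; s (-3) 0]; [:: e 6 0; e 6 0; z; z; s (-6) 0];
      [:: e 2 (-2); e 2 (-2); e 2 (-2); e (-4) (-2); s (-1) 4];
      [:: e 4 2; e 4 2; e 4 2; e 4 2; s (-8) (-4)]; [:: z; z; z; z; s 6 3]]%BZ.

Definition g33_roots := ST_roots n0 (Zw2_emb Zw_w) Zw2_s 33.

Lemma g33_basis_check : basis_check 5 (reflKs 5 g33_roots)
  [seq [seq [seq Zw2_emb x | x <- r] | r <- A] | A <- g33_gens] (normKs g33_roots)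
  g33_basis g33_cobasis (Zw2_emb (18, 0)%BZ).
Proof. by vm_compute. Qed.

Lemma g33_cover : cover_check 5 g33_gens [seq sword 5 g33_gens w | w <- g33_conj]
  [seq sword 5 g33_gens w | w <- g33_reps] g33_cert true.
Proof. by vm_compute. Qed.

Lemma g33_vchecks : all2 (fun w (v : vcert Zw * vcert Zw) =>
    let c := sword 5 g33_gens w in
    vcheck 5 g33_gens c v.1 && vcheck 5 g33_gens (sopp c) v.2) g33_reps g33_vcerts.
Proof. by vm_compute. Qed.

Section G33.

Variable C : numClosedFieldType.

Lemma Zw2_embE x : Ew2 C (Zw2_emb x) = Ew C x.
Proof. by rewrite -[LHS]/(Ew C x + Ew C n0 * sqrtC 2) ev0 mul0r addr0. Qed.

Lemma Zw2_sE : Ew2 C Zw2_s = sqrtC 2.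
Proof. by rewrite -[LHS]/(Ew C n0 + Ew C n1 * sqrtC 2) ev0 ev1 add0r mul1r. Qed.

Lemma emx_emb n A : emx (Ew2 C) n [seq [seq Zw2_emb x | x <- r] | r <- A] = emx (Ew C) n A.
Proof.
rewrite !emx_rows -map_comp; congr mx_rows; apply: eq_map => r /=.
by rewrite -map_comp; apply: eq_map => x; apply: Zw2_embE.
Qed.

Lemma ST33_vanish (gT : finGroupType) (rG : mx_representation C [set: gT] 5)
    (P : 'M[C]_5) (gs : seq gT) :
  mx_faithful rG -> P \in unitmx -> <<[set:: gs]>>%g = [set: gT] ->
  [seq rG g | g <- gs] = [seq P *m s *m invmx P | s <- ST_gens C 5 33] ->
  forall a, drinfeld rG a -> forall x, a x = 0.
Proof.
move=> fG uP gsG gsP a da x.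
have sg : size gs = 5%N by rewrite -(size_map rG) gsP size_map.
move: gsP; rewrite (ST_gens_roots (E := Ew2 C) (i := n0) (w := Zw2_emb Zw_w) (t := Zw2_s) 5) //;
  last 2 first.
- by rewrite Zw2_embE Zw_wE.
- by rewrite Zw2_sE.
rewrite -/g33_roots => gsP; have rok : refl_check 5 g33_roots by vm_compute.
have AE i := reflKsE (Ew2 C) i rok.
have uQ := basis_unit (Ew2 C) uP g33_basis_check.
have gsE := basis_gens uP gsP AE erefl g33_basis_check.
set Q := P *m _ in uQ gsE.
have {}gsE i : rG (nth 1%g gs i) *m Q = Q *m emx (Ew C) 5 (nth (sone 5) g33_gens i).
  rewrite gsE; congr (_ *m _); rewrite -emx_emb.
  by case: i => [|[|[|[|[|[|i]]]]]].
have wfg : all (swf 5) g33_gens by vm_compute.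
have [y [j [b [jr _ xy]]]] := coverP gsG wfg gsE sg g33_cover x.
apply: (drinfeld_conj (y := y) da).
rewrite size_map in jr; rewrite (nth_map [::]) // in xy.
have /andP[v1 v2] := all2_nth [::] (VCentral Zw, VCentral Zw) g33_vchecks jr.
(* If the sign is -1, [x] is conjugate to the negative of the representative, whose fixed space is a
   different one; hence the second certificate. *)
move: xy; case: b => /= xy.
  apply: (vcheckP fG uQ wfg gsE da _ _ v2); first by apply/swf_map/swf_word.
  by rewrite emx_opp -scaleN1r.
apply: (vcheckP fG uQ wfg gsE da _ _ v1); first exact: swf_word.
by rewrite -[emx _ _ _]scale1r.
Qed.

End G33.

(** * The groups G_4, G_12 and G_24 *)

Section Det3.

Variables (C : numClosedFieldType) (R : numRing) (E : numEval R C).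

Definition sdet3 (A : seq (seq R)) :=
  let d i j := nsub (nmul (sget A 1 i) (sget A 2 j)) (nmul (sget A 1 j) (sget A 2 i)) in
  nadd (nsub (nmul (sget A 0 0) (d 1 2)) (nmul (sget A 0 1) (d 0 2)))
       (nmul (sget A 0 2) (d 0 1))%N.

Lemma emx_det3 A : \det (emx E 3 A) = E (sdet3 A).
Proof.
rewrite (expand_det_row _ ord0) !big_ord_recl big_ord0 /cofactor.
rewrite !(expand_det_row _ ord0) !big_ord_recl !big_ord0 /cofactor !det_mx11 !mxE /=.
rewrite /sdet3 /nsub !(evD, evN, evM).
rewrite !(expr0, expr1, addn0, add0n, addnn) /=.
rewrite ?expr2; ring.
Qed.

End Det3.

Definition skew2 (R : numRing) : seq (seq R) := [:: [:: n0; n1]; [:: nopp n1; n0]].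

(* The Gram matrix of (u, v) |-> det (f, u, v) for f = (x, y, z). *)
Definition skew3 (R : numRing) (x y z : R) : seq (seq R) :=
  [:: [:: n0; z; nopp y]; [:: nopp z; n0; x]; [:: y; nopp x; n0]].

Definition elements (R : numRing) n (gens : seq (seq (seq R))) :=
  sclosure n gens 30 [:: sone n] [:: sone n].

(** The first generator has order 4 and 6 conjugates; the second is a reflection of order 3 with 4
    conjugates. Inverses are spelled as positive powers. *)
Definition g4_conj := digit_words
  [:: 1; 2; 2122; 12111; 12122111; 2212222; 21211122; 21212211122; 121211122111;
      22121221112222]%BZ.

Definition g4_reps := digit_words
  [:: 0; 1; 2; 11; 22; 112; 122]%BZ.

Definition g4_cert := digit_cert [::
  [:: (0,1); (0,2); (22,1); (1,2); (212,1); (2,1); (121,2); (21,1); (12,2); (2122,1)];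
  [:: (0,3); (121,2); (21,1); (12,2); (2,1); (22,1); (0,5); (212,1); (1,5); (0,0)];
  [:: (12,2); (0,4); (1,2); (0,6); (1,5); (121,2); (12,6); (121,5); (1,6); (12,5)];
  [:: (2122,1); (0,5); (212,1); (1,5); (22,1); (21,1); (121,5); (2,1); (12,5); (0,1)];
  [:: (1,6); (0,0); (0,6); (22,1); (12,4); (12,6); (2,1); (1,4); (0,1); (121,4)];
  [:: (12,5); (121,6); (1,5); (12,4); (1,2); (121,5); (1,4); (121,2); (121,4); (12,2)];
  [:: (12,6); (0,1); (121,6); (21,1); (0,4); (121,4); (22,1); (1,6); (0,3); (1,4)]]%BZ.

Definition Ziw_i : Ziw := ((0, 1), (0, 0))%BZ.
Definition Ziw_w : Ziw := ((0, 0), (1, 0))%BZ.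

Definition g4_gens : seq (seq (seq Ziw)) :=
  [:: [:: [:: n0; nopp n1]; [:: n1; n0]];
      [:: [:: nopp (nadd n1 Ziw_w); nopp Ziw_w]; [:: n0; n1]]].

Definition g4_basis : seq (seq Ziw) :=
  [:: [:: ((-2, 0), (-1, -1)); ((0, 2), (-1, 1))]; [:: ((0, 0), (-1, -1)); ((0, 0), (1, -1))]]%BZ.

Definition g4_cobasis : seq (seq Ziw) :=
  [:: [:: ((-1, 1), (1, 1)); ((1, -1), (1, -1))];
      [:: ((-1, -1), (-1, 1)); ((-1, -1), (-1, -1))]]%BZ.

Definition g4_scaled : seq (seq (seq Ziw)) :=
  [:: sscale (nopp n1) (tetraS Ziw_i); sscale (nopp Ziw_w) (tetraT Ziw_i)].

Definition g4_orders : seq nat := [:: 1; 4; 3; 2; 3; 6; 6]%N.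

(** The entry at index 1 only fills the position of the class of order 4, which carries a form and
    is treated in [g4_goods]. Each other class is centralized by an element of determinant different
    from 1. *)
Definition g4_vcerts : seq (vcert Ziw) :=
  let d := VDet Ziw in
  [:: d [:: 1]; VCentral Ziw; d [:: 1]; d [:: 1]; d [:: 1]; d [:: 1]; d [:: 0; 1]]%N.

Definition g4_goods := [:: (1, skew2 Ziw, (0, 1, 0, 1))]%N.

Lemma g4_basis_check : basis_check 2 g4_scaled g4_gens [:: n1; ntwo Ziw]
  g4_basis g4_cobasis ((4, 0), (0, 0))%BZ.
Proof. by vm_compute. Qed.

Lemma g4_classify : classify_check 2 g4_gens g4_conj g4_reps g4_cert g4_orders g4_vcerts
  g4_goods (elements 2 g4_gens).
Proof. by vm_compute. Qed.

(** The 12 reflections, conjugate to the first generator, and the 8 elements of order 6, conjugate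
    to the second. *)
Definition g12_conj := digit_words
  [:: 1; 2; 2122222; 121; 121222221; 2212222222222; 212122222; 212122222122222;
      122122222222221; 12121222221; 221212222222222; 12121222221222221;
      221212222212222222222; 212212222222222122222; 21212122222122222;
      12212122222122222222221; 12122122222222221222221; 22121212222212222222222;
      21221212222212222222222122222; 1221212122222122222222221]%BZ.

Definition g12_reps := digit_words
  [:: 0; 1; 2; 12; 22; 222; 1212; 12222]%BZ.

Definition g12_cert := digit_cert [::
  [:: (0,1); (0,2); (22,1); (1,2); (221,1); (2,1); (122,2); (2121,1); (21,1); (1212,2); (12,2);
    (212,1); (2212,1); (2122,1); (121,2); (22121,1); (21221,1); (12122,2); (212212,1);
    (121221,2)];
  [:: (0,0); (0,3); (121,2); (1,3); (12,2); (122,2); (2,1); (21,6); (1212,2); (21,1); (221,1);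
    (2,6); (122,4); (121,4); (22,1); (1212,4); (12,4); (2121,7); (0,5); (212,7)];
  [:: (1,3); (0,4); (2,3); (1,6); (21,1); (0,3); (2,6); (2122,1); (2121,1); (1,2); (0,6);
    (221,1); (212,1); (2212,1); (122,2); (0,7); (2,7); (12,2); (1,7); (0,0)];
  [:: (1,2); (212,3); (1,6); (2,3); (1212,2); (0,2); (212,1); (121,4); (21,6); (1,3); (21,3);
    (12,2); (2,6); (122,4); (2,1); (121221,4); (212,6); (221,1); (12122,4); (0,1)];
  [:: (2121,3); (0,5); (212,3); (122,4); (2121,1); (21,3); (12,4); (2212,1); (2122,1); (1,6);
    (1,4); (21,1); (221,1); (212,1); (2,6); (21,7); (212,7); (0,6); (2121,7); (0,2)];
  [:: (212212,1); (121221,4); (21221,1); (12122,4); (2122,1); (22121,1); (1212,4); (212,1);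
    (2212,1); (122,4); (121,4); (2121,1); (21,1); (221,1); (12,4); (2,1); (22,1); (1,4);
    (0,1); (0,4)];
  [:: (2,3); (12,4); (2212,1); (0,4); (1,3); (212,3); (12,2); (21,7); (22,1); (1,4); (1212,4);
    (21,3); (21221,1); (1,7); (0,2); (212,7); (21,1); (1212,2); (2,7); (1,2)];
  [:: (12122,4); (212,7); (212,6); (2,7); (122,4); (121221,4); (2121,1); (12,2); (2,6); (1,7);
    (21,7); (121,4); (21,6); (1212,2); (22121,1); (0,2); (1,6); (2122,1); (1,2); (212212,1)]]%BZ.

Definition g12_gens : seq (seq (seq Zi2)) :=
  [:: [:: [:: nopp n1; nopp (nadd n1 (nmul Zi2_i Zi2_s))]; [:: n0; n1]];
      [:: [:: n0; nopp n1]; [:: n1; n1]]].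

Definition g12_basis : seq (seq Zi2) :=
  [:: [:: ((-2, 0), (-1, 0)); ((-1, -1), (0, -1))];
      [:: ((0, 0), (0, -1)); ((1, -1), (0, -1))]]%BZ.

Definition g12_cobasis : seq (seq Zi2) :=
  [:: [:: ((0, -2), (-1, 1)); ((0, -2), (1, 1))]; [:: ((-2, 0), (2, 0)); ((0, 2), (0, 0))]]%BZ.

Definition g12_scaled : seq (seq (seq Zi2)) :=
  [:: sscale Zi2_i (octaS Zi2_i Zi2_s); sscale n1 (octaT Zi2_i)].

Definition g12_orders : seq nat := [:: 1; 2; 6; 8; 3; 2; 4; 8]%N.

Definition g12_vcerts : seq (vcert Zi2) :=
  let d := VDet Zi2 in
  [:: d [:: 0]; d [:: 0]; VCentral Zi2; d [:: 1; 0]; VCentral Zi2; d [:: 0];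
      d [:: 1; 0]; d [:: 1; 0]]%N.

Definition g12_goods :=
  [:: (2, skew2 Zi2, (0, 1, 0, 1)); (4, skew2 Zi2, (0, 1, 0, 1))]%N.

Lemma g12_basis_check : basis_check 2 g12_scaled g12_gens [:: ntwo Zi2; ntwo Zi2]
  g12_basis g12_cobasis ((4, 0), (0, 0))%BZ.
Proof. by vm_compute. Qed.

Lemma g12_classify : classify_check 2 g12_gens g12_conj g12_reps g12_cert g12_orders
  g12_vcerts g12_goods (elements 2 g12_gens).
Proof. by vm_compute. Qed.

Definition g24_conj := digit_words
  [:: 1; 2; 3; 212; 313; 121; 323; 131; 232; 32123; 23132; 31213; 13231; 21312; 12321;
      1321231; 1231321; 2132312; 313212313; 212313212; 121323121]%BZ.

Definition g24_reps := digit_words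
  [:: 0; 1; 12; 123; 132; 1212; 1213; 12123; 123123; 132132; 1212313; 1212313212313]%BZ.

Definition g24_cert := digit_cert [::
  [:: (0,1); (32313,1); (23212,1); (2,1); (3,1); (23123,1); (3231,1); (32132,1); (2321,1);
    (23,1); (32,1); (2312,1); (323,1); (3213,1); (232,1); (231,1); (321,1); (2323,1);
    (2313,1); (3212,1); (23231,1)];
  [:: (0,0); (0,2); (132132,2); (0,5); (32132,5); (1,2); (2132,6); (32132,2); (123123,6);
    (131323,2); (313,2); (231232,6); (21232,6); (232132,6); (13123,6); (31323,2); (1313,2);
    (21312,6); (313,5); (31323,5); (131213,6)];
  [:: (23123,1); (0,1); (0,3); (32313,1); (12323,7); (2,1); (123123,7); (21,4); (0,4); (12,4);
    (123213,7); (1212,4); (2313,7); (3,3); (21,3); (312,3); (13231,7); (12313,7); (2313,10);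
    (13213,7); (132313,7)];
  [:: (3123,2); (123123,6); (0,2); (212,6); (0,6); (32131,2); (132132,2); (132312,6); (2132,6);
    (31231,2); (31,9); (232131,6); (123,6); (1212,9); (321,2); (3231,9); (3,2); (12,9);
    (213,9); (323,9); (12123,9)];
  [:: (13123,2); (132132,2); (2132,6); (12,6); (131,6); (23123,6); (123123,6); (131,2); (0,2);
    (21,8); (131231,2); (1313,8); (132,2); (21323,6); (2,6); (13213,2); (2321,8); (13,8);
    (232,8); (312,8); (13132,8)];
  [:: (2,1); (23123,1); (0,7); (0,1); (0,10); (32313,1); (312313,10); (1,7); (2,7); (31,7);
    (2,10); (32,7); (213123,10); (12,7); (21,7); (3,7); (21,10); (23123,10); (0,11);
    (212,10); (32313,10)];
  [:: (21,4); (2,7); (23123,1); (212,3); (0,3); (2312,1); (0,7); (12323,7); (312313,10); (2,4);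
    (312132,10); (23212,1); (232,10); (313,3); (131232,7); (213231,10); (12123,4); (2132,7);
    (3231,10); (21323,10); (323,7)];
  [:: (23213,6); (2,6); (0,5); (131323,2); (232131,6); (32313,2); (0,6); (3132,2); (13231,2);
    (132132,2); (312,9); (31231,2); (1321,8); (212,9); (21,8); (31212,5); (0,8); (2,9);
    (3,5); (2312,6); (323,6)];
  [:: (123,7); (3231,4); (12,7); (323,4); (1212,4); (1231,7); (12323,7); (12123,4); (31,4);
    (123123,7); (3,10); (12,4); (213,4); (32313,10); (12321,7); (32132,10); (0,7);
    (21321,10); (21312,10); (3123,10); (21,10)];
  [:: (213,7); (2132,7); (2321,3); (1313,3); (232,3); (13132,3); (21,3); (2131,7); (31,7);
    (21,10); (123123,7); (213212,10); (2,7); (13,3); (312,3); (123213,7); (213123,10);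
    (3231,10); (232,10); (3213,10); (3,10)];
  [:: (3132,2); (13231,6); (23213,6); (31323,5); (0,5); (1323,6); (31,8); (232131,6);
    (13212,8); (232,6); (132312,6); (12,9); (3,8); (121,9); (2313,8); (2321,6); (212323,6);
    (31,9); (32132,5); (313,5); (3,9)];
  [:: (3132,5); (3231,5); (31212,5); (313,5); (31323,5); (323,5); (32313,5); (3212,5);
    (3121,5); (31,5); (32131,5); (32,5); (31232,5); (321,5); (312,5); (3,5); (3213,5);
    (3123,5); (0,5); (32132,5); (31231,5)]]%BZ.

Definition Zk_k : Zk := (0, 1)%BZ.
Definition g24_roots := ST_roots n0 n0 Zk_k 24.

Definition g24_gens : seq (seq (seq Zk)) :=
  let row := @sone_row Zk 3 in
  [:: row 0 [:: (-1, 0); (-1, -1); (0, -1)]%BZ; row 1 [:: (0, 1); (-1, 0); (-1, -1)]%BZ;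
      row 2 [:: (1, 1); (0, 1); (-1, 0)]%BZ].

Definition g24_basis : seq (seq Zk) :=
  [:: [:: (0, 0); (0, 0); (0, 1)]; [:: (0, 0); (2, 0); (0, 1)];
      [:: (0, 2); (-2, 0); (-2, -1)]]%BZ.

Definition g24_cobasis : seq (seq Zk) :=
  [:: [:: (-1, 1); (-1, -1); (-1, -1)]; [:: (-2, 0); (2, 0); (0, 0)];
      [:: (-2, -2); (0, 0); (0, 0)]]%BZ.

Definition g24_orders : seq nat := [:: 1; 2; 4; 14; 14; 2; 3; 6; 7; 7; 4; 2]%N.

Definition g24_vcerts : seq (vcert Zk) :=
  let r := VRegular Zk 0 1 2 0 1 2 in let s := VReflection Zk 0 0 in let c := VCentral Zk in
  [:: c; s; c; r; r; s; c; r; r; r; r; r].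

(** The triples given to [skew3] span the fixed lines of the representatives, of order 4 and 3
    respectively: the cyclic condition forces ker (g - 1) into the radical. *)
Definition g24_goods : seq (nat * seq (seq Zk) * (nat * nat * nat * nat)) :=
  [:: (2, skew3 ((-1, -1)%BZ : Zk) (0, -1)%BZ (2, 0)%BZ, (0, 1, 0, 1));
      (6, skew3 ((-2, 0)%BZ : Zk) (-3, -1)%BZ (0, -2)%BZ, (0, 2, 0, 1))]%N.

Lemma g24_basis_check : basis_check 3 (reflKs 3 g24_roots) g24_gens (normKs g24_roots)
  g24_basis g24_cobasis (4, 0)%BZ.
Proof. by vm_compute. Qed.

Lemma g24_classify : classify_check 3 g24_gens g24_conj g24_reps g24_cert g24_orders
  g24_vcerts g24_goods (elements 3 g24_gens).
Proof. by vm_compute. Qed.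

Section Classification.

Variable C : numClosedFieldType.

Lemma Ziw_iE : Eiw C Ziw_i = 'i.
Proof. by rewrite /= /evQ /= /evQ /= /evZ /= !(mul0r, addr0, mul1r, add0r). Qed.

Lemma Ziw_wE : Eiw C Ziw_w = zeta3 C.
Proof. by rewrite /= /evQ /= /evQ /= /evZ /= !(mul0r, addr0, mul1r, add0r). Qed.

Lemma Zk_kE : Ek C Zk_k = klein C.
Proof. by rewrite /= /evQ /= /evZ /= mul1r add0r. Qed.

Lemma g4_scaledE i : emx (Eiw C) 2 (nth (sone 2) g4_scaled i) =
  Eiw C (nth n1 [:: n1; ntwo Ziw] i) *: nth 1%:M (ST_gens C 2 4) i.
Proof.
case: i => [|[|i]]; last by rewrite !nth_default // emx_one ev1 scale1r.
- by rewrite [LHS]emx_scale (tetraSE Ziw_iE) scalerA mulrC -scalerA evN ev1.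
- by rewrite [LHS]emx_scale evN Ziw_wE (tetraTE Ziw_iE) scalerA mulrC -scalerA.
Qed.

Lemma g12_scaledE i : emx (Ei2 C) 2 (nth (sone 2) g12_scaled i) =
  Ei2 C (nth n1 [:: ntwo Zi2; ntwo Zi2] i) *: nth 1%:M (ST_gens C 2 12) i.
Proof.
case: i => [|[|i]]; last by rewrite !nth_default // emx_one ev1 scale1r.
- by rewrite [LHS]emx_scale Zi2E (octaSE (Zi2E C) _ (Zi2_sE C)) scalerA mulrC -scalerA.
- by rewrite [LHS]emx_scale ev1 (octaTE (Zi2E C)) scalerA mulrC -scalerA.
Qed.

Section Group.

Variables (gT : finGroupType) (n : nat) (rG : mx_representation C [set: gT] n).
Variables (P : 'M[C]_n) (gs : seq gT).
Hypotheses (fG : mx_faithful rG) (uP : P \in unitmx) (gsG : <<[set:: gs]>>%g = [set: gT]).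

Let realizes (ss : seq 'M[C]_n) := [seq rG g | g <- gs] = [seq P *m s *m invmx P | s <- ss].

Definition supports (good : gT -> Prop) :=
  forall x, (exists a, drinfeld rG a /\ a x <> 0) <-> good x.

Definition form_dim d := exists U : {vspace {ffun gT -> 'M[C]_n}},
  (forall a, a \in U <-> drinfeld rG a) /\ \dim U = d.

End Group.

Section RankTwo.

Variables (gT : finGroupType) (rG : mx_representation C [set: gT] 2).
Variables (P : 'M[C]_2) (gs : seq gT).
Hypotheses (fG : mx_faithful rG) (uP : P \in unitmx) (gsG : <<[set:: gs]>>%g = [set: gT]).

Lemma ST4_classification :
  [seq rG g | g <- gs] = [seq P *m s *m invmx P | s <- ST_gens C 2 4] ->
  supports rG (fun x => #[x]%g = 4%N) /\ form_dim rG 1.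
Proof.
move=> gsP; have sg : size gs = 2%N by rewrite -(size_map rG) gsP size_map.
have uQ := basis_unit (Eiw C) uP g4_basis_check.
have gsE := basis_gens uP gsP g4_scaledE erefl g4_basis_check.
have wfg : all (swf 2) g4_gens by vm_compute.
split; last exact: (classified_dim fG uQ gsG wfg gsE sg g4_classify).
move=> x; have [j jr [-> _ ->]] := classified_class fG uQ gsG wfg gsE sg g4_classify x.
by case: j jr => [|[|[|[|[|[|[|j]]]]]]] //= _; split.
Qed.

Lemma ST12_classification :
  [seq rG g | g <- gs] = [seq P *m s *m invmx P | s <- ST_gens C 2 12] ->
  supports rG (fun x => #[x]%g = 3%N \/ #[x]%g = 6%N) /\ form_dim rG 2.
Proof.
move=> gsP; have sg : size gs = 2%N by rewrite -(size_map rG) gsP size_map.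
have uQ := basis_unit (Ei2 C) uP g12_basis_check.
have gsE := basis_gens uP gsP g12_scaledE erefl g12_basis_check.
have wfg : all (swf 2) g12_gens by vm_compute.
split; last exact: (classified_dim fG uQ gsG wfg gsE sg g12_classify).
move=> x; have [j jr [-> _ ->]] := classified_class fG uQ gsG wfg gsE sg g12_classify x.
by case: j jr => [|[|[|[|[|[|[|[|j]]]]]]]] //= _; split=> //;
  by [case | left | right].
Qed.

End RankTwo.

Lemma ST24_classification (gT : finGroupType) (rG : mx_representation C [set: gT] 3)
    (P : 'M[C]_3) (gs : seq gT) :
  mx_faithful rG -> P \in unitmx -> <<[set:: gs]>>%g = [set: gT] ->
  [seq rG g | g <- gs] = [seq P *m s *m invmx P | s <- ST_gens C 3 24] ->
  supports rG (fun x => #[x]%g = 3%N \/ (#[x]%g = 4%N /\ \det (rG x) = 1)) /\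
  form_dim rG 2.
Proof.
move=> fG uP gsG gsP; have sg : size gs = 3%N by rewrite -(size_map rG) gsP size_map.
move: gsP; rewrite (ST_gens_roots (E := Ek C) (i := n0) (w := n0) (t := Zk_k) 3) //;
  last by rewrite Zk_kE.
rewrite -/g24_roots => gsP; have rok : refl_check 3 g24_roots by vm_compute.
have AE i := reflKsE (Ek C) i rok.
have uQ := basis_unit (Ek C) uP g24_basis_check.
have gsE := basis_gens uP gsP AE erefl g24_basis_check.
have wfg : all (swf 3) g24_gens by vm_compute.
split; last exact: (classified_dim fG uQ gsG wfg gsE sg g24_classify).
move=> x; have [j jr [-> -> ->]] := classified_class fG uQ gsG wfg gsE sg g24_classify x.
rewrite emx_det3;
pose d j := Ek C (sdet3 (nth (sone 3) [seq sword 3 g24_gens w | w <- g24_reps] j)).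
(* Representatives 2 and 10 both have order 4, and only the determinant tells them apart. *)
rewrite -/(d j); have d2 : d 2 = 1 by rewrite -(ev1 (Ek C)); apply: ev_eq; vm_compute.
have d10 : d 10 <> 1.
  by apply/eqP; rewrite -subr_eq0 -(ev1 (Ek C)) -evN -evD; apply: ev_nz; vm_compute.
(* With [d] abstracted, the case split on the class sees just the two determinants that matter. *)
rewrite size_map in jr; move: (d) d2 d10 => f f2 f10.
case: j jr => [|[|[|[|[|[|[|[|[|[|[|[|j]]]]]]]]]]]] //= _; split=> //;
  by [case=> // -[] | left | right].
Qed.

End Classification.

Theorem mainTheorem3 (R : realType) (k : nat)
    (gT : finGroupType) (n : nat) (rG : mx_representation R[i] [set: gT] n)
    (hk : (4 <= k <= 34)%N) (hreal : k \notin [:: 23; 28; 30]%N)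
    (hG : is_ST_group k rG) :
  (k \notin [:: 4; 12; 24]%N ->
     forall a : {ffun gT -> 'M[R[i]]_n}, graded_hecke rG a ->
     forall g : gT, a g = 0) /\
  (k = 4%N ->
     (forall g : gT,
        (exists a : {ffun gT -> 'M[R[i]]_n}, graded_hecke rG a /\ a g <> 0)
          <-> #[g]%g = 4%N) /\
     (exists U : {vspace {ffun gT -> 'M[R[i]]_n}},
        (forall a, a \in U <-> graded_hecke rG a) /\ \dim U = 1%N)) /\
  (k = 12%N ->
     (forall g : gT,
        (exists a : {ffun gT -> 'M[R[i]]_n}, graded_hecke rG a /\ a g <> 0)
          <-> (#[g]%g = 3%N \/ #[g]%g = 6%N)) /\
     (exists U : {vspace {ffun gT -> 'M[R[i]]_n}},
        (forall a, a \in U <-> graded_hecke rG a) /\ \dim U = 2%N)) /\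
  (k = 24%N ->
     (forall g : gT,
        (exists a : {ffun gT -> 'M[R[i]]_n}, graded_hecke rG a /\ a g <> 0)
          <-> (#[g]%g = 3%N \/ (#[g]%g = 4%N /\ \det (rG g) = 1))) /\
     (exists U : {vspace {ffun gT -> 'M[R[i]]_n}},
        (forall a, a \in U <-> graded_hecke rG a) /\ \dim U = 2%N)).
Proof.
case: hG => nk fG [gs [P [uP gsG gsP]]].
have GP a : graded_hecke rG a <-> drinfeld rG a.
  by apply: graded_heckeP; rewrite pnatr_eq0.
have transfer (good : gT -> Prop) d : supports rG good /\ form_dim rG d ->
    (forall g, (exists a : {ffun gT -> 'M[R[i]]_n}, graded_hecke rG a /\ a g <> 0)
       <-> good g) /\
    (exists U : {vspace {ffun gT -> 'M[R[i]]_n}},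
        (forall a, a \in U <-> graded_hecke rG a) /\ \dim U = d).
  case=> sP [U [UP dU]]; split=> [g|].
    rewrite -sP; split=> -[a [ga ag]]; exists a; split=> //; exact/GP.
  by exists U; split=> // a; rewrite UP GP.
split; [|split; [|split]] => kE.
- move=> a /GP da g.
  (* The remaining indices are sorted by method: scalars of the rank 2 generators, scalar powers of
     a product of reflections, and the certificates of G_33. *)
  have {hk hreal kE} : 
    [|| k \in [:: 5; 6; 7; 8; 9; 10; 11; 13; 14; 15; 16; 17; 18; 19; 20; 21; 22],
      k \in [:: 25; 26; 27; 29; 31; 32; 34] | k == 33]%N.
    move: k hk hreal kE {nk gsP}; do 35?[case=> [//|]]; by [].
  case/or3P => [k2|kh|/eqP k33].
  + have n2 : n = 2%N.
      by rewrite nk; move: k k2 {nk gsP}; do 23?[case=> [//|]].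
    by move: nk => _; subst n; exact: (ST_rank2_vanish fG uP gsP k2 da).
  + exact: (ST_high_rank_vanish fG uP nk kh gsP da).
  + by move: nk; rewrite k33 => nk; subst k n; exact: (ST33_vanish fG uP gsG gsP da).
- by subst k n; apply/transfer/(ST4_classification fG uP gsG gsP).
- by subst k n; apply/transfer/(ST12_classification fG uP gsG gsP).
- by subst k n; apply/transfer/(ST24_classification fG uP gsG gsP).
Qed.
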